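(* Let $d=3$, let $\Omega\subset\mathbb{R}^3$ be an open and bounded domain with Lipschitz boundary, and let $s\in[3,4]$. Let $\nu,\kappa\in C^{0,1}(\mathbb{R})$, with Lipschitz constants $\mathcal{L}_\nu,\mathcal{L}_\kappa$, satisfy $\nu_-\le\nu(r)\le\nu_+$ and $\kappa_-\le\kappa(r)\le\kappa_+$ for all $r\in\mathbb{R}$, with positive constants $\nu_\pm,\kappa_\pm$. Let $\mathbf{f}\in\mathbf{H}^{-1}(\Omega)$ and $g\in H^{-1}(\Omega)$. Assume that the coupled problem has a weak solution $(\mathbf{u}_1,\mathsf{p}_1,T_1)\in(\mathbf{W}^{1,3}(\Omega)\cap\mathbf{H}_0^1(\Omega))\times L_0^2(\Omega)\times(W^{1,3}(\Omega)\cap H_0^1(\Omega))$ such that $$\frac{\mathcal{C}_N}{\nu_-^2}\|\mathbf{f}\|_{\mathbf{H}^{-1}(\Omega)}+\frac{\mathcal{L}_\nu\mathcal{C}_{6\hookrightarrow2}\mathcal{C}_{4\hookrightarrow2}^2\|g\|_{H^{-1}(\Omega)}\|\nabla\mathbf{u}_1\|_{\mathbf{L}^3(\Omega)}}{\nu_-\kappa_-\left(\kappa_--\mathcal{L}_\kappa\mathcal{C}_{6\hookrightarrow2}\|\nabla T_1\|_{\mathbf{L}^3(\Omega)}\right)}<1,\qquad \mathcal{L}_\kappa\mathcal{C}_{6\hookrightarrow2}\|\nabla T_1\|_{\mathbf{L}^3(\Omega)}<\kappa_-.$$ Then the coupled problem has no other weak solution $(\mathbf{u}_2,\mathsf{p}_2,T_2)\in\mathbf{H}_0^1(\Omega)\times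 L_0^2(\Omega)\times H_0^1(\Omega)$.
   Context: Bold letters denote $\mathbb{R}^d$-valued functions and their spaces; $|\cdot|$ is the Euclidean norm. $L_0^2(\Omega)$ is the space of $L^2(\Omega)$ functions with zero mean. $H^{-1}(\Omega)$ and $\mathbf{H}^{-1}(\Omega)$ are the duals of $H_0^1(\Omega)$ and $\mathbf{H}_0^1(\Omega)$, with dual norms taken with respect to the norm $\|\nabla\cdot\|_{L^2(\Omega)}$. Weak solution of the coupled problem: $(\mathbf{u},\mathsf{p},T)\in\mathbf{H}_0^1(\Omega)\times L_0^2(\Omega)\times H_0^1(\Omega)$ such that for all $(\mathbf{v},\mathsf{q},S)\in\mathbf{H}_0^1(\Omega)\times L_0^2(\Omega)\times H_0^1(\Omega)$ $$\int_\Omega\left(\nu(T)\nabla\mathbf{u}\cdot\nabla\mathbf{v}+(\mathbf{u}\cdot\nabla)\mathbf{u}\cdot\mathbf{v}+\mathbf{u}\cdot\mathbf{v}+|\mathbf{u}|^{s-2}\mathbf{u}\cdot\mathbf{v}-\mathsf{p}\,\mathrm{div}\,\mathbf{v}\right)\mathrm{d}x=\langle\mathbf{f},\mathbf{v}\rangle,$$ $$\int_\Omega\mathsf{q}\,\mathrm{div}\,\mathbf{u}\,\mathrm{d}x=0,\qquad\int_\Omega\left(\kappa(T)\nabla T\cdot\nabla S+(\mathbf{u}\cdot\nabla T)S\right)\mathrm{d}x=\langle g,S\rangle.$$ Constants. $\mathcal{C}_N>0$ is a constant such that $\left|\int_\Omega(\mathbf{u}\cdot\nabla)\mathbf{v}\cdot\mathbf{w}\,\mathrm{d}x\right|\le\mathcal{C}_N\|\nabla\mathbf{u}\|_{\mathbf{L}^2(\Omega)}\|\nabla\mathbf{v}\|_{\mathbf{L}^2(\Omega)}\|\nabla\mathbf{w}\|_{\mathbf{L}^2(\Omega)}$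 for all $\mathbf{u},\mathbf{v},\mathbf{w}\in\mathbf{H}_0^1(\Omega)$. $\mathcal{C}_{p\hookrightarrow2}$ is the best constant in $\|v\|_{L^p(\Omega)}\le\mathcal{C}_{p\hookrightarrow2}\|\nabla v\|_{\mathbf{L}^2(\Omega)}$ for $v\in H_0^1(\Omega)$; the same symbol is used for vector-valued functions in $\mathbf{H}_0^1(\Omega)$. *)

(* Defs.v *)
From HB Require Import structures.
From mathcomp Require Import all_boot all_order all_algebra.
From mathcomp Require Import all_classical all_reals all_analysis.
Set Implicit Arguments.
Unset Strict Implicit.
Unset Printing Implicit Defensive.
Import Order.TTheory GRing.Theory Num.Theory numFieldNormedType.Exports.
Local Open Scope classical_set_scope.
Local Open Scope ring_scope.

(* Three-dimensional space is the product R * R * R, which carries both the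
   product topology and the product sigma-algebra. *)
Notation E3 R := (R * R * R)%type.

(* Functions on an open set Omega are represented by total functions on E3 R of
   which only the values on Omega matter; vector fields are families of three
   scalar components. *)
Notation sfield R := (E3 R -> R).
Notation vfield R := ('I_3 -> E3 R -> R).

Section Space.
Context {R : realType}.

Definition leb3 : {measure set (measurableTypeR R * measurableTypeR R
                                * measurableTypeR R) -> \bar R} :=
  (lebesgue_measure \x lebesgue_measure \x lebesgue_measure)%E.

Definition coor3 (x : E3 R) (i : 'I_3) : R := [:: x.1.1; x.1.2; x.2]`_i.

Definition evec (i : 'I_3) : E3 R :=
  ((i == 0 :> nat)%:R, (i == 1 :> nat)%:R, (i == 2 :> nat)%:R).

Definition enorm (a : 'I_3 -> R) : R := Num.sqrt (\sum_i a i ^+ 2).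

(* Near each boundary point, in some orthonormal coordinate system y = x Q,
   Omega is the strict epigraph of a Lipschitz function of (y_0, y_1). *)
Definition lipschitz_boundary (Omega : set (E3 R)) : Prop :=
  forall x0, (closure Omega `\` interior Omega) x0 ->
  exists (Q : 'M[R]_3) (gamma : R * R -> R),
    [/\ Q *m Q^T = 1%:M, lipschitz gamma &
      let y (x : E3 R) := (\row_i coor3 x i) *m Q in
      \forall x \near x0, Omega x <->
        gamma (y x ord0 (inord 0), y x ord0 (inord 1)) < y x ord0 (inord 2)].

Definition lipschitz_domain (Omega : set (E3 R)) : Prop :=
  [/\ Omega !=set0, open Omega, connected Omega, bounded_set Omega &
      lipschitz_boundary Omega].

End Space.

Section Sobolev.
Context {R : realType} (Omega : set (E3 R)).

Definition in_Lp (p : R) (f : sfield R) : Prop := f \_ Omega \in Lfun leb3 p%:E.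

Definition eLp_norm (p : R) (f : sfield R) : \bar R :=
  'N[leb3]_(p%:E)[EFin \o (f \_ Omega)]%E.

Definition Lp_norm (p : R) (f : sfield R) : R := fine (eLp_norm p f).

Definition L20 (q : sfield R) : Prop :=
  in_Lp 2 q /\ \int[leb3]_(x in Omega) q x = 0.

Definition partials (l : seq 'I_3) (phi : sfield R) : sfield R :=
  foldr (fun i (f : sfield R) => 'D_(evec i) f) phi l.

Definition smooth (phi : sfield R) : Prop :=
  forall l, continuous (partials l phi) /\
    forall (x : E3 R) i, derivable (partials l phi) x (evec i).

Definition test_fun (phi : sfield R) : Prop :=
  smooth phi /\ exists K : set (E3 R),
    [/\ compact K, K `<=` Omega & forall x, ~ K x -> phi x = 0].

Definition loc_integrable (f : sfield R) : Prop :=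
  forall K : set (E3 R), compact K -> K `<=` Omega ->
    leb3.-integrable K (EFin \o f).

Definition weak_partial (i : 'I_3) (u g : sfield R) : Prop :=
  [/\ loc_integrable u, loc_integrable g & forall phi, test_fun phi ->
    \int[leb3]_(x in Omega) (u x * 'D_(evec i) phi x) =
    - \int[leb3]_(x in Omega) (g x * phi x)].

(* A chosen representative of the i-th weak derivative, which is unique up to
   equality almost everywhere on Omega (a junk value if there is none). *)
Definition wpd (i : 'I_3) (u : sfield R) : sfield R :=
  xget (fun=> 0) [set g | weak_partial i u g].

Definition W1p (p : R) (u : sfield R) : Prop :=
  in_Lp p u /\ forall i, exists2 g, weak_partial i u g & in_Lp p g.

Definition grad_norm (p : R) (u : sfield R) : R :=
  Lp_norm p (fun x => enorm (fun i => wpd i u x)).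

Definition H10 (u : sfield R) : Prop :=
  W1p 2 u /\ exists phi : nat -> sfield R,
    [/\ forall n, test_fun (phi n),
        (fun n => Lp_norm 2 (u \- phi n)) @ \oo --> (0 : R) &
        (fun n => grad_norm 2 (u \- phi n)) @ \oo --> (0 : R)].

Definition vW1p (p : R) (u : vfield R) : Prop := forall i, W1p p (u i).

Definition vH10 (u : vfield R) : Prop := forall i, H10 (u i).

Definition vgrad_norm (p : R) (u : vfield R) : R :=
  Lp_norm p (fun x => Num.sqrt (\sum_i \sum_j wpd j (u i) x ^+ 2)).

Definition divergence (u : vfield R) : sfield R :=
  fun x => \sum_i wpd i (u i) x.

(* Stated in the extended reals, so that finiteness of the L^p norm is part of
   the inequality. *)
Definition embedding_const (p C : R) : Prop :=
  forall v, H10 v -> (eLp_norm p v <= (C * grad_norm 2 v)%:E)%E.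

Definition best_embedding_const (p C : R) : Prop :=
  embedding_const p C /\ forall C', embedding_const p C' -> C <= C'.

(* (u . grad) v . w *)
Definition convection (u v w : vfield R) : sfield R :=
  fun x => \sum_i (\sum_j u j x * wpd j (v i) x) * w i x.

Definition convection_const (C : R) : Prop :=
  forall u v w, vH10 u -> vH10 v -> vH10 w ->
    `|\int[leb3]_(x in Omega) convection u v w x|
    <= C * vgrad_norm 2 u * vgrad_norm 2 v * vgrad_norm 2 w.

End Sobolev.

Section Dual.
Context {R : realType} {X : lmodType R} (V : X -> Prop) (nrm : X -> R).

(* Bounded linear functionals on the subspace V of X, normed by nrm; values
   outside V are irrelevant. *)
Definition in_dual (F : X -> R) : Prop :=
  (forall (a : R) u v, V u -> V v -> F (a *: u + v) = a * F u + F v) /\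
  exists C : R, forall v, V v -> `|F v| <= C * nrm v.

Definition dual_norm (F : X -> R) : R :=
  sup [set `|F v| | v in [set v | V v /\ nrm v <= 1]].

End Dual.

Section Dual_H10.
Context {R : realType} (Omega : set (E3 R)).

Definition Hm1 : (sfield R -> R) -> Prop :=
  in_dual (H10 Omega) (grad_norm Omega 2).
Definition Hm1_norm : (sfield R -> R) -> R :=
  dual_norm (H10 Omega) (grad_norm Omega 2).

Definition vHm1 : (vfield R -> R) -> Prop :=
  in_dual (vH10 Omega) (vgrad_norm Omega 2).
Definition vHm1_norm : (vfield R -> R) -> R :=
  dual_norm (vH10 Omega) (vgrad_norm Omega 2).

End Dual_H10.

Definition weak_solution {R : realType} (Omega : set (E3 R)) (s : R)
    (nu kappa : R -> R) (f : vfield R -> R) (g : sfield R -> R)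
    (u : vfield R) (p T : sfield R) : Prop :=
  [/\ vH10 Omega u, L20 Omega p, H10 Omega T &
  forall (v : vfield R) (q S : sfield R),
    vH10 Omega v -> L20 Omega q -> H10 Omega S ->
    [/\ \int[leb3]_(x in Omega)
          (nu (T x) * (\sum_i \sum_j wpd Omega j (u i) x * wpd Omega j (v i) x)
           + convection Omega u u v x
           + \sum_i u i x * v i x
           + enorm (fun i => u i x) `^ (s - 2) * (\sum_i u i x * v i x)
           - p x * divergence Omega v x) = f v,
        \int[leb3]_(x in Omega) (q x * divergence Omega u x) = 0 &
        \int[leb3]_(x in Omega)
          (kappa (T x) * (\sum_i wpd Omega i T x * wpd Omega i S x)
           + (\sum_i u i x * wpd Omega i T x) * S x) = g S]].

(* Main.v *)
Require Import Defs.
From HB Require Import structures.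
From mathcomp Require Import all_boot all_order all_algebra.
From mathcomp Require Import all_classical all_reals all_analysis.
From mathcomp Require Import measurable_realfun.
From mathcomp Require Import ring lra.
Set Implicit Arguments.
Unset Strict Implicit.
Unset Printing Implicit Defensive.
Import Order.TTheory GRing.Theory Num.Theory numFieldNormedType.Exports.
Local Open Scope classical_set_scope.
Local Open Scope ring_scope.

(** Let W = u2 - u1 and th = T2 - T1. The difference of the two momentum equations
    is tested with W. The pressures drop out since div W = 0, and the terms u and
    |u|^(s-2) u are monotone, hence have the good sign. The viscous terms leave
    nu(T2) |grad W|^2 and (nu(T2) - nu(T1)) grad u1 . grad W; the latter is at most
    L_nu |th| |grad u1| |grad W|, which Hoelder's inequality with exponents 6, 3, 2
    controls. The convective terms leave (u2 . grad) W . W, whose integral is 0,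
    and (W . grad) u1 . W, which C_N controls. This is [velocity_difference]; the
    heat equations tested with th give [temperature_difference] in the same way.

    Testing the equations of the first solution with that solution itself bounds
    the norms of grad u1 and grad T1 by those of the data ([sol_grad_velocity],
    [sol_grad_temperature]). Eliminating the norm of grad th from the two estimates
    then yields, for the norm N of grad W, the inequality N^2 <= rho N^2, where
    rho < 1 is the left-hand side of the smallness assumption ([small_data_eq0]).
    So grad W and grad th vanish, and W = 0, th = 0 by the Sobolev embedding.

    It remains to compare the pressures. Now the momentum equations differ only in
    the pressure term, so p1 - p2 is orthogonal to all derivatives of test
    functions. Such a function is constant on a connected open set
    ([zero_gradient_cst]), and the constant is 0 because the pressures have zero
    mean.

    The argument rests on three facts about weak derivatives.
    - They are unique almost everywhere ([weak_partial_unique]), by the fundamental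
      lemma of the calculus of variations. Its test functions are products of bumps
      built from exp(-1/t), which approximate the indicators of open boxes.
    - The integral of (u . grad T) T vanishes if div u = 0 and T is in H^1_0
      ([transport_skew]): for a test function it is half the integral of
      u . grad (T^2), and the general case follows by density.
    - A function with zero weak gradient is constant. On a box, a smooth function of
      one variable with zero integral has a compactly supported primitive, so the
      integral of the function against a product of bumps depends only on the
      integrals of the factors; connectedness does the rest. *)

(** * Bump functions on the line *)

Section PointwiseRules.
Context {R : realType} {V : normedModType R}.
Implicit Types (f g : V -> R) (x v : V).

Lemma is_derive_mul f g x v df dg :
  is_derive x v f df -> is_derive x v g dg ->
  is_derive x v (fun y => f y * g y) (f x * dg + g x * df).
Proof. exact: is_deriveM. Qed.

Lemma is_derive_add f g x v df dg :
  is_derive x v f df -> is_derive x v g dg ->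
  is_derive x v (fun y => f y + g y) (df + dg).
Proof. exact: is_deriveD. Qed.

Lemma is_derive_exp f n x v df :
  is_derive x v f df ->
  is_derive x v (fun y => f y ^+ n) (n%:R * f x ^+ n.-1 * df).
Proof.
move=> fdf; rewrite (_ : (fun y => _) = f ^+ n); first exact: is_deriveX.
by apply/funext => y; rewrite fctE.
Qed.

Lemma is_derive_cst_line f x v : (forall h : R, f (h *: v + x) = f x) ->
  is_derive x v f 0.
Proof.
move=> fx; have E : (fun h : R => h^-1 *: (f (h *: v + x) - f x)) = cst 0.
  by apply/funext => h; rewrite fx subrr scaler0.
apply: DeriveDef; first by rewrite /derivable E; exact: is_cvg_cst.
by rewrite /derive E; apply: lim_cst.
Qed.

End PointwiseRules.

Section Smooth1.
Context {R : realType}.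
Implicit Types (f g F : R -> R) (t : R).

Definition smooth1 f := forall n t, derivable (derive1n n f) t 1.

(** Smoothness is shown by exhibiting a class of functions that is stable under
    differentiation, so that no derivative of higher order is ever computed. *)
Lemma smooth1_coind (S : set (R -> R)) :
  (forall f, S f -> (forall t, derivable f t 1) /\ S (derive1 f)) ->
  forall f, S f -> smooth1 f.
Proof.
move=> SS f Sf n; suff : S (derive1n n f) by move/SS => [].
by elim: n => //= n /SS[_].
Qed.

Lemma smooth1_derivable f t : smooth1 f -> derivable f t 1.
Proof. by move=> /(_ 0%N); exact. Qed.

Lemma smooth1_continuous f : smooth1 f -> continuous f.
Proof.
move=> sf t; apply: differentiable_continuous.
by apply/derivable1_diffP; exact: smooth1_derivable.
Qed.

Lemma smooth1_derive f : smooth1 f -> smooth1 (derive1 f).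
Proof. by move=> sf n t; have := sf n.+1 t; rewrite derive1Sn. Qed.

(** The function exp(-1/t), multiplied by t^-k because all its derivatives are
    combinations of such products. *)
Definition flat (k : nat) t : R :=
  if 0 < t then t^-1 ^+ k * expR (- t^-1) else 0.

Lemma flat_ge0 k t : 0 <= flat k t.
Proof.
rewrite /flat; case: ifPn => // t0.
by rewrite mulr_ge0 ?expR_ge0 ?exprn_ge0 ?invr_ge0 ?ltW.
Qed.

Lemma flat_npos k t : t <= 0 -> flat k t = 0.
Proof. by rewrite /flat leNgt => /negbTE ->. Qed.

Lemma flat0_le1 t : flat 0 t <= 1.
Proof.
rewrite /flat; case: ifPn => // t0.
by rewrite expr0 mul1r expR_le1 oppr_le0 invr_ge0 ltW.
Qed.

(** The exponential series bounds y^(k+1) by (k+1)! exp y; take y = 1/t. *)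
Lemma flat_le k t : 0 < t -> flat k t <= k.+1`!%:R * t.
Proof.
move=> t0; rewrite /flat t0.
have y0 : 0 < t^-1 by rewrite invr_gt0.
have fk : 0 < k.+1`!%:R :> R by rewrite ltr0n fact_gt0.
have yk : t^-1 ^+ k.+1 <= k.+1`!%:R * expR t^-1.
  rewrite -ler_pdivrMl// mulrC.
  by apply: le_trans (expR_ge1Dxn k (ltW y0)); rewrite ler_wpDl.
rewrite expRN ler_pdivrMr ?expR_gt0//.
rewrite -[X in _ <= X]mulrAC -ler_pdivrMr//.
by move: yk; rewrite exprSr.
Qed.

(** The only delicate point is t = 0, where the difference quotient of [flat k]
    is [flat k.+1], which tends to 0 by [flat_le]. *)
Lemma is_derive_flat k t :
  is_derive t (1 : R) (flat k) (flat k.+2 t - k%:R * flat k.+1 t).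
Proof.
have [t0|t0|->] := ltgtP t 0.
- rewrite !flat_npos ?(ltW t0)// mulr0 subr0.
  apply: (near_eq_is_derive (f := cst 0)).
    near=> x; rewrite flat_npos//; apply: ltW; near: x.
    exact: lt_nbhsl.
- apply: (near_eq_is_derive (f := fun t => t^-1 ^+ k * expR (- t^-1))).
    near=> x; rewrite /flat ifT//; near: x; exact: lt_nbhsr.
  have t00 : t != 0 by rewrite gt_eqF.
  have dV : is_derive t (1 : R) (fun y : R => y^-1) (- t ^- 2 *: 1).
    exact: is_deriveV.
  have dN : is_derive t (1 : R) (fun y : R => - y^-1) (- (- t ^- 2 *: 1)).
    exact: is_deriveN.
  have dE : is_derive t (1 : R) (fun y : R => expR (- y^-1))
      (expR (- t^-1) * (- (- t ^- 2 *: 1))).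
    exact: is_derive1_comp.
  have dP := is_derive_mul (is_derive_exp k dV) dE.
  apply: (is_derive_eq dP).
  rewrite /flat t0 /= -![_ *: _]/(_ * _).
  case: k {dP} => [|k] /=; first by field.
  by rewrite !exprS; field.
- rewrite !flat_npos// mulr0 subr0.
  have H : (fun h : R => h^-1 *: (flat k (h *: 1 + 0) - flat k 0)) @ 0^' --> (0 : R).
    apply/cvgrPdist_le => e e0 /=; near=> h.
    rewrite sub0r normrN.
    rewrite (flat_npos k (lexx 0)) subr0 addr0 -![_ *: _]/(_ * _) mulr1.
    have [h0|h0] := leP h 0.
      by rewrite flat_npos// mulr0 normr0 ltW.
    have -> : h^-1 * flat k h = flat k.+1 h by rewrite /flat h0 mulrA exprS.
    rewrite ger0_norm ?flat_ge0//.
    apply: (le_trans (flat_le _ h0)).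
    rewrite -ler_pdivlMl ?ltr0n ?fact_gt0//.
    rewrite -[h]gtr0_norm//.
    near: h; apply: dnbhs0_le.
    by rewrite mulr_gt0// invr_gt0 ltr0n fact_gt0.
  apply: DeriveDef; first by apply/cvg_ex; exists 0.
  exact/cvg_lim.
Unshelve. all: by end_near. Qed.

(** The class of functions to which [smooth1_coind] is applied. *)
Inductive flat_alg : (R -> R) -> Prop :=
| flat_alg_cst c : flat_alg (cst c)
| flat_alg_flat k (a b : R) : flat_alg (fun t => flat k (a * t + b))
| flat_alg_add f g : flat_alg f -> flat_alg g -> flat_alg (f \+ g)
| flat_alg_mul f g : flat_alg f -> flat_alg g -> flat_alg (f \* g).

Lemma flat_alg_smooth1 f : flat_alg f -> smooth1 f.
Proof.
apply: smooth1_coind => {}f.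
suff H : flat_alg f -> exists df, flat_alg df /\ forall t, is_derive t (1 : R) f (df t).
  move=> /H[df [adf fdf]]; split; first by move=> t; exact: ex_derive.
  suff -> : (derive1 f) = df by [].
  by apply/funext => t; rewrite derive1E derive_val.
elim=> {f} [c|k a b|f g _ [df [af dfE]] _ [dg [ag dgE]]
           |f g af0 [df [af dfE]] ag0 [dg [ag dgE]]].
- exists (cst 0); split; [exact: flat_alg_cst | move=> t; exact: is_derive_cst].
- exists ((cst a) \* ((fun t => flat k.+2 (a * t + b)) \+
    (cst (- k%:R) \* (fun t => flat k.+1 (a * t + b))))); split.
    apply: flat_alg_mul; first exact: flat_alg_cst.
    apply: flat_alg_add; first exact: flat_alg_flat.
    by apply: flat_alg_mul; [exact: flat_alg_cst|exact: flat_alg_flat].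
  move=> t.
  have d1 : is_derive t (1:R) (fun t => a * t + b) a.
    have H := is_deriveD (is_deriveZ a (is_derive_id t (1:R))) (is_derive_cst b t (1:R)).
    by apply: (is_derive_eq H); rewrite addr0 -[_ *: _]/(_ * _) mulr1.
  have d2 : is_derive t (1:R) (fun t => flat k (a * t + b))
      ((flat k.+2 (a * t + b) - k%:R * flat k.+1 (a * t + b)) * a).
    by apply: (is_derive1_comp (f := flat k)); exact: is_derive_flat.
  by apply: (is_derive_eq d2); rewrite /= mulrC mulNr.
- exists (df \+ dg); split; first exact: flat_alg_add.
  by move=> t; exact: is_deriveD.
- exists ((f \* dg) \+ (g \* df)); split.
    by apply: flat_alg_add; exact: flat_alg_mul.
  by move=> t; exact: is_deriveM.
Qed.

(** For every [n >= 0] the support lies in [a, b]; as [n] grows, the bumps tend to the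
    indicator of the open interval. *)
Definition bump n a b t := flat 0 (n * (t - a)) * flat 0 (n * (b - t)).

Lemma bump_smooth1 n a b : smooth1 (bump n a b).
Proof.
apply: flat_alg_smooth1.
have -> : bump n a b = (fun t => flat 0 (n * t + (- n * a))) \*
    (fun t => flat 0 (- n * t + n * b)).
  by apply/funext => t /=; rewrite /bump; congr (flat _ _ * flat _ _); ring.
by apply: flat_alg_mul; exact: flat_alg_flat.
Qed.

Lemma bump_ge0 n a b t : 0 <= bump n a b t.
Proof. by rewrite mulr_ge0 ?flat_ge0. Qed.

Lemma bump_le1 n a b t : bump n a b t <= 1.
Proof. by rewrite -[1]mul1r ler_pM ?flat_ge0 ?flat0_le1. Qed.

Lemma bump_out n a b t : 0 <= n -> t \notin `]a, b[ -> bump n a b t = 0.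
Proof.
move=> n0; rewrite in_itv/= negb_and -!leNgt => /orP[ta|bt].
- by rewrite /bump flat_npos ?mul0r// mulr_ge0_le0// subr_le0.
- by rewrite /bump mulrC flat_npos ?mul0r// mulr_ge0_le0// subr_le0.
Qed.

Lemma flat0_cvg1 t : 0 < t -> flat 0 (n.+1%:R * t) @[n --> \oo] --> (1 : R).
Proof.
move=> t0.
have -> : (fun n => flat 0 (n.+1%:R * t)) = (fun n => expR (- (harmonic n * t^-1))).
  apply/funext => n; rewrite /flat mulr_gt0 ?ltr0n// expr0 mul1r invfM.
  by [].
rewrite -[X in _ --> X]expR0; apply: continuous_cvg; first exact: continuous_expR.
rewrite -[X in _ --> X]oppr0; apply: cvgN.
rewrite -[X in _ --> X](mul0r t^-1); apply: cvgMl.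
exact: cvg_harmonic.
Qed.

Lemma bump_cvg a b t :
  bump n.+1%:R a b t @[n --> \oo] --> (\1_`]a, b[%classic t : R).
Proof.
rewrite indicE; have [tab|tab] := boolP (t \in `]a, b[); last first.
  rewrite mem_setE (negbTE tab) /=.
  rewrite (_ : (fun n => _) = cst 0); first exact: cvg_cst.
  by apply/funext => n; rewrite bump_out.
rewrite mem_setE tab /=; move: tab; rewrite in_itv /= => /andP[ta tb].
rewrite -[X in _ --> X]mulr1.
by apply: cvgM; apply: flat0_cvg1; rewrite subr_gt0.
Qed.

End Smooth1.

(** * Smooth functions and test functions in space *)

Section Smooth3.
Context {R : realType}.
Implicit Types (f g phi : sfield R) (F : R -> R) (x : E3 R).

Lemma smooth_coind (S : set (sfield R)) :
  (forall f, S f -> continuous f /\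
     forall i, (forall x, derivable f x (evec i)) /\ S ('D_(evec i) f)) ->
  forall f, S f -> smooth f.
Proof.
move=> SS f Sf l; suff : S (partials l f).
  by move=> /SS[cf df]; split=> // x i; have [] := df i.
by elim: l => //= i l /SS[_ /(_ i)[]].
Qed.

Lemma smooth_continuous f : smooth f -> continuous f.
Proof. by move=> /(_ [::])[]. Qed.

Lemma smooth_is_derive f x i : smooth f ->
  is_derive x (evec i) f ('D_(evec i) f x).
Proof. by move=> /(_ [::])[_ df]; apply: derivableP; exact: df. Qed.

Lemma smooth_derive f i : smooth f -> smooth ('D_(evec i) f).
Proof.
move=> sf l; suff -> : partials l ('D_(evec i) f) = partials (rcons l i) f.
  exact: sf.
by rewrite /partials foldr_rcons.
Qed.

Lemma coor3_continuous i : continuous (fun x => coor3 x i).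
Proof.
move=> x; rewrite /coor3; case: i => -[|[|[|//]]] i3 /=.
- by apply: (@continuous_comp _ _ _ (fun x : E3 R => x.1) fst);
    [exact: cvg_fst|exact: cvg_fst].
- by apply: (@continuous_comp _ _ _ (fun x : E3 R => x.1) snd);
    [exact: cvg_fst|exact: cvg_snd].
- exact: cvg_snd.
Qed.

Lemma norm_coor3 x i : `|coor3 x i| <= `|x|.
Proof.
case: x => -[x y] z; case: i => -[|[|[|//]]] hi; rewrite /coor3 /=.
- by rewrite prod_normE /= le_max prod_normE /= le_max lexx.
- by rewrite prod_normE /= le_max prod_normE /= le_max lexx orbT.
- by rewrite prod_normE /= le_max lexx orbT.
Qed.

Lemma coor3_line (h : R) x i j :
  coor3 (h *: evec j + x) i = h * (j == i)%:R + coor3 x i.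
Proof.
case: x => -[x y] z; case: i => -[|[|[|//]]] hi; case: j => -[|[|[|//]]] hj;
  by rewrite /coor3 /evec /=.
Qed.

Lemma is_derive_coor F x i j : derivable F (coor3 x i) 1 ->
  is_derive x (evec j) (fun x => F (coor3 x i))
    ((j == i)%:R * derive1 F (coor3 x i)).
Proof.
move=> dF; have [ji|ij] := eqVneq j i.
  subst i.
  have E : (fun h : R => h^-1 *: ((fun x => F (coor3 x j)) (h *: evec j + x)
      - F (coor3 x j))) =
      (fun h => h^-1 *: (F (h *: 1 + coor3 x j) - F (coor3 x j))).
    by apply/funext => h /=; rewrite coor3_line eqxx.
  apply: DeriveDef; first by rewrite /derivable E.
  by rewrite /derive E mul1r derive1E.
rewrite mul0r; apply: is_derive_cst_line => h.
by rewrite coor3_line (negbTE ij) mulr0 add0r.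
Qed.

(** Stable under partial derivatives; it contains what is already known to be
    smooth, so that sums, products and functions of one coordinate are all
    handled by one use of [smooth_coind]. *)
Inductive smooth_alg : sfield R -> Prop :=
| smooth_alg_base f : smooth f -> smooth_alg f
| smooth_alg_coor F i : smooth1 F -> smooth_alg (fun x => F (coor3 x i))
| smooth_alg_cst c : smooth_alg (cst c)
| smooth_alg_add f g : smooth_alg f -> smooth_alg g -> smooth_alg (f \+ g)
| smooth_alg_mul f g : smooth_alg f -> smooth_alg g -> smooth_alg (f \* g).

Lemma smooth_alg_smooth f : smooth_alg f -> smooth f.
Proof.
apply: smooth_coind => {}f.
suff H : smooth_alg f -> continuous f /\
    forall i, exists df, smooth_alg df /\ forall x, is_derive x (evec i) f (df x).
  move=> /H[cf df]; split=> // i; have [d [ad fd]] := df i; split.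
    by move=> x; exact: ex_derive.
  suff -> : 'D_(evec i) f = d by [].
  by apply/funext => x; rewrite derive_val.
elim=> {f} [f sf|F j sF|c|f g _ [cf df] _ [cg dg]|f g af [cf df] ag [cg dg]].
- split=> [|i]; first exact: smooth_continuous.
  exists ('D_(evec i) f); split; first exact/smooth_alg_base/smooth_derive.
  by move=> x; exact: smooth_is_derive.
- split=> [x|i].
    apply: continuous_comp; first exact: coor3_continuous.
    exact: smooth1_continuous.
  exists (cst (i == j)%:R \* (fun x => derive1 F (coor3 x j))); split.
    apply: smooth_alg_mul; first exact: smooth_alg_cst.
    exact/smooth_alg_coor/smooth1_derive.
  by move=> x; exact/is_derive_coor/smooth1_derivable.
- split=> [x|i]; first exact: cvg_cst.
  by exists (cst 0); split=> [|x]; [exact: smooth_alg_cst|exact: is_derive_cst].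
- split=> [x|i]; first exact: cvgD (cf x) (cg x).
  have [d [ad fd]] := df i; have [e [ae ge]] := dg i.
  exists (d \+ e); split; first exact: smooth_alg_add.
  by move=> x; exact: is_derive_add.
- split=> [x|i]; first exact: cvgM (cf x) (cg x).
  have [d [ad fd]] := df i; have [e [ae ge]] := dg i.
  exists (f \* e \+ g \* d); split.
    by apply: smooth_alg_add; exact: smooth_alg_mul.
  by move=> x; exact: is_derive_mul.
Qed.

Lemma smoothD f g : smooth f -> smooth g -> smooth (f \+ g).
Proof.
by move=> sf sg; apply/smooth_alg_smooth/smooth_alg_add; exact: smooth_alg_base.
Qed.

Lemma smoothM f g : smooth f -> smooth g -> smooth (f \* g).
Proof.
by move=> sf sg; apply/smooth_alg_smooth/smooth_alg_mul; exact: smooth_alg_base.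
Qed.

Lemma smooth_cst (c : R) : smooth (cst c : sfield R).
Proof. exact/smooth_alg_smooth/smooth_alg_cst. Qed.

Lemma smooth_coor F i : smooth1 F -> smooth (fun x : E3 R => F (coor3 x i)).
Proof. by move=> sF; exact/smooth_alg_smooth/smooth_alg_coor. Qed.

Definition tensor (F : 'I_3 -> R -> R) : sfield R := fun x => \prod_i F i (coor3 x i).

Lemma smooth_tensor (F : 'I_3 -> R -> R) : (forall i, smooth1 (F i)) -> smooth (tensor F).
Proof.
move=> sF; have -> : tensor F = (fun x => F 0 (coor3 x 0)) \*
    ((fun x => F 1 (coor3 x 1)) \* (fun x => F 2%:R (coor3 x 2%:R))).
  apply/funext => x; rewrite /tensor !big_ord_recl big_ord0 mulr1.
  by congr (F _ (coor3 _ _) * (F _ (coor3 _ _) * F _ (coor3 _ _))); exact: val_inj.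
by do 2?apply: smoothM; exact: smooth_coor.
Qed.

Lemma compact_closed3 (K : set (E3 R)) : compact K -> closed K.
Proof.
by move=> cK; apply: compact_closed cK; exact: (@norm_hausdorff R (R * R * R)%type).
Qed.

(** The complement of a compact set is open: [f] vanishes in a neighborhood of
    [x]. *)
Lemma derive_vanish (K : set (E3 R)) f i : compact K -> (forall x, ~ K x -> f x = 0) ->
  forall x, ~ K x -> 'D_(evec i) f x = 0.
Proof.
move=> cK f0 x nK.
have oK : open (~` K) by apply: closed_openC; exact: compact_closed3.
suff : is_derive x (evec i) f 0 by move=> ?; exact: derive_val.
apply: (near_eq_is_derive (f := cst 0)).
near=> y; rewrite [RHS]f0//; near: y; exact: open_nbhs_nbhs.
Unshelve. all: by end_near. Qed.

Section Test.
Variable Omega : set (E3 R).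

Lemma test_fun_vanish f : test_fun Omega f -> forall x, ~ Omega x -> f x = 0.
Proof. by move=> [_ [K [_ KO K0]]] x nO; apply: K0 => /KO. Qed.

Lemma test_funD f g : test_fun Omega f -> test_fun Omega g ->
  test_fun Omega (f \+ g).
Proof.
move=> [sf [K [cK KO K0]]] [sg [L [cL LO L0]]]; split; first exact: smoothD.
exists (K `|` L); split.
- exact: compactU.
- by rewrite subUset.
- by move=> x /= /not_orP[Kx Lx]; rewrite K0// L0// addr0.
Qed.

Lemma test_funMl f g : smooth f -> test_fun Omega g -> test_fun Omega (f \* g).
Proof.
move=> sf [sg [L [cL LO L0]]]; split; first exact: smoothM.
by exists L; split=> // x Lx /=; rewrite L0// mulr0.
Qed.

Lemma test_funZ (c : R) g : test_fun Omega g -> test_fun Omega (c *: g).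
Proof. by move=> tg; apply: (test_funMl (smooth_cst c) tg). Qed.

Lemma test_fun_derive f i : test_fun Omega f -> test_fun Omega ('D_(evec i) f).
Proof.
move=> [sf [K [cK KO K0]]]; split; first exact: smooth_derive.
by exists K; split=> //; exact: derive_vanish.
Qed.

End Test.
End Smooth3.

(** * Boxes and the three-dimensional Lebesgue measure *)

(* The almost everywhere filter occurs both bare and through [nbhs]. *)
#[global] Instance ae_leb3_filter {R : realType} :
  Filter (almost_everywhere (@leb3 R)).
Proof. exact: (@ae_filter_ringOfSetsType _ _ R leb3). Qed.

#[global] Instance ae_leb3_nbhs_filter {R : realType} :
  Filter (nbhs (almost_everywhere (@leb3 R))).
Proof. exact: ae_leb3_filter. Qed.

(* Measurability always refers to the product of the Borel sigma-algebras; the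
   type annotations select that structure on the bare product type. *)
Notation M1 R := (measurableTypeR R).
Notation M3 R := (measurableTypeR R * measurableTypeR R * measurableTypeR R)%type.
Notation meas3 A := (measurable (A : set (M3 _))).
Notation mfun3 A f := (measurable_fun (A : set (M3 _)) f).

Section Boxes.
Context {R : realType}.
Implicit Types (x : E3 R) (A : 'I_3 -> set R) (U : set (E3 R)).

Definition box A : set (E3 R) := [set x | forall i, A i (coor3 x i)].

Lemma boxE A : box A = A 0 `*` A 1 `*` A 2%:R.
Proof.
apply/seteqP; split=> [[[x y] z] /= H|[[x y] z] /= [[h0 h1] h2]].
  by split; [split|]; [exact: (H 0)|exact: (H 1)|exact: (H 2%:R)].
move=> i; case: i => -[|[|[|//]]] hi; rewrite /coor3 /=.
- by rewrite (_ : Ordinal hi = 0)//; exact: val_inj.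
- by rewrite (_ : Ordinal hi = 1)//; exact: val_inj.
- by rewrite (_ : Ordinal hi = 2%:R)//; exact: val_inj.
Qed.

Lemma measurable_box A : (forall i, measurable (A i : set (M1 R))) -> meas3 (box A).
Proof. by move=> mA; rewrite boxE; do 2?apply: measurableX. Qed.

Lemma leb3_box A : (forall i, measurable (A i : set (M1 R))) ->
  leb3 (box A) = (\prod_(i < 3) lebesgue_measure (A i))%E.
Proof.
move=> mA; rewrite boxE /leb3 /=.
rewrite product_measure1E; [|exact: (measurableX (mA _) (mA _))|exact: mA].
rewrite [X in (X * _)%E]product_measure1E; [|exact: mA|exact: mA].
rewrite !big_ord_recl big_ord0 mule1 muleA.
by congr (lebesgue_measure (A _) * lebesgue_measure (A _)
  * lebesgue_measure (A _))%E; exact: val_inj.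
Qed.

Lemma compact_box A : (forall i, compact (A i)) -> compact (box A).
Proof. by move=> cA; rewrite boxE; do 2?apply: compact_setX. Qed.

Lemma open_box A : (forall i, open (A i)) -> open (box A).
Proof.
move=> oA; rewrite openE => x Ax.
have H i : \forall y \near x, A i (coor3 y i).
  by apply: coor3_continuous; apply: open_nbhs_nbhs; split; [exact: oA|exact: Ax].
exact: (@filter_forall _ _ _ _ (nbhs_filter x) H).
Qed.

Lemma nbhs_box x U : nbhs x U -> exists2 e : R, 0 < e &
  forall y, (forall i, `|coor3 x i - coor3 y i| < e) -> U y.
Proof.
move=> /nbhs_ballP[e e0 xU]; exists e => // y H; apply: xU.
by split; [split|]; [exact: (H 0)|exact: (H 1)|exact: (H 2%:R)].
Qed.

(** Boxes with rational corners form a countable base of the topology, which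
    reduces statements about open sets to countably many boxes. *)
Definition ratbox (p : {ffun 'I_3 -> rat} * {ffun 'I_3 -> rat}) : set (E3 R) :=
  box (fun i => `]ratr (p.1 i), ratr (p.2 i)[%classic).

Definition ratcbox (p : {ffun 'I_3 -> rat} * {ffun 'I_3 -> rat}) : set (E3 R) :=
  box (fun i => `[ratr (p.1 i), ratr (p.2 i)]%classic).

Lemma ratbox_sub p : ratbox p `<=` ratcbox p.
Proof. by move=> x px i; apply: subset_itv_oo_cc; exact: px. Qed.

Lemma measurable_ratbox p : meas3 (ratbox p).
Proof. exact: measurable_box. Qed.

Lemma measurable_ratcbox p : meas3 (ratcbox p).
Proof. exact: measurable_box. Qed.

Lemma compact_ratcbox p : compact (ratcbox p).
Proof. by apply: compact_box => i; exact: segment_compact. Qed.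

Lemma open_ratbox p : open (ratbox p).
Proof. by apply: open_box => i; exact: interval_open. Qed.

Lemma nbhs_ratbox x U : nbhs x U -> exists p, ratbox p x /\ ratcbox p `<=` U.
Proof.
move=> /nbhs_box[e e0 xU].
have lo i : {q : rat | ratr q \in `]coor3 x i - e, coor3 x i[}.
  by apply/cid/rat_in_itvoo; rewrite ltrBlDr ltrDl.
have hi i : {q : rat | ratr q \in `]coor3 x i, coor3 x i + e[}.
  by apply/cid/rat_in_itvoo; rewrite ltrDl.
exists ([ffun i => sval (lo i)], [ffun i => sval (hi i)]); split.
  move=> i /=; rewrite !ffunE in_itv /=.
  case: (lo i) => q /=; rewrite in_itv /= => /andP[_ ->] /=.
  by case: (hi i) => r /=; rewrite in_itv /= => /andP[].
move=> y Hy; apply: xU => i; have := Hy i; rewrite /= !ffunE in_itv /=.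
case: (lo i) => q /=; rewrite in_itv /= => /andP[eq _].
case: (hi i) => r /=; rewrite in_itv /= => /andP[_ re] /andP[qy yr].
rewrite ltr_norml; apply/andP; split; lra.
Qed.

Lemma open_bigcup_ratbox U : open U ->
  U = \bigcup_(p in [set p | ratcbox p `<=` U]) ratbox p.
Proof.
move=> oU; apply/seteqP; split=> [x Ux|x [p pU px]].
  by have [p [px pU]] := nbhs_ratbox (open_nbhs_nbhs (conj oU Ux)); exists p.
exact/pU/ratbox_sub.
Qed.

Lemma open_measurable3 U : open U -> meas3 U.
Proof.
move=> /open_bigcup_ratbox ->; rewrite bigcup_mkcond.
apply: countable_bigcupT_measurable; first exact: countableP.
by move=> p; case: ifPn => // _; exact: measurable_ratbox.
Qed.

Lemma closed_measurable3 U : closed U -> meas3 U.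
Proof. by move=> /closed_openC/open_measurable3/measurableC; rewrite setCK. Qed.

Lemma compact_measurable3 U : compact U -> meas3 U.
Proof. by move=> /compact_closed3/closed_measurable3. Qed.

Lemma continuous_measurable3 (f : sfield R) : continuous f -> mfun3 setT f.
Proof.
move=> cf; apply: (measurability _ (RGenOpens.measurableE R)).
move=> _ [_ [a [b ->] <-]]; rewrite setTI; apply: open_measurable3.
by apply: open_comp => [y _|]; [exact: cf|exact: interval_open].
Qed.

Lemma leb3_box_itv (a b : 'I_3 -> R) : (forall i, a i < b i) ->
  (0 < leb3 (box (fun i => `]a i, b i[%classic)))%E.
Proof.
move=> ab; rewrite leb3_box//.
apply: (big_ind (fun x : \bar R => (0 < x)%E)) => [|x y|i _].
- exact: lte01.
- exact: mule_gt0.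
by rewrite lebesgue_measure_itv/= lte_fin ab -EFinB lte_fin subr_gt0.
Qed.

Lemma bounded_leb3_fin U : meas3 U -> bounded_set U -> (leb3 U < +oo)%E.
Proof.
move=> mU [M [_ HM]].
pose B : set (E3 R) := box (fun i => `[- (M + 1), M + 1]%classic).
have mB : meas3 B by exact: measurable_box.
have UB : U `<=` B.
  move=> x Ux i; rewrite /= in_itv /= -ler_norml; apply: le_trans (norm_coor3 x i) _.
  by apply: HM => //; rewrite ltrDl.
apply: (@le_lt_trans _ _ (leb3 B)); first by apply: le_measure => //; rewrite inE.
rewrite leb3_box// ltey_eq; apply/orP; left.
apply: (big_ind (fun x : \bar R => x \is a fin_num)) => [//|x y|i _].
  exact: fin_numM.
by rewrite lebesgue_measure_itv/=; case: ifPn.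
Qed.

Lemma compact_leb3_fin U : compact U -> (leb3 U < +oo)%E.
Proof.
move=> cU; apply: bounded_leb3_fin; first exact: compact_measurable3.
exact: (@compact_bounded _ (R * R * R)%type).
Qed.

Lemma ae_forall3 (P : 'I_3 -> E3 R -> Prop) :
  (forall i, {ae leb3, forall x, P i x}) -> {ae leb3, forall x i, P i x}.
Proof. exact: (@filter_forall _ _ _ _ ae_leb3_filter). Qed.

(** Among the rational boxes, which are countably many, those on which [P] holds
    almost everywhere cover [U]. *)
Lemma ae_locally U (P : set (E3 R)) :
  (forall x, U x -> exists2 V, nbhs x V & {ae leb3, forall y, V y -> P y}) ->
  {ae leb3, forall y, U y -> P y}.
Proof.
move=> H.
(* The exceptional set of the n-th rational box, if that box is one of them. *)
pose F n := if unpickle n is Some p then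
  if pselect ({ae leb3, forall y, ratbox p y -> P y}) then ratbox p `&` ~` P else set0
  else set0.
have : leb3.-negligible (\bigcup_n F n).
  apply: negligible_bigcup => n; rewrite /F.
  case: unpickle => [p|]; last exact: negligible_set0.
  case: pselect => [Hp|Hn]; last exact: negligible_set0.
  apply: negligibleS Hp => y [py nPy] /(_ py); exact: nPy.
apply: negligibleS => x /= /not_implyP[Ux nPx].
have [V xV VP] := H x Ux; have [p [px pV]] := nbhs_ratbox xV.
exists (pickle p) => //; rewrite /F pickleK; case: pselect => [//|[]].
by apply: filterS VP => y H' py; apply/H'/pV/ratbox_sub.
Qed.

End Boxes.

(** * Integration by parts against test functions *)

Lemma integrable_bounded_support d (T : measurableType d) (R : realType)
    (mu : {measure set T -> \bar R}) (A : set T) (C : R) (g : T -> R) :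
  measurable A -> (mu A < +oo)%E -> measurable_fun setT g ->
  (forall x, `|g x| <= C) -> (forall x, ~ A x -> g x = 0) ->
  mu.-integrable setT (EFin \o g).
Proof.
move=> mA Afin mg gC g0.
have -> : EFin \o g = (EFin \o g) \_ A.
  apply/funext => x; rewrite patchE; case: ifPn => // /negP xA /=.
  by rewrite g0// => Ax; apply: xA; rewrite inE.
apply/(integrable_mkcond _ mA); apply: measurable_bounded_integrable => //.
  exact: measurable_funTS.
exists C; split; first exact: num_real.
by move=> M CM x _; apply: le_trans (gC x) (ltW CM).
Qed.

Section ProductMeasure.
Local Open Scope ereal_scope.
Context d1 d2 (T1 : measurableType d1) (T2 : measurableType d2) {R : realType}
  (m1 : {sigma_finite_measure set T1 -> \bar R})
  (m2 : {sigma_finite_measure set T2 -> \bar R}).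

(** The triple product is iterated, so Fubini's theorem requires the product of
    the first two measures to be sigma-finite. *)
Lemma product_sigma_finite : sigma_finite setT (m1 \x m2).
Proof.
have /sigma_finiteP[F [TF ndF Foo]] := sigma_finiteT m1.
have /sigma_finiteP[G [TG ndG Goo]] := sigma_finiteT m2.
exists (fun n => F n `*` G n).
  rewrite -setXTT TF TG predeqE => -[x y]; split.
    move=> [/= [n _ Fnx] [k _ Gky]]; exists (maxn n k) => //; split.
    - by move: x Fnx; exact/subsetPset/ndF/leq_maxl.
    - by move: y Gky; exact/subsetPset/ndG/leq_maxr.
  by move=> [n _ []/= ? ?]; split; exists n.
move=> k; have [? ?] := Foo k; have [? ?] := Goo k.
split; first exact: measurableX.
by rewrite product_measure1E// lte_mul_pinfty// ge0_fin_numE.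
Qed.

Definition prod_meas_fun : set (T1 * T2)%type -> \bar R := m1 \x m2.
HB.instance Definition _ := Measure.on prod_meas_fun.
HB.instance Definition _ :=
  Measure_isSigmaFinite.Build _ _ _ prod_meas_fun product_sigma_finite.
Definition prod_meas : {sigma_finite_measure set _ -> \bar R} := prod_meas_fun.

End ProductMeasure.

Section Fubini3.
Local Open Scope ereal_scope.
Context d1 d2 d3 (T1 : measurableType d1) (T2 : measurableType d2)
  (T3 : measurableType d3) {R : realType}
  (m1 : {sigma_finite_measure set T1 -> \bar R})
  (m2 : {sigma_finite_measure set T2 -> \bar R})
  (m3 : {sigma_finite_measure set T3 -> \bar R})
  (f : T1 * T2 * T3 -> \bar R).

Lemma fubini_product3_12 : (m1 \x m2 \x m3).-integrable setT f ->
  \int[m1 \x m2 \x m3]_x f x = \int[m1 \x m2]_w \int[m3]_z f (w, z).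
Proof.
move=> fi.
exact: (esym (@integral12_prod_meas1 _ _ _ _ R (prod_meas m1 m2) m3 f fi)).
Qed.

Lemma fubini_product3_21 : (m1 \x m2 \x m3).-integrable setT f ->
  \int[m1 \x m2 \x m3]_x f x = \int[m3]_z \int[m1 \x m2]_w f (w, z).
Proof.
move=> fi.
exact: (esym (@integral21_prod_meas1 _ _ _ _ R (prod_meas m1 m2) m3 f fi)).
Qed.

End Fubini3.

Section IntegrationByParts.
Context {R : realType}.
Implicit Types (f g phi : sfield R) (x : E3 R).
Notation mu1 := (@lebesgue_measure R).

Definition leb2 : {measure set
    (measurableTypeR R * measurableTypeR R)%type -> \bar R} := (mu1 \x mu1)%E.

Lemma fubini_leb3_12 (f : E3 R -> \bar R) : leb3.-integrable setT f ->
  (\int[leb3]_x f x = \int[leb2]_w \int[mu1]_z f (w, z))%E.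
Proof. exact: fubini_product3_12. Qed.

Lemma fubini_leb3_21 (f : E3 R -> \bar R) : leb3.-integrable setT f ->
  (\int[leb3]_x f x = \int[mu1]_z \int[leb2]_w f (w, z))%E.
Proof. exact: fubini_product3_21. Qed.

Lemma fubini_leb2_12 (f : R * R -> \bar R) : leb2.-integrable setT f ->
  (\int[leb2]_w f w = \int[mu1]_x \int[mu1]_y f (x, y))%E.
Proof. by move=> fi; exact: (esym (integral12_prod_meas1 fi)). Qed.

Lemma fubini_leb2_21 (f : R * R -> \bar R) : leb2.-integrable setT f ->
  (\int[leb2]_w f w = \int[mu1]_y \int[mu1]_x f (x, y))%E.
Proof. by move=> fi; exact: (esym (integral21_prod_meas1 fi)). Qed.

Lemma continuous_pair (T U V : topologicalType) (f : T -> U) (g : T -> V) :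
  continuous f -> continuous g -> continuous (fun t => (f t, g t)).
Proof. by move=> cf cg t; exact: cvg_pair (cf t) (cg t). Qed.

Lemma integral_deriv_compact (F f : R -> R) (M : R) : 0 < M ->
  (forall t, is_derive t (1 : R) F (f t)) -> continuous f ->
  (forall t, M <= `|t| -> F t = 0 /\ f t = 0) ->
  (\int[mu1]_t (f t)%:E = 0)%E.
Proof.
move=> M0 dF cf F0.
have cF : continuous F.
  move=> t; apply: differentiable_continuous; apply/derivable1_diffP.
  by have := dF t => ?; exact: ex_derive.
have -> : (fun t => (f t)%:E) = (fun t => (f t)%:E) \_ `[- M, M].
  apply/funext => t; rewrite patchE; case: ifPn => //.
  rewrite notin_setE /= in_itv /= -ler_norml => /negP; rewrite -ltNge => Mt.
  by have [_ ->] := F0 t (ltW Mt).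
rewrite -integral_mkcond (@continuous_FTC2 _ f F).
- have [|-> _] := F0 M; first by rewrite ger0_norm// ltW.
  have [|-> _] := F0 (- M); first by rewrite normrN ger0_norm// ltW.
  by rewrite sube0.
- lra.
- exact: continuous_subspaceT.
- split; first by move=> t _; have := dF t => ?; exact: ex_derive.
  + by apply: cvg_at_right_filter; exact: cF.
  + by apply: cvg_at_left_filter; exact: cF.
- by move=> t _; rewrite derive1E; have := dF t => ?; rewrite derive_val.
Qed.

Lemma is_derive_line (c : R -> E3 R) (v : E3 R) f t d :
  (forall h : R, c (h *: (1 : R) + t) = h *: v + c t) ->
  is_derive (c t) v f d -> is_derive t (1 : R) (fun t => f (c t)) d.
Proof.
move=> ch [df dE].
have E : (fun h : R => h^-1 *: (f (c (h *: (1 : R) + t)) - f (c t))) =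
    (fun h => h^-1 *: (f (h *: v + c t) - f (c t))).
  by apply/funext => h; rewrite ch.
by apply: DeriveDef; [rewrite /derivable E|rewrite /derive E].
Qed.

Lemma compact_support_bounds K g : compact K -> continuous g ->
  (forall x, ~ K x -> g x = 0) -> exists M : R, [/\ 0 < M,
    forall x, `|g x| <= M & forall x i, M <= `|coor3 x i| -> ~ K x].
Proof.
move=> cK cg g0.
have [M1 [_ H1]] : bounded_set (g @` K).
  apply: compact_bounded; apply: continuous_compact cK.
  exact: continuous_subspaceT.
have [M2 [_ H2]] : bounded_set K by exact: (@compact_bounded _ (R * R * R)%type).
exists (`|M1| + `|M2| + 1); split.
- by rewrite ltr_wpDl// addr_ge0.
- move=> x; have [Kx|nKx] := pselect (K x); last first.
    by rewrite g0// normr0 !addr_ge0.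
  apply: H1; last by exists x.
  by rewrite (le_lt_trans (ler_norm _))// -addrA ltrDl ltr_wpDl.
- move=> x i Mx Kx.
  have : `|x| <= `|M2| + 1/2.
    by apply: H2 => //; rewrite (le_lt_trans (ler_norm _))// ltrDl; lra.
  have := norm_coor3 x i; have := normr_ge0 M1; lra.
Qed.

Lemma integrable_compact_support K g : compact K -> continuous g ->
  (forall x, ~ K x -> g x = 0) -> leb3.-integrable setT (EFin \o g).
Proof.
move=> cK cg g0; have [M [M0 gM KM]] := compact_support_bounds cK cg g0.
apply: (@integrable_bounded_support _ _ _ leb3 K M g) => //.
- exact: compact_measurable3.
- exact: compact_leb3_fin.
- exact: continuous_measurable3.
Qed.

(** By Fubini's theorem the i-th variable may be integrated first, and on each
    line the fundamental theorem of calculus gives 0. *)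
Lemma integral_derive_compact_support K phi i : compact K -> smooth phi ->
  (forall x, ~ K x -> phi x = 0) ->
  (\int[leb3]_x ('D_(evec i) phi x)%:E = 0)%E.
Proof.
move=> cK sphi phi0; have dphi0 := derive_vanish i cK phi0.
set g := 'D_(evec i) phi in dphi0 *.
have sg : smooth g by exact: smooth_derive.
have cg := smooth_continuous sg.
have mg : mfun3 setT g := continuous_measurable3 cg.
have intg := integrable_compact_support cK cg dphi0.
have [M [M0 gM KM]] := compact_support_bounds cK cg dphi0.
have line (c : R -> E3 R) :
    (forall t h : R, c (h *: (1 : R) + t) = h *: evec i + c t) ->
    (forall t, coor3 (c t) i = t) -> continuous c ->
    (\int[mu1]_t (g (c t))%:E = 0)%E.
  move=> cl ci cc; apply: (@integral_deriv_compact (phi \o c) _ M) => //.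
  - by move=> t; apply: is_derive_line (cl t) _; exact: smooth_is_derive.
  - by move=> t; apply: continuous_comp; [exact: cc|exact: cg].
  - move=> t Mt; have nK : ~ K (c t) by apply: (KM _ i); rewrite ci.
    by split; [exact: phi0|exact: dphi0].
have intg2 z : leb2.-integrable setT (fun w => (g (w, z))%:E).
  pose A := `[- M, M]%classic `*` `[- M, M]%classic : set (R * R).
  apply: (@integrable_bounded_support _ _ _ leb2 A M (fun w => g (w, z))).
  - exact: (measurableX (measurable_itv _) (measurable_itv _)).
  - rewrite /A /leb2 [ltLHS]product_measure1E//= !lebesgue_measure_itv/= lte_fin.
    by case: ifPn => _; rewrite -?EFinB -?EFinM ?mule0 ltry.
  - by apply: measurableT_comp.
  - by move=> w; exact: gM.
  - move=> [x y] nA; apply: dphi0.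
    have [/KM|Mx] := leP M `|coor3 (x, y, z) (0 : 'I_3)|; first exact.
    have [/KM|My] := leP M `|coor3 (x, y, z) (1 : 'I_3)|; first exact.
    exfalso; apply: nA; split => /=; rewrite in_itv/= -ler_norml ltW//.
case: i @g sg cg mg intg gM intg2 line {dphi0 KM} =>
  -[|[|[|//]]] hi g sg cg mg intg gM intg2 line.
- rewrite (fubini_leb3_21 intg); apply: integral0_eq => z _.
  rewrite (fubini_leb2_21 (intg2 z)); apply: integral0_eq => y _.
  apply: (line (fun t => (t, y, z))) => [t h|//|t].
    rewrite /evec /=; congr ((_, _), _) => /=;
      by rewrite ?[_ *: _]mulr0 ?[_ *: _]mulr1 ?add0r.
  by apply: continuous_pair t; [apply: continuous_pair|];
    move=> t; [exact: cvg_id|exact: cvg_cst|exact: cvg_cst].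
- rewrite (fubini_leb3_21 intg); apply: integral0_eq => z _.
  rewrite (fubini_leb2_12 (intg2 z)); apply: integral0_eq => x _.
  apply: (line (fun t => (x, t, z))) => [t h|//|t].
    rewrite /evec /=; congr ((_, _), _) => /=;
      by rewrite ?[_ *: _]mulr0 ?[_ *: _]mulr1 ?add0r.
  by apply: continuous_pair t; [apply: continuous_pair|];
    move=> t; [exact: cvg_cst|exact: cvg_id|exact: cvg_cst].
- rewrite (fubini_leb3_12 intg); apply: integral0_eq => -[x y] _.
  apply: (line (fun t => (x, y, t))) => [t h|//|t].
    rewrite /evec /=; congr ((_, _), _) => /=;
      by rewrite ?[_ *: _]mulr0 ?[_ *: _]mulr1 ?add0r.
  by apply: continuous_pair t; move=> t; [exact: cvg_cst|exact: cvg_id].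
Qed.

Section OnOpenSet.
Variable Omega : set (E3 R).

Lemma Rintegral_patch f : (forall x, ~ Omega x -> f x = 0) ->
  \int[leb3]_(x in Omega) f x = \int[leb3]_x f x.
Proof.
move=> f0; rewrite Rintegral_mkcond; congr (fine _); apply: eq_integral => x _.
by rewrite patchE; case: ifPn => //; rewrite notin_setE => /f0 ->.
Qed.

Lemma integrable_test_fun phi : test_fun Omega phi ->
  leb3.-integrable setT (EFin \o phi).
Proof.
move=> [sphi [K [cK _ K0]]]; apply: integrable_compact_support cK _ K0.
exact: smooth_continuous.
Qed.

Lemma Rintegral_derive_test phi i : test_fun Omega phi ->
  \int[leb3]_(x in Omega) 'D_(evec i) phi x = 0.
Proof.
move=> tphi; have tdphi := test_fun_derive i tphi.
rewrite Rintegral_patch; last exact: test_fun_vanish.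
case: tphi => sphi [K [cK _ K0]].
by rewrite /Rintegral (integral_derive_compact_support i cK sphi K0).
Qed.

(** The integral of the i-th derivative of the product [phi * psi] vanishes. *)
Lemma weak_partial_test phi i : meas3 Omega -> test_fun Omega phi ->
  weak_partial Omega i phi ('D_(evec i) phi).
Proof.
move=> mO tphi; have tdphi := test_fun_derive i tphi; split.
- move=> K cK KO; apply: integrableS (integrable_test_fun tphi) => //.
  exact: compact_measurable3.
- move=> K cK KO; apply: integrableS (integrable_test_fun tdphi) => //.
  exact: compact_measurable3.
- move=> psi tpsi; have tdpsi := test_fun_derive i tpsi.
  have [[sphi _] [spsi _]] := (tphi, tpsi).
  have int_test f : test_fun Omega f -> leb3.-integrable Omega (EFin \o f).
    by move=> tf; apply: integrableS (integrable_test_fun tf).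
  have := Rintegral_derive_test i (test_funMl sphi tpsi).
  have -> : 'D_(evec i) (phi \* psi) =
      fun x => phi x * 'D_(evec i) psi x + 'D_(evec i) phi x * psi x.
    apply/funext => x.
    have := is_derive_mul (smooth_is_derive x i sphi) (smooth_is_derive x i spsi).
    by move=> ?; rewrite derive_val (mulrC (psi x)).
  rewrite RintegralD//; first by move/eqP; rewrite addr_eq0 => /eqP.
  + exact: (int_test _ (test_funMl sphi tdpsi)).
  + by have sdphi := smooth_derive i sphi; exact: (int_test _ (test_funMl sdphi tpsi)).
Qed.

End OnOpenSet.
End IntegrationByParts.

(** * The fundamental lemma of the calculus of variations *)

Section FundamentalLemma.
Context {R : realType}.
Implicit Types (f g h phi : sfield R) (x : E3 R) (a b : 'I_3 -> R).

Definition obox a b : set (E3 R) := box (fun i => `]a i, b i[%classic).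

Definition oboxes : set (set (E3 R)) := [set A | exists a b, A = obox a b].

Lemma measurable_obox a b : meas3 (obox a b).
Proof. exact: measurable_box. Qed.

Lemma oboxI a b a' b' : obox a b `&` obox a' b' =
  obox (fun i => Num.max (a i) (a' i)) (fun i => Num.min (b i) (b' i)).
Proof.
apply/seteqP; split=> [x [H H'] i|x H].
  have := H i; have := H' i; rewrite /= !in_itv/= gt_max lt_min.
  by move=> /andP[-> ->] /andP[-> ->].
split=> i; have := H i; rewrite /= !in_itv/= gt_max lt_min.
  by move=> /andP[/andP[-> _] /andP[-> _]].
by move=> /andP[/andP[_ ->] /andP[_ ->]].
Qed.

(** The coordinates are measurable for the sigma-algebra generated by the open
    boxes, hence so is the identity map into the product space. *)
Lemma measurable_oboxes (A : set (E3 R)) : meas3 A -> <<s oboxes >> A.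
Proof.
have opens U : open U -> <<s oboxes >> U.
  move=> /open_bigcup_ratbox ->; rewrite bigcup_mkcond.
  apply: (@countable_bigcupT_measurable _ (g_sigma_algebraType oboxes)).
    exact: countableP.
  move=> p; case: ifPn => // _; apply: sub_sigma_algebra.
  by exists (fun i => ratr (p.1 i)), (fun i => ratr (p.2 i)).
have mc i : measurable_fun setT
    ((fun x => coor3 x i) : g_sigma_algebraType oboxes -> M1 R).
  apply: (measurability _ (RGenOpens.measurableE R)).
  move=> _ [_ [a [b ->] <-]]; rewrite setTI; apply: opens.
  by apply: open_comp => [y _|]; [exact: coor3_continuous|exact: interval_open].
have mid : measurable_fun setT (fun x : g_sigma_algebraType oboxes =>
    ((coor3 x 0, coor3 x 1), coor3 x 2%:R) : M3 R).
  by apply: measurable_fun_pair; [apply: measurable_fun_pair|]; exact: mc.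
move=> mA; have := mid measurableT _ mA; rewrite setTI.
by rewrite (_ : _ @^-1` A = A)//; apply/seteqP; split=> -[[x y] z].
Qed.

(** The sets over which [h] integrates to 0 form a Dynkin system, and the open
    boxes are stable under intersection. *)
Lemma integral_oboxes_eq0 (a0 b0 : 'I_3 -> R) (h : sfield R) :
  leb3.-integrable (obox a0 b0) (EFin \o h) ->
  (forall a b, (\int[leb3]_(x in obox a0 b0 `&` obox a b) (h x)%:E = 0)%E) ->
  forall A, meas3 A -> (\int[leb3]_(x in obox a0 b0 `&` A) (h x)%:E = 0)%E.
Proof.
move=> hint h0 A /measurable_oboxes sA.
have mB := measurable_obox a0 b0.
have mh E : E `<=` obox a0 b0 -> meas3 E -> leb3.-integrable E (EFin \o h).
  by move=> EB mE; exact: integrableS hint.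
pose D := [set A : set (E3 R) | meas3 A /\
  (\int[leb3]_(x in obox a0 b0 `&` A) (h x)%:E = 0)%E].
suff : D A by case.
have GI : setI_closed oboxes.
  move=> _ _ [a [b ->]] [a' [b' ->]]; rewrite oboxI.
  by do 2 eexists.
move: A sA; rewrite -(setI_closed_g_dynkin_g_sigma_algebra GI).
apply: smallest_sub; last first.
  by move=> _ [a [b ->]]; split; [exact: measurable_obox|exact: h0].
have D0 : (\int[leb3]_(x in obox a0 b0) (h x)%:E = 0)%E.
  by rewrite -[obox a0 b0]setIid; exact: h0.
split.
- by split; [exact: measurableT|rewrite setIT].
- move=> A [mA A0]; split; first exact: measurableC.
  have mBA : meas3 (obox a0 b0 `&` A) by exact: measurableI.
  have mBCA : meas3 (obox a0 b0 `&` ~` A).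
    by apply: measurableI => //; exact: measurableC.
  move: D0; rewrite -[X in integral _ X _](setUIDK (obox a0 b0) A) setDE integral_setU//.
  + by rewrite A0 add0e.
  + rewrite -setDE setUIDK; exact: measurable_int hint.
  + by rewrite disj_set2E setIACA setICr setI0.
- move=> F tF DF; split; first by apply: bigcupT_measurable => n; case: (DF n).
  have mF n : meas3 (obox a0 b0 `&` F n) by apply: measurableI => //; case: (DF n).
  rewrite setI_bigcupr integral_bigcup//.
  + by apply: eseries0 => n _ _; case: (DF n).
  + exact: trivIset_setIl.
  + apply: mh; last exact: bigcupT_measurable.
    by move=> x [n _ []].
Qed.

Definition bumps n a b : sfield R := tensor (fun i => bump n (a i) (b i)).

Lemma bumps_ge0 n a b x : 0 <= bumps n a b x.
Proof. by apply: prodr_ge0 => i _; exact: bump_ge0. Qed.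

Lemma bumps_le1 n a b x : bumps n a b x <= 1.
Proof. by apply: prodr_ile1 => i _; rewrite bump_ge0 bump_le1. Qed.

Lemma bumps_out n a b x : 0 <= n -> ~ obox a b x -> bumps n a b x = 0.
Proof.
move=> n0 /existsNP[i /negP xi].
by rewrite /bumps /tensor (bigD1 i)//= bump_out ?mul0r.
Qed.

Lemma bumps_cvg a b x :
  bumps n.+1%:R a b x @[n --> \oo] --> (\1_(obox a b) x : R).
Proof.
have -> : \1_(obox a b) x = \prod_i (\1_`]a i, b i[%classic (coor3 x i) : R).
  rewrite indicE; have [xab|xab] := boolP (x \in _).
    rewrite big1// => i _; rewrite indicE mem_set//.
    by move: xab; rewrite inE; exact.
  move: xab; rewrite notin_setE => /existsNP[i xi].
  by rewrite (bigD1 i)//= indicE memNset ?mul0r.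
rewrite /bumps /tensor; elim: (index_enum _) => [|i r IH].
  by rewrite big_nil (_ : (fun _ => _) = cst 1) //;
    [exact: cvg_cst|apply/funext => n; rewrite big_nil].
rewrite big_cons (_ : (fun _ => _) = (fun n => bump n.+1%:R (a i) (b i) (coor3 x i) *
    \prod_(i <- r) bump n.+1%:R (a i) (b i) (coor3 x i))).
  by apply: cvgM; [exact: bump_cvg|exact: IH].
by apply/funext => n; rewrite big_cons.
Qed.

Lemma test_bumps (Omega K : set (E3 R)) n a b : compact K -> K `<=` Omega ->
  obox a b `<=` K -> 0 <= n -> test_fun Omega (bumps n a b).
Proof.
move=> cK KO abK n0; split; first by apply: smooth_tensor => i; exact: bump_smooth1.
exists K; split=> // x nKx; apply: bumps_out => // abx.
exact/nKx/abK.
Qed.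

Variable Omega : set (E3 R).

(** Products of bumps tend boundedly to indicators of open boxes, so [h] has zero
    integral over all open boxes in the given one, and therefore over all its
    measurable subsets. Only bumps are tested, because [zero_gradient_local] has
    no information on other test functions. *)
Lemma bumps_eq0_ae p h : loc_integrable Omega h -> ratcbox p `<=` Omega ->
  (forall a b (n : nat),
     (forall i, ratr (p.1 i) <= a i /\ b i <= ratr (p.2 i)) ->
     \int[leb3]_(x in Omega) (h x * bumps n.+1%:R a b x) = 0) ->
  {ae leb3, forall x, ratbox p x -> h x = 0}.
Proof.
move=> ih pO h0.
have cK : compact (@ratcbox R p) by exact: compact_ratcbox.
have mB : meas3 (@ratbox R p) by exact: measurable_ratbox.
have mK : meas3 (@ratcbox R p) by exact: measurable_ratcbox.
have iK := ih _ cK pO.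
have iB : leb3.-integrable (ratbox p) (EFin \o h).
  by apply: integrableS iK; [exact: mK|exact: mB|exact: ratbox_sub].
pose a0 i : R := ratr (p.1 i); pose b0 i : R := ratr (p.2 i).
have BE : ratbox p = obox a0 b0 by [].
have box0 a b : (\int[leb3]_(x in obox a0 b0 `&` obox a b) (h x)%:E = 0)%E.
  rewrite oboxI; pose a' i := Num.max (a0 i) (a i); pose b' i := Num.min (b0 i) (b i).
  rewrite -/a' -/b'.
  have ab' i : ratr (p.1 i) <= a' i /\ b' i <= ratr (p.2 i).
    by rewrite le_max ge_min !lexx.
  have abK : obox a' b' `<=` ratcbox p.
    by rewrite -oboxI => y [yB _]; exact/ratbox_sub.
  have tb n : test_fun Omega (bumps n.+1%:R a' b') by exact: (test_bumps cK).
  have mb n : mfun3 (ratcbox p) (bumps n.+1%:R a' b').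
    apply: measurable_funTS; apply: continuous_measurable3.
    by apply: smooth_continuous; case: (tb n).
  have mh : mfun3 (ratcbox p) h.
    by apply/measurable_EFinP; exact: measurable_int iK.
  have ib n : leb3.-integrable (ratcbox p)
      (EFin \o (fun y => h y * bumps n.+1%:R a' b' y)).
    apply: (@le_integrable _ _ _ leb3 _ mK _ (EFin \o h)); last exact: iK.
      by apply/measurable_EFinP; exact: (measurable_funM mh (mb n)).
    move=> y _ /=; rewrite lee_fin normrM ler_piMr//.
    by rewrite ger0_norm ?bumps_ge0 ?bumps_le1.
  have bK n : (\int[leb3]_(y in ratcbox p) (h y * bumps n.+1%:R a' b' y)%:E = 0)%E.
    rewrite -[LHS]fineK; last by apply: integrable_fin_num => //; exact: ib.
    congr (_%:E); rewrite -[RHS](h0 a' b' n ab').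
    rewrite /Rintegral; congr fine; rewrite [LHS]integral_mkcond [RHS]integral_mkcond.
    apply: eq_integral => y _; rewrite !patchE.
    have [yK|yK] := boolP (y \in ratcbox p).
      by rewrite mem_set//; apply: pO; rewrite inE in yK.
    case: ifPn => // _; rewrite bumps_out ?mulr0// => /abK yK'.
    by rewrite notin_setE in yK.
  have -> : (\int[leb3]_(y in obox a' b') (h y)%:E =
      \int[leb3]_(y in ratcbox p) (h y * \1_(obox a' b') y)%:E)%E.
    rewrite -[in LHS](setIidr abK) integral_mkcondr; apply: eq_integral => y _.
    rewrite patchE indicE; case: (y \in _) => /=.
      by rewrite mulr1.
    by rewrite mulr0.
  (* Dominated convergence, with |h| as the bound. *)
  have [|||||_ _] := @dominated_convergence _ _ R leb3 (ratcbox p) mK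
    (fun n y => (h y * bumps n.+1%:R a' b' y)%:E)
    (fun y => (h y * \1_(obox a' b') y)%:E) (fun y => `|h y|%:E).
  - by move=> n; apply/measurable_EFinP; exact: (measurable_funM mh (mb n)).
  - apply/measurable_EFinP; apply: measurable_funM => //.
    by apply: measurable_funTS; apply: measurable_indic; exact: measurable_obox.
  - apply: aeW => y _; apply: cvg_EFin; first exact: nearW.
    by apply: cvgMr; exact: bumps_cvg.
  - by apply/integrable_norm.
  - apply: aeW => y n _; rewrite lee_fin normrM ler_piMr//.
    by rewrite ger0_norm ?bumps_ge0 ?bumps_le1.
  rewrite (_ : [sequence _]_n = cst 0%E); last by apply/funext => n; exact: bK.
  by move=> /(cvg_lim (@ereal_hausdorff R)) <-; exact: lim_cst.
have int0 := integral_oboxes_eq0 iB box0.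
have : ae_eq leb3 (ratbox p) (EFin \o h) (cst 0%E).
  apply: integral_ae_eq => // E EB mE.
  by rewrite -(setIidr EB) [LHS](int0 _ mE) integral0.
by apply: filterS => y H /H [].
Qed.

Lemma test_bumps_ratcbox p (n : R) a b : ratcbox p `<=` Omega -> 0 <= n ->
  (forall i, ratr (p.1 i) <= a i /\ b i <= ratr (p.2 i)) ->
  test_fun Omega (bumps n a b).
Proof.
move=> pO n0 abp; apply: (@test_bumps _ (ratcbox p)) => //.
  exact: compact_ratcbox.
move=> x abx i; have [pa bp] := abp i; have /= := abx i.
by rewrite !in_itv/= => /andP[ax xb]; rewrite (le_trans pa (ltW ax)) (le_trans (ltW xb)).
Qed.

Lemma fundamental_lemma h : loc_integrable Omega h -> open Omega ->
  (forall phi, test_fun Omega phi ->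
     \int[leb3]_(x in Omega) (h x * phi x) = 0) ->
  {ae leb3, forall x, Omega x -> h x = 0}.
Proof.
move=> ih oO h0; apply: ae_locally => x Ox.
have [p [px pO]] := nbhs_ratbox (open_nbhs_nbhs (conj oO Ox)).
exists (ratbox p); first by apply: open_nbhs_nbhs; split => //; exact: open_ratbox.
apply: bumps_eq0_ae => // a b n abp; apply: h0.
by apply: test_bumps_ratcbox pO _ abp.
Qed.

End FundamentalLemma.

(** * Uniqueness and linearity of weak derivatives *)

Section WeakPartials.
Context {R : realType}.
Variable Omega : set (E3 R).
Hypothesis oO : open Omega.
Implicit Types (f g h u v phi : sfield R).

Let mO : meas3 Omega := open_measurable3 oO.

Lemma test_fun_bounded phi : test_fun Omega phi -> exists M : R, forall x, `|phi x| <= M.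
Proof.
move=> [sphi [K [cK _ K0]]].
have [M [_ HM _]] := compact_support_bounds cK (smooth_continuous sphi) K0.
by exists M.
Qed.

Lemma measurable_test_fun phi : test_fun Omega phi -> mfun3 setT phi.
Proof. by move=> [sphi _]; apply: continuous_measurable3; exact: smooth_continuous. Qed.

Lemma loc_integrable_mul_test h phi : loc_integrable Omega h ->
  test_fun Omega phi -> leb3.-integrable Omega (EFin \o (fun x => h x * phi x)).
Proof.
move=> hl tphi; have [M phiM] := test_fun_bounded tphi.
have mphi := measurable_test_fun tphi.
case: tphi => sphi [K [cK KO K0]].
have mK : meas3 K by exact: compact_measurable3.
have iK := hl K cK KO.
have mh : mfun3 K h by apply/measurable_EFinP; exact: (measurable_int leb3 iK).
have ik : leb3.-integrable K (EFin \o (fun x => h x * phi x)).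
  apply: (@le_integrable _ _ _ leb3 _ mK _ (fun x => (M * h x)%:E)).
  - apply/measurable_EFinP.
    exact: (measurable_funM mh (measurable_funTS mphi)).
  - move=> x Kx; rewrite lee_fin normrM mulrC normrM ler_wpM2r//.
    by apply: le_trans (phiM x) _; rewrite ler_norm.
  - exact: (@integrableZl _ _ _ leb3 _ mK M _ iK).
rewrite (_ : EFin \o _ = (EFin \o (fun x => h x * phi x)) \_ K); last first.
  apply/funext => x; rewrite patchE; case: ifPn => //.
  by rewrite notin_setE => /K0 /= ->; rewrite mulr0.
apply/(@integrable_restrict _ _ _ leb3 K mK Omega mO).
by rewrite setIidr.
Qed.

Lemma loc_integrableD (a : R) f g : loc_integrable Omega f ->
  loc_integrable Omega g -> loc_integrable Omega (a *: f + g).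
Proof.
move=> lf lg K cK KO; have mK : meas3 K by exact: compact_measurable3.
have laf := @integrableZl _ _ _ leb3 _ mK a _ (lf K cK KO).
exact: (@integrableD _ _ _ leb3 _ mK _ _ laf (lg K cK KO)).
Qed.

Lemma weak_partialD (a : R) i u v f g : weak_partial Omega i u f ->
  weak_partial Omega i v g -> weak_partial Omega i (a *: u + v) (a *: f + g).
Proof.
move=> [lu lf uf] [lv lg vg]; split; [exact: loc_integrableD..|].
move=> phi tphi; have tdphi := test_fun_derive i tphi.
have lin h k psi : loc_integrable Omega h -> loc_integrable Omega k ->
    test_fun Omega psi ->
    \int[leb3]_(x in Omega) ((a *: h + k) x * psi x) =
    a * \int[leb3]_(x in Omega) (h x * psi x) + \int[leb3]_(x in Omega) (k x * psi x).
  move=> lh lk tpsi; have ih := loc_integrable_mul_test lh tpsi.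
  have ik := loc_integrable_mul_test lk tpsi.
  rewrite -(RintegralZl a mO ih) -RintegralD//.
    by apply: eq_Rintegral => x _; rewrite mulrA -mulrDl.
  exact: (@integrableZl _ _ _ leb3 _ mO a _ ih).
by rewrite !lin// uf// vg//; ring.
Qed.

(** The difference of two weak derivatives of [u] is a weak derivative of 0, hence
    orthogonal to all test functions. *)
Lemma weak_partial_unique i u f g : weak_partial Omega i u f ->
  weak_partial Omega i u g -> {ae leb3, forall x, Omega x -> f x = g x}.
Proof.
move=> uf ug; have := weak_partialD (-1) uf ug; rewrite scaleN1r addNr.
move=> [_ lfg H].
have : {ae leb3, forall x, Omega x -> (-1 *: f + g) x = 0}.
  apply: (fundamental_lemma lfg oO) => phi tphi.
  have := H _ tphi; rewrite (_ : (fun _ => _) = cst 0); last first.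
    by apply/funext => x; rewrite /= mul0r.
  rewrite Rintegral_cst// mul0r => /esym /eqP; rewrite oppr_eq0 => /eqP.
  exact.
apply: filterS => x h /h; rewrite scaleN1r => /eqP; rewrite addrC subr_eq0 => /eqP.
by move=> ->.
Qed.

Lemma wpd_weak_partial i u f : weak_partial Omega i u f ->
  weak_partial Omega i u (wpd Omega i u).
Proof. by move=> uf; rewrite /wpd; case: xgetP => [g ->//|/(_ f)]. Qed.

Lemma wpd_ae i u f : weak_partial Omega i u f ->
  {ae leb3, forall x, Omega x -> wpd Omega i u x = f x}.
Proof.
by move=> uf; exact: weak_partial_unique (wpd_weak_partial uf) uf.
Qed.

Lemma wpd_lin_ae (a : R) i u v f g : weak_partial Omega i u f ->
  weak_partial Omega i v g -> {ae leb3, forall x, Omega x ->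
    wpd Omega i (a *: u + v) x = a * wpd Omega i u x + wpd Omega i v x}.
Proof.
move=> uf vg.
exact: wpd_ae (weak_partialD a (wpd_weak_partial uf) (wpd_weak_partial vg)).
Qed.

End WeakPartials.

(** * Integrability and norms on a measurable set *)

Section LpOn.
Context {R : realType}.
Variable Omega : set (E3 R).
Hypothesis mO : meas3 Omega.
Implicit Types (f g h : sfield R) (p q r : R).

Notation intO f := (leb3.-integrable Omega (EFin \o f)).

Lemma in_LpP p f : in_Lp Omega p f <->
  mfun3 Omega f /\ (eLp_norm Omega p f < +oo)%E.
Proof.
rewrite /in_Lp inE /= /finite_norm; split.
- move=> /andP[]; rewrite !inE /= => mf lf; split => //.
  exact/(measurable_restrictT _ mO).
- move=> [mf lf]; apply/andP; rewrite !inE /=; split => //.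
  exact/(measurable_restrictT _ mO).
Qed.

Lemma in_Lp_mfun p f : in_Lp Omega p f -> mfun3 Omega f.
Proof. by move=> /in_LpP[]. Qed.

Lemma eLp_norm_ge0 p f : (0 <= eLp_norm Omega p f)%E.
Proof. exact: Lnorm_ge0. Qed.

Lemma eLp_normE p f : 0 < p -> eLp_norm Omega p f =
  ((\int[leb3]_(x in Omega) (`|f x| `^ p)%:E) `^ p^-1)%E.
Proof.
move=> p0; rewrite /eLp_norm unlock; congr (_ `^ _)%E.
rewrite [RHS]integral_mkcond; apply: eq_integral => x _.
rewrite patchE /= patchE; case: (x \in Omega) => //=.
by rewrite normr0 powR0// gt_eqF.
Qed.

Lemma mfun_powR p f : mfun3 Omega f -> mfun3 Omega (fun x => `|f x| `^ p).
Proof.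
move=> mf; apply: (measurableT_comp (measurable_powR p)).
exact: measurableT_comp mf.
Qed.

Lemma eLp_norm_le p f g : 0 < p -> mfun3 Omega f -> mfun3 Omega g ->
  (forall x, Omega x -> `|f x| <= `|g x|) ->
  (eLp_norm Omega p f <= eLp_norm Omega p g)%E.
Proof.
move=> p0 mf mg fg; rewrite (eLp_normE f p0) (eLp_normE g p0).
have int_ge0 h : (0 <= \int[leb3]_(x in Omega) (`|h x| `^ p)%:E)%E.
  by apply: integral_ge0 => x _; rewrite lee_fin powR_ge0.
apply: gt0_ler_poweR; [by rewrite invr_ge0 ltW|by rewrite in_itv /= int_ge0 leey
  |by rewrite in_itv /= int_ge0 leey|].
apply: (@ge0_le_integral _ _ R leb3 Omega mO) => //.
- by apply/measurable_EFinP; exact: mfun_powR.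
- by apply/measurable_EFinP; exact: mfun_powR.
- move=> x Ox; rewrite lee_fin ge0_ler_powR ?nnegrE ?fg// ltW//.
Qed.

Lemma eLp_norm_ae p f g : 0 < p -> mfun3 Omega f -> mfun3 Omega g ->
  {ae leb3, forall x, Omega x -> f x = g x} ->
  eLp_norm Omega p f = eLp_norm Omega p g.
Proof.
move=> p0 mf mg fg; rewrite (eLp_normE f p0) (eLp_normE g p0); congr poweR.
apply: (@ae_eq_integral _ _ R leb3 Omega) => //.
- by apply/measurable_EFinP; exact: mfun_powR.
- by apply/measurable_EFinP; exact: mfun_powR.
- by apply: filterS fg => x /= + Ox => ->.
Qed.

Lemma eLp_norm_powR p r f : 0 < p -> 0 < r ->
  eLp_norm Omega (p / r) (fun x => `|f x| `^ r) = (eLp_norm Omega p f `^ r)%E.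
Proof.
move=> p0 r0; rewrite (eLp_normE _ (divr_gt0 p0 r0)) (eLp_normE f p0) -poweRrM.
rewrite invf_div (mulrC r); congr poweR.
apply: eq_integral => x _; congr (_%:E).
by rewrite ger0_norm ?powR_ge0// -powRrM mulrCA divff ?mulr1// gt_eqF.
Qed.

(** The case [r = 1] applied to |f|^r and |g|^r. *)
Lemma eLp_hoelder p q r f g : 0 < p -> 0 < q -> 0 < r ->
  p^-1 + q^-1 = r^-1 -> mfun3 Omega f -> mfun3 Omega g ->
  (eLp_norm Omega r (f \* g)%R <= eLp_norm Omega p f * eLp_norm Omega q g)%E.
Proof.
move=> p0 q0 r0 pqr mf mg.
have H : (eLp_norm Omega r (f \* g)%R `^ r <=
    (eLp_norm Omega p f * eLp_norm Omega q g) `^ r)%E.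
  rewrite poweRM ?eLp_norm_ge0//.
  rewrite -(eLp_norm_powR f p0 r0) -(eLp_norm_powR g q0 r0).
  have -> : (eLp_norm Omega r (f \* g)%R `^ r)%E =
      eLp_norm Omega 1 ((fun x => `|f x| `^ r) \* (fun x => `|g x| `^ r)).
    rewrite -eLp_norm_powR// divff ?gt_eqF// /eLp_norm; apply: eq_Lnorm => x /=.
    by rewrite !patchE; case: ifPn => // _; rewrite /= normrM powRM.
  pose F : sfield R := (fun x => `|f x| `^ r) \_ Omega.
  pose G : sfield R := (fun x => `|g x| `^ r) \_ Omega.
  have mF : mfun3 setT F by apply/(measurable_restrictT _ mO); exact: mfun_powR.
  have mG : mfun3 setT G by apply/(measurable_restrictT _ mO); exact: mfun_powR.
  have pqr' : (p / r)^-1 + (q / r)^-1 = 1.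
    by rewrite !invf_div -mulrDr pqr divff// gt_eqF.
  have := @hoelder _ _ R leb3 F G _ _ mF mG (divr_gt0 p0 r0) (divr_gt0 q0 r0) pqr'.
  apply: le_trans; rewrite /eLp_norm le_eqVlt; apply/orP; left; apply/eqP.
  apply: eq_Lnorm => x /=; rewrite /F /G !patchE; case: ifPn => //= _.
  by rewrite mulr0.
have := gt0_ler_poweR (r := r^-1) _ _ _ H.
rewrite -!poweRrM mulfV ?gt_eqF// !poweRe1 ?mule_ge0 ?eLp_norm_ge0//; apply.
- by rewrite invr_ge0 ltW.
- by rewrite in_itv /= poweR_ge0 leey.
- by rewrite in_itv /= poweR_ge0 leey.
Qed.

Lemma Lp_norm_ge0 p f : 0 <= Lp_norm Omega p f.
Proof. by rewrite fine_ge0// eLp_norm_ge0. Qed.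

Lemma eLp_norm_fine p f : in_Lp Omega p f ->
  eLp_norm Omega p f = (Lp_norm Omega p f)%:E.
Proof.
by move=> /in_LpP[_ lf]; rewrite /Lp_norm fineK// ge0_fin_numE ?eLp_norm_ge0.
Qed.

Lemma in_Lp_bound p f (c : R) : mfun3 Omega f ->
  (eLp_norm Omega p f <= c%:E)%E -> in_Lp Omega p f /\ Lp_norm Omega p f <= c.
Proof.
move=> mf fc; have lf : in_Lp Omega p f.
  by apply/in_LpP; split => //; apply: le_lt_trans fc _; exact: ltry.
by split => //; rewrite -lee_fin -eLp_norm_fine.
Qed.

Lemma in_Lp_le p f g : 0 < p -> mfun3 Omega f -> in_Lp Omega p g ->
  (forall x, Omega x -> `|f x| <= `|g x|) ->
  in_Lp Omega p f /\ Lp_norm Omega p f <= Lp_norm Omega p g.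
Proof.
move=> p0 mf lg fg; apply: in_Lp_bound => //; rewrite -eLp_norm_fine//.
by apply: eLp_norm_le => //; exact: in_Lp_mfun lg.
Qed.

Lemma in_Lp_ae p f g : 0 < p -> mfun3 Omega f -> in_Lp Omega p g ->
  {ae leb3, forall x, Omega x -> f x = g x} ->
  in_Lp Omega p f /\ Lp_norm Omega p f = Lp_norm Omega p g.
Proof.
move=> p0 mf /[dup] lg /in_LpP[mg lgoo] fg; have E := eLp_norm_ae p0 mf mg fg.
by rewrite /Lp_norm E; split => //; apply/in_LpP; rewrite E.
Qed.

Lemma Lp_hoelder p q r f g : 0 < p -> 0 < q -> 0 < r ->
  p^-1 + q^-1 = r^-1 -> in_Lp Omega p f -> in_Lp Omega q g ->
  in_Lp Omega r (f \* g) /\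
  Lp_norm Omega r (f \* g) <= Lp_norm Omega p f * Lp_norm Omega q g.
Proof.
move=> p0 q0 r0 pqr lf lg.
have [mf mg] := (in_Lp_mfun lf, in_Lp_mfun lg).
apply: in_Lp_bound; first exact: (measurable_funM mf mg).
by rewrite EFinM -!eLp_norm_fine//; exact: eLp_hoelder.
Qed.

Lemma in_LpZD p (a : R) f g : 1 <= p -> in_Lp Omega p f -> in_Lp Omega p g ->
  in_Lp Omega p (a *: f + g).
Proof.
move=> p1 lf lg; have p1' : (1 <= p%:E :> \bar R)%E by rewrite lee_fin.
rewrite /in_Lp (_ : _ \_ Omega = a *: (f \_ Omega) + (g \_ Omega)).
  by have [_ H] := Lfun_submod_closed leb3 p1'; exact: H.
apply/funext => x; rewrite patchE /= !fctE !patchE.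
by case: ifPn => // _; rewrite scaler0 addr0.
Qed.

Lemma in_Lp_abs p f : 0 < p -> in_Lp Omega p f ->
  in_Lp Omega p (fun x => `|f x|) /\
  Lp_norm Omega p (fun x => `|f x|) <= Lp_norm Omega p f.
Proof.
move=> p0 lf; apply: (in_Lp_le p0 _ lf); last by move=> x _; rewrite normr_id.
exact: measurableT_comp (@normr_measurable R setT) (in_Lp_mfun lf).
Qed.

Lemma eLp_norm_cst0 p : 0 < p -> eLp_norm Omega p (cst 0) = 0%E.
Proof.
move=> p0; rewrite /eLp_norm (_ : _ \o _ = cst 0%E) ?Lnorm0 ?eqe ?gt_eqF//.
by apply/funext => x /=; rewrite patchE; case: ifPn.
Qed.

Lemma in_Lp_sum p n (F : 'I_n -> sfield R) : 1 <= p ->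
  (forall i, in_Lp Omega p (F i)) -> in_Lp Omega p (fun x => \sum_i F i x).
Proof.
move=> p1; elim: n F => [|n IH] F lF.
  rewrite (_ : (fun _ => _) = cst 0); last by apply/funext => x; rewrite big_ord0.
  apply/in_LpP; split; first exact: measurable_cst.
  by rewrite eLp_norm_cst0// (lt_le_trans ltr01).
rewrite (_ : (fun _ => _) = 1 *: F ord0 + (fun x => \sum_i F (lift ord0 i) x)).
  by apply: in_LpZD => //; apply: IH => i; exact: lF.
by apply/funext => x; rewrite !fctE scale1r big_ord_recl.
Qed.

Lemma eL1_norm f : eLp_norm Omega 1 f = (\int[leb3]_(x in Omega) `|(f x)%:E|)%E.
Proof.
rewrite eLp_normE// invr1 poweRe1; last first.
  by apply: integral_ge0 => x _; rewrite lee_fin powR_ge0.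
by apply: eq_integral => x _; rewrite powRr1.
Qed.

Lemma in_L1P f : in_Lp Omega 1 f <-> intO f.
Proof.
split=> [/in_LpP[mf]|/integrableP[/measurable_EFinP mf fi]].
- by rewrite eL1_norm => H; apply/integrableP; split=> //; exact/measurable_EFinP.
- by apply/in_LpP; split=> //; rewrite eL1_norm.
Qed.

Lemma L1_norm f : Lp_norm Omega 1 f = \int[leb3]_(x in Omega) `|f x|.
Proof.
by rewrite /Lp_norm eL1_norm.
Qed.

Lemma Lp_normX n f : in_Lp Omega n.+1%:R f ->
  intO (fun x => `|f x| ^+ n.+1) /\
  Lp_norm Omega n.+1%:R f ^+ n.+1 = \int[leb3]_(x in Omega) `|f x| ^+ n.+1.
Proof.
move=> lf; have n0 : 0 < n.+1%:R :> R by rewrite ltr0n.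
have E : (\int[leb3]_(x in Omega) (`|f x| ^+ n.+1)%:E =
    (Lp_norm Omega n.+1%:R f ^+ n.+1)%:E)%E.
  rewrite -powR_mulrn ?Lp_norm_ge0// -poweR_EFin -eLp_norm_fine//.
  rewrite eLp_normE// -poweRrM mulVf ?gt_eqF// poweRe1 ?integral_ge0//.
  by apply: eq_integral => x _; rewrite powR_mulrn.
split; last by rewrite /Rintegral E.
apply/integrableP; split.
  apply/measurable_EFinP; apply: measurable_funX.
  by apply: measurableT_comp => //; exact: in_Lp_mfun lf.
under eq_integral do rewrite /= ger0_norm ?exprn_ge0//.
by rewrite E ltry.
Qed.

End LpOn.

(** * Integrals of products *)

Section Pairings.
Context {R : realType}.
Variable Omega : set (E3 R).
Hypothesis mO : meas3 Omega.
Implicit Types (f g h : sfield R).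

Notation intO f := (leb3.-integrable Omega (EFin \o f)).

Lemma Rintegral_ae f g : mfun3 Omega f -> mfun3 Omega g ->
  {ae leb3, forall x, Omega x -> f x = g x} ->
  \int[leb3]_(x in Omega) f x = \int[leb3]_(x in Omega) g x.
Proof.
move=> mf mg fg; congr fine.
apply: (@ae_eq_integral _ _ R leb3 Omega) => //; [exact/measurable_EFinP..|].
by apply: filterS fg => x /= + Ox => ->.
Qed.

Lemma intO_mfun f : intO f -> mfun3 Omega f.
Proof. by move=> fi; apply/measurable_EFinP; exact: (measurable_int leb3 fi). Qed.

Lemma intOD f g : intO f -> intO g -> intO (fun x => f x + g x).
Proof. by move=> fi gi; exact: (@integrableD _ _ _ leb3 _ mO _ _ fi gi). Qed.

Lemma intOZ (a : R) f : intO f -> intO (fun x => a * f x).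
Proof. by move=> fi; exact: (@integrableZl _ _ _ leb3 _ mO a _ fi). Qed.

Lemma intO_sum n (F : 'I_n -> sfield R) : (forall i, intO (F i)) ->
  intO (fun x => \sum_(i < n) F i x).
Proof.
move=> Fi; rewrite (_ : EFin \o _ = fun x => (\sum_(i < n) (F i x)%:E)%E).
  by apply: (@integrable_sum _ _ _ leb3 _ mO) => i _; exact: Fi.
by apply/funext => x /=; rewrite sumEFin.
Qed.

Lemma Rintegral_sum n (F : 'I_n -> sfield R) : (forall i, intO (F i)) ->
  \int[leb3]_(x in Omega) (\sum_(i < n) F i x) =
  \sum_(i < n) \int[leb3]_(x in Omega) F i x.
Proof.
elim: n F => [|n IH] F Fi.
  rewrite big_ord0 (_ : (fun _ => _) = cst 0) ?Rintegral_cst ?mul0r//.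
  by apply/funext => x; rewrite big_ord0.
rewrite big_ord_recl -IH => [|i]; last exact: Fi.
rewrite -RintegralD//; last exact: (intO_sum (fun i => Fi (lift ord0 i))).
by apply: eq_Rintegral => x _; rewrite big_ord_recl.
Qed.

Lemma intO_ae f g : mfun3 Omega f -> intO g ->
  {ae leb3, forall x, Omega x -> f x = g x} -> intO f.
Proof.
by move=> mf /(in_L1P mO) gi fg; apply/(in_L1P mO); have [] := in_Lp_ae mO ltr01 mf gi fg.
Qed.

Lemma L2_mul f g : in_Lp Omega 2 f -> in_Lp Omega 2 g ->
  intO (fun x => f x * g x) /\ `|\int[leb3]_(x in Omega) (f x * g x)| <=
    Lp_norm Omega 2 f * Lp_norm Omega 2 g.
Proof.
move=> lf lg; have e : (2 : R)^-1 + 2^-1 = 1^-1 by lra.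
have [i b] := Lp_hoelder mO (ltr0n R 2) (ltr0n R 2) ltr01 e lf lg.
have i' := (in_L1P mO _).1 i; split=> //; apply: le_trans b.
by rewrite L1_norm//; exact: le_normr_Rintegral.
Qed.

Lemma L4_mul f g : in_Lp Omega 4 f -> in_Lp Omega 4 g ->
  in_Lp Omega 2 (f \* g) /\
  Lp_norm Omega 2 (f \* g) <= Lp_norm Omega 4 f * Lp_norm Omega 4 g.
Proof. by apply: Lp_hoelder => //; lra. Qed.

Lemma L63_mul f g : in_Lp Omega 6 f -> in_Lp Omega 3 g ->
  in_Lp Omega 2 (f \* g) /\
  Lp_norm Omega 2 (f \* g) <= Lp_norm Omega 6 f * Lp_norm Omega 3 g.
Proof. by apply: Lp_hoelder => //; lra. Qed.

Lemma L2_sqr f : in_Lp Omega 2 f -> intO (fun x => f x ^+ 2) /\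
  Lp_norm Omega 2 f ^+ 2 = \int[leb3]_(x in Omega) f x ^+ 2.
Proof.
move=> /(Lp_normX mO (n := 1)) H; have [] := H.
have -> : (fun x => `|f x| ^+ 2) = (fun x => f x ^+ 2); last by [].
by apply/funext => x; rewrite real_normK ?num_real.
Qed.

(** From (x + y)^2 <= 2 x^2 + 2 y^2: weaker than the triangle inequality, but it
    can be summed over the components of a gradient. *)
Lemma L2_sqr_lin (a : R) f g : in_Lp Omega 2 f -> in_Lp Omega 2 g ->
  Lp_norm Omega 2 (a *: f + g) ^+ 2 <=
    2 * a ^+ 2 * Lp_norm Omega 2 f ^+ 2 + 2 * Lp_norm Omega 2 g ^+ 2.
Proof.
move=> lf lg; have lfg := in_LpZD a (ler1n R 2) lf lg.
have [if2 ->] := L2_sqr lf; have [ig2 ->] := L2_sqr lg.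
have [ifg ->] := L2_sqr lfg.
rewrite -!(RintegralZl _ mO)// -RintegralD//; [|exact: intOZ..].
apply: le_Rintegral => //; first by apply: intOD; exact: intOZ.
move=> x _; rewrite !fctE.
have := sqr_ge0 (a * f x - g x); rewrite -[_ *: _]/(_ * _); nra.
Qed.

End Pairings.

(** * Sobolev spaces *)

Section Sobolev.
Context {R : realType}.
Variable Omega : set (E3 R).
Hypothesis oO : open Omega.
Implicit Types (f g h u v w phi T : sfield R).

Let mO : meas3 Omega := open_measurable3 oO.
Notation intO f := (leb3.-integrable Omega (EFin \o f)).
Notation gn := (grad_norm Omega 2).

(** An open set is a countable union of compact rational boxes, on each of which
    [f] is integrable. *)
Lemma loc_integrable_mfun f : loc_integrable Omega f -> mfun3 Omega f.
Proof.
move=> lf _ Y mY.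
rewrite (_ : Omega `&` _ = \bigcup_(p in [set p | ratcbox p `<=` Omega])
    (ratcbox p `&` f @^-1` Y)).
  rewrite bigcup_mkcond.
  apply: countable_bigcupT_measurable; first exact: countableP.
  move=> p; case: ifPn => [|_]; last exact: measurable0.
  rewrite inE /= => pO.
  have cK : compact (@ratcbox R p) by exact: compact_ratcbox.
  apply: (intO_mfun (lf _ cK pO)) => //; exact: measurable_ratcbox.
apply/seteqP; split=> [x [Ox Yx]|x [p pO [px Yx]]]; last by split => //; exact: pO.
have [p [px pO]] := nbhs_ratbox (open_nbhs_nbhs (conj oO Ox)).
by exists p => //; split => //; exact: ratbox_sub.
Qed.

(** The chosen representative inherits integrability from any weak derivative,
    to which it is equal almost everywhere. *)
Lemma wpd_W1p p u i : 0 < p -> W1p Omega p u ->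
  weak_partial Omega i u (wpd Omega i u) /\ in_Lp Omega p (wpd Omega i u).
Proof.
move=> p0 [_ /(_ i)[g ug lg]]; have uw := wpd_weak_partial ug; split=> //.
have [_ lw _] := uw.
by have [] := in_Lp_ae mO p0 (loc_integrable_mfun lw) lg (wpd_ae oO ug).
Qed.

Lemma W1p_lin p (a : R) u v : 1 <= p -> W1p Omega p u -> W1p Omega p v ->
  W1p Omega p (a *: u + v).
Proof.
move=> p1 [lu du] [lv dv]; split; first exact: in_LpZD.
move=> i; have [f uf lf] := du i; have [g vg lg] := dv i.
by exists (a *: f + g); [exact: weak_partialD|exact: in_LpZD].
Qed.

Lemma wpd_lin p (a : R) u v i : 0 < p -> W1p Omega p u -> W1p Omega p v ->
  {ae leb3, forall x, Omega x ->
    wpd Omega i (a *: u + v) x = a * wpd Omega i u x + wpd Omega i v x}.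
Proof.
move=> p0 Wu Wv; have [uf _] := wpd_W1p i p0 Wu; have [vg _] := wpd_W1p i p0 Wv.
exact: (wpd_lin_ae oO a uf vg).
Qed.

Lemma enorm_ge0 (a : 'I_3 -> R) : 0 <= enorm a.
Proof. exact: sqrtr_ge0. Qed.

Lemma enorm_sqr (a : 'I_3 -> R) : enorm a ^+ 2 = \sum_i a i ^+ 2.
Proof. by rewrite sqr_sqrtr// sumr_ge0// => i _; exact: sqr_ge0. Qed.

(** The Euclidean norm is at most the sum of the absolute values. *)
Lemma in_Lp_root_sum p n (F : 'I_n -> sfield R) : 1 <= p ->
  (forall i, in_Lp Omega p (F i)) ->
  in_Lp Omega p (fun x => Num.sqrt (\sum_i F i x ^+ 2)).
Proof.
move=> p1 lF; have p0 : 0 < p by exact: lt_le_trans p1.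
have mF i : mfun3 Omega (F i) := in_Lp_mfun mO (lF i).
have lS : in_Lp Omega p (fun x => \sum_i `|F i x|).
  by apply: (in_Lp_sum mO p1) => i; exact: (in_Lp_abs mO p0 (lF i)).1.
apply: (in_Lp_le mO p0 _ lS _).1.
  have ms : measurable_fun setT (@Num.sqrt R).
    by apply: continuous_measurable_fun => x; exact: sqrt_continuous.
  apply: (measurableT_comp ms).
  by apply: measurable_sum => i; exact: measurable_funX.
move=> x _; rewrite ger0_norm ?sqrtr_ge0// ger0_norm; last by rewrite sumr_ge0.
rewrite -[leRHS]ger0_norm ?sumr_ge0// -sqrtr_sqr ler_wsqrtr//.
rewrite expr2 mulr_sumr ler_sum// => i _.
rewrite mulr_suml (bigD1 i)//= -normrM -expr2 ger0_norm ?sqr_ge0// lerDl.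
by rewrite sumr_ge0// => j _; rewrite mulr_ge0.
Qed.

Lemma Lp_norm_root_sum n (F : 'I_n -> sfield R) :
  (forall i, in_Lp Omega 2 (F i)) ->
  Lp_norm Omega 2 (fun x => Num.sqrt (\sum_i F i x ^+ 2)) ^+ 2 =
  \sum_i Lp_norm Omega 2 (F i) ^+ 2.
Proof.
move=> lF; have lS := in_Lp_root_sum (ler1n R 2) lF.
rewrite (L2_sqr mO lS).2.
under eq_bigr do rewrite (L2_sqr mO (lF _)).2.
rewrite -Rintegral_sum// => [|i]; last exact: (L2_sqr mO (lF i)).1.
apply: eq_Rintegral => x _; rewrite sqr_sqrtr// sumr_ge0// => i _; exact: sqr_ge0.
Qed.

Lemma grad_norm_ge0 p u : 0 <= grad_norm Omega p u.
Proof. exact: Lp_norm_ge0. Qed.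

Lemma vgrad_norm_ge0 p (u : vfield R) : 0 <= vgrad_norm Omega p u.
Proof. exact: Lp_norm_ge0. Qed.

Lemma in_Lp_grad p u : 1 <= p -> W1p Omega p u ->
  in_Lp Omega p (fun x => enorm (fun i => wpd Omega i u x)).
Proof.
move=> p1 Wu; apply: in_Lp_root_sum => // i.
by have [] := wpd_W1p i (lt_le_trans ltr01 p1) Wu.
Qed.

Lemma grad_norm_sqr u : W1p Omega 2 u ->
  gn u ^+ 2 = \sum_i Lp_norm Omega 2 (wpd Omega i u) ^+ 2.
Proof.
move=> Wu; rewrite /grad_norm /enorm Lp_norm_root_sum// => i.
by have [] := wpd_W1p i (ltr0n R 2) Wu.
Qed.

Lemma wpd_norm_le u i : W1p Omega 2 u -> Lp_norm Omega 2 (wpd Omega i u) <= gn u.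
Proof.
move=> Wu; rewrite -(@ler_pXn2r _ 2)// ?nnegrE ?Lp_norm_ge0//.
rewrite grad_norm_sqr// (bigD1 i)//= lerDl sumr_ge0// => j _; exact: sqr_ge0.
Qed.

Lemma grad_norm_lin (a : R) u v : W1p Omega 2 u -> W1p Omega 2 v ->
  gn (a *: u + v) ^+ 2 <= 2 * a ^+ 2 * gn u ^+ 2 + 2 * gn v ^+ 2.
Proof.
move=> Wu Wv; have Wuv := W1p_lin a (ler1n R 2) Wu Wv.
rewrite (grad_norm_sqr Wuv) (grad_norm_sqr Wu) (grad_norm_sqr Wv).
rewrite !mulr_sumr -big_split/=; apply: ler_sum => i _.
have [_ lu] := wpd_W1p i (ltr0n R 2) Wu; have [_ lv] := wpd_W1p i (ltr0n R 2) Wv.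
have [_ luv] := wpd_W1p i (ltr0n R 2) Wuv.
have [_ ->] := in_Lp_ae mO (ltr0n R 2) (in_Lp_mfun mO luv)
  (in_LpZD a (ler1n R 2) lu lv) (wpd_lin a i (ltr0n R 2) Wu Wv).
exact: (L2_sqr_lin mO a lu lv).
Qed.

Lemma test_fun_in_Lp p phi : 0 < p -> test_fun Omega phi -> in_Lp Omega p phi.
Proof.
move=> p0 tphi; have [M phiM] := test_fun_bounded tphi.
have mphi := measurable_test_fun tphi.
case: tphi => sphi [K [cK KO K0]].
have mK : meas3 K by exact: compact_measurable3.
have mI : mfun3 Omega (\1_K : sfield R).
  by apply: measurable_funTS; exact: measurable_indic.
apply/(in_LpP mO); split; first exact: measurable_funTS mphi.
rewrite eLp_normE//; apply: poweR_lty.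
apply: (@le_lt_trans _ _ (\int[leb3]_(x in Omega) ((`|M| `^ p)%:E * (\1_K x)%:E))%E).
  apply: (@ge0_le_integral _ _ R leb3 Omega mO).
  - by move=> x _; rewrite lee_fin powR_ge0.
  - apply/measurable_EFinP; apply: mfun_powR; exact: measurable_funTS mphi.
  - by apply/measurable_EFinP; apply: measurable_funM.
  - move=> x _; rewrite -EFinM lee_fin indicE.
    have [xK|xK] := boolP (x \in K).
      rewrite mulr1; apply: ge0_ler_powR; rewrite ?nnegrE//; first exact: ltW.
      exact: le_trans (phiM x) (ler_norm _).
    by rewrite mulr0 K0 ?normr0 ?powR0 ?gt_eqF//; rewrite notin_setE in xK.
rewrite ge0_integralZl//; last exact/measurable_EFinP.
rewrite integral_indic// lte_mul_pinfty ?lee_fin ?powR_ge0//.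
apply: le_lt_trans (compact_leb3_fin cK).
by apply: le_measure; rewrite ?inE//; exact: measurableI.
Qed.

Lemma test_fun_W1p p phi : 0 < p -> test_fun Omega phi -> W1p Omega p phi.
Proof.
move=> p0 tphi; split; first exact: test_fun_in_Lp.
move=> i; exists ('D_(evec i) phi); first exact: weak_partial_test.
by apply: test_fun_in_Lp => //; exact: test_fun_derive.
Qed.

Lemma test_fun0 : test_fun Omega (cst 0 : sfield R).
Proof.
split; first exact: smooth_cst.
by exists set0; split=> //; exact: compact0.
Qed.

Lemma wpd_cst0 i : {ae leb3, forall x, Omega x -> wpd Omega i (cst 0) x = 0}.
Proof.
have := wpd_ae oO (weak_partial_test i mO test_fun0).
by apply: filterS => x H /H ->; rewrite derive_cst.
Qed.

Lemma Lp_norm_cst0 p : 0 < p -> Lp_norm Omega p (cst 0) = 0.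
Proof. by move=> p0; rewrite /Lp_norm eLp_norm_cst0. Qed.

Lemma grad_norm_cst0 : gn (cst 0) = 0.
Proof.
have W0 := test_fun_W1p (ltr0n R 2) test_fun0.
apply/eqP; rewrite -sqrf_eq0 grad_norm_sqr// big1 ?eqxx// => i _.
have [_ l0] := wpd_W1p i (ltr0n R 2) W0.
have [_ ->] := in_Lp_ae mO (ltr0n R 2) (in_Lp_mfun mO l0)
  (test_fun_in_Lp (ltr0n R 2) test_fun0) (wpd_cst0 i).
by rewrite Lp_norm_cst0 ?expr0n.
Qed.

Lemma H10_test phi : test_fun Omega phi -> H10 Omega phi.
Proof.
move=> tphi; split; first exact: test_fun_W1p.
have E : phi \- phi = cst 0 by apply/funext => x /=; rewrite subrr.
exists (fun=> phi); split => //; rewrite E.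
  by rewrite Lp_norm_cst0//; exact: cvg_cst.
by rewrite grad_norm_cst0; exact: cvg_cst.
Qed.

(** Carries the squared bounds [L2_sqr_lin] and [grad_norm_lin] over to limits. *)
Lemma cvg0_sqr_lin (a : R) (x y z : R^nat) : (forall n, 0 <= x n) ->
  (forall n, 0 <= y n) -> (forall n, 0 <= z n) ->
  (forall n, x n ^+ 2 <= 2 * a ^+ 2 * y n ^+ 2 + 2 * z n ^+ 2) ->
  y @ \oo --> (0 : R) -> z @ \oo --> (0 : R) -> x @ \oo --> (0 : R).
Proof.
move=> x0 y0 z0 xyz cy cz.
apply: (squeeze_cvgr (f := cst 0) (h := fun n => 2 * (`|a| * y n + z n))).
- apply: nearW => n; rewrite x0/= -(@ler_pXn2r _ 2)// ?nnegrE//; last first.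
    by rewrite mulr_ge0// addr_ge0// mulr_ge0.
  apply: le_trans (xyz n) _.
  rewrite -(real_normK (num_real a)).
  have := mulr_ge0 (mulr_ge0 (normr_ge0 a) (y0 n)) (z0 n).
  have := sqr_ge0 (z n); have := sqr_ge0 (`|a| * y n).
  rewrite [X in _ -> _ -> _ -> _ <= X](_ : _ = 4 * (`|a| * y n) ^+ 2 +
    8 * (`|a| * y n * z n) + 4 * z n ^+ 2); last by ring.
  rewrite -(mulrA 2) -exprMn; lra.
- exact: cvg_cst.
- have c : (fun n => 2 * (`|a| * y n + z n)) @ \oo --> 2 * (`|a| * 0 + 0).
    by apply: cvgMr; apply: cvgD => //; exact: cvgMr.
  by move: c; rewrite mulr0 addr0 mulr0.
Qed.

Lemma sub_funE u v : u \- v = -1 *: v + u.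
Proof. by apply/funext => x; rewrite scaleN1r !fctE addrC. Qed.

Lemma H10_lin (a : R) u v : H10 Omega u -> H10 Omega v -> H10 Omega (a *: u + v).
Proof.
move=> [Wu [phi [tphi phi0 gphi0]]] [Wv [psi [tpsi psi0 gpsi0]]].
split; first exact: (W1p_lin a (ler1n R 2) Wu Wv).
have Wphi n : W1p Omega 2 (u \- phi n).
  rewrite sub_funE.
  by apply: W1p_lin; rewrite ?ler1n//; exact: test_fun_W1p.
have Wpsi n : W1p Omega 2 (v \- psi n).
  rewrite sub_funE.
  by apply: W1p_lin; rewrite ?ler1n//; exact: test_fun_W1p.
have E n : (a *: u + v) \- (a *: phi n + psi n) = a *: (u \- phi n) + (v \- psi n).
  by apply/funext => x; rewrite !fctE /= -![_ *: _]/(_ * _); ring.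
exists (fun n => a *: phi n + psi n); split.
- by move=> n; apply: test_funD => //; exact: test_funZ.
- apply: (cvg0_sqr_lin (a := a) _ _ _ _ phi0 psi0) => n; rewrite ?Lp_norm_ge0//.
  by rewrite E; apply: L2_sqr_lin => //; [have [] := Wphi n|have [] := Wpsi n].
- apply: (cvg0_sqr_lin (a := a) _ _ _ _ gphi0 gpsi0) => n; rewrite ?grad_norm_ge0//.
  by rewrite E; exact: grad_norm_lin.
Qed.

End Sobolev.

(** * The transport form and its skew-symmetry *)

Section Convection.
Context {R : realType}.
Variable Omega : set (E3 R).
Hypothesis oO : open Omega.
Implicit Types (f g h v w phi T : sfield R) (u : vfield R).

Let mO : meas3 Omega := open_measurable3 oO.
Notation intO f := (leb3.-integrable Omega (EFin \o f)).
Notation gn := (grad_norm Omega 2).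
Notation N4 := (Lp_norm Omega 4).

Lemma H10_embed p (C : R) v : 0 < p -> embedding_const Omega p C -> H10 Omega v ->
  in_Lp Omega p v /\ Lp_norm Omega p v <= C * gn v.
Proof.
move=> p0 emb Hv; apply: (in_Lp_bound mO); last exact: emb.
by have [[/(in_LpP mO)[]]] := Hv.
Qed.

(** A negative embedding constant forces all gradient norms to be 0, and then
    [C - 1] is an embedding constant as well. *)
Lemma best_embedding_ge0 p (C : R) : best_embedding_const Omega p C -> 0 <= C.
Proof.
move=> [emb best]; rewrite leNgt; apply/negP => C0.
have gn0 v : H10 Omega v -> gn v = 0.
  move=> Hv; apply/eqP; rewrite eq_le grad_norm_ge0 andbT.
  have := le_trans (eLp_norm_ge0 Omega p v) (emb v Hv).
  by rewrite lee_fin nmulr_rge0.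
have emb' : embedding_const Omega p (C - 1).
  by move=> v Hv; have := emb v Hv; rewrite gn0// !mulr0.
by have := best _ emb'; lra.
Qed.

Lemma le_cvg0 (a : R) (e : R^nat) : (forall n, a <= e n) -> e @ \oo --> (0 : R) ->
  a <= 0.
Proof.
move=> ae ce; rewrite -(cvg_lim (@Rhausdorff R) ce); apply: limr_ge.
  by apply/cvg_ex; exists 0.
exact: nearW.
Qed.

Lemma in_Lp_cst1 p : 0 < p -> (leb3 Omega < +oo)%E -> in_Lp Omega p (cst 1).
Proof.
move=> p0 fO; apply/(in_LpP mO); split; first exact: measurable_cst.
rewrite eLp_normE//; apply: poweR_lty.
rewrite (eq_integral (cst 1%E)) => [|x _]; last by rewrite /= normr1 powR1.
by rewrite integral_cst// mul1e.
Qed.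

Lemma L2_intO f : (leb3 Omega < +oo)%E -> in_Lp Omega 2 f -> intO f /\
  `|\int[leb3]_(x in Omega) f x| <= Lp_norm Omega 2 f * Lp_norm Omega 2 (cst 1).
Proof.
move=> fO lf; have := L2_mul mO lf (in_Lp_cst1 (ltr0n R 2) fO).
by rewrite (_ : (fun x => f x * _) = f)//; apply/funext => x; rewrite mulr1.
Qed.

Lemma Rintegral_wpd_test i phi : test_fun Omega phi ->
  \int[leb3]_(x in Omega) wpd Omega i phi x = 0.
Proof.
move=> tphi; rewrite -(Rintegral_derive_test i tphi).
have wphi := weak_partial_test i mO tphi.
have [_ l1 _] := wphi; have [_ l2 _] := wpd_weak_partial wphi.
by apply: Rintegral_ae (wpd_ae oO wphi) => //; exact: loc_integrable_mfun.
Qed.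

Lemma in_L2_wpd v i : H10 Omega v -> in_Lp Omega 2 (wpd Omega i v).
Proof. by move=> [Wv _]; have [] := wpd_W1p oO i (ltr0n R 2) Wv. Qed.

(** Clear for test functions; on a set of finite measure the integral is
    continuous for the gradient norm, and test functions are dense. *)
Lemma Rintegral_wpd v i : (leb3 Omega < +oo)%E -> H10 Omega v ->
  \int[leb3]_(x in Omega) wpd Omega i v x = 0.
Proof.
move=> fO Hv; have L1 f := @L2_intO f fO.
have [Wv [phi [tphi phi0 gphi0]]] := Hv.
have Hd n : H10 Omega (-1 *: phi n + v).
  exact: (H10_lin oO (-1) (H10_test oO (tphi n)) Hv).
have E n : \int[leb3]_(x in Omega) wpd Omega i (-1 *: phi n + v) x =
    \int[leb3]_(x in Omega) wpd Omega i v x.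
  have iv := (L1 _ (in_L2_wpd i Hv)).1.
  have ip := (L1 _ (in_L2_wpd i (H10_test oO (tphi n)))).1.
  have ivp : intO (fun x => -1 * wpd Omega i (phi n) x + wpd Omega i v x).
    by apply: intOD => //; exact: intOZ.
  rewrite (Rintegral_ae mO _ _ (wpd_lin oO (-1) i (ltr0n R 2)
    (test_fun_W1p oO (ltr0n R 2) (tphi n)) Wv)).
  - rewrite RintegralD//; last exact: intOZ.
    by rewrite RintegralZl// Rintegral_wpd_test// mulr0 add0r.
  - exact: in_Lp_mfun (in_L2_wpd i (Hd n)).
  - exact: intO_mfun ivp.
apply/eqP; rewrite -normr_le0.
apply: (@le_cvg0 _ (fun n => gn (v \- phi n) * Lp_norm Omega 2 (cst 1))).
  move=> n; rewrite sub_funE -(E n); apply: le_trans (L1 _ (in_L2_wpd i (Hd n))).2 _.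
  by rewrite ler_wpM2r ?Lp_norm_ge0// wpd_norm_le//; have [] := Hd n.
rewrite -(mul0r (Lp_norm Omega 2 (cst 1))); apply: cvgMl; exact: gphi0.
Qed.

(** The integrand of the trilinear form B(u, v, w) of the heat equation; each
    component of [convection] has this form too. *)
Definition transport u v w : sfield R :=
  fun x => (\sum_j u j x * wpd Omega j v x) * w x.

(** Hoelder's inequality with exponents 4, 2, 4 in each component of [u]; the
    constant is not sharp, only continuity in [v] and [w] matters here. *)
Lemma transport_bound u v w : (forall j, in_Lp Omega 4 (u j)) ->
  W1p Omega 2 v -> in_Lp Omega 4 w ->
  intO (transport u v w) /\ `|\int[leb3]_(x in Omega) transport u v w x| <=
    (\sum_j N4 (u j)) * gn v * N4 w.
Proof.
move=> lu Wv lw.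
have E : transport u v w = fun x => \sum_j (u j \* w) x * wpd Omega j v x.
  apply/funext => x; rewrite /transport mulr_suml; apply: eq_bigr => j _ /=; ring.
have H j : intO (fun x => (u j \* w) x * wpd Omega j v x) /\
    `|\int[leb3]_(x in Omega) ((u j \* w) x * wpd Omega j v x)| <= N4 (u j) * gn v * N4 w.
  have [luw nuw] := L4_mul mO (lu j) lw.
  have [_ lv] := wpd_W1p oO j (ltr0n R 2) Wv.
  have [i b] := L2_mul mO luw lv; split=> //; apply: le_trans b _.
  rewrite mulrAC; apply: ler_pM; rewrite ?Lp_norm_ge0//.
  exact: wpd_norm_le.
rewrite E; split; first by apply: intO_sum => // j; exact: (H j).1.
rewrite Rintegral_sum// => [|j]; last exact: (H j).1.
rewrite mulr_suml mulr_suml; apply: le_trans (ler_norm_sum _ _ _) _.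
by apply: ler_sum => j _; exact: (H j).2.
Qed.

Lemma le_mul_bound (K a b c x y : R) : 0 <= K -> 0 <= a -> y <= b * c ->
  x <= K * a * y -> x <= K * b * (a * c).
Proof.
move=> K0 a0 ybc xy; apply: le_trans xy _.
rewrite (_ : K * b * _ = K * a * (b * c)); last by ring.
by apply: ler_wpM2l => //; exact: mulr_ge0.
Qed.

(** Here the letters stand for the values of a bilinear form at the pairs formed
    from T, p and d = T - p; as the form vanishes at (p, p), its value at (T, T)
    is a sum of terms containing d. *)
Lemma polarize (TT dT Td dd pp pT pd : R) :
  dT = - pT + TT -> dd = - pd + Td -> pd = - pp + pT -> pp = 0 ->
  TT = dT + Td - dd.
Proof. by move=> -> -> -> ->; ring. Qed.

Lemma polarize_bound (dT Td dd K a b : R) : `|dT| <= K * (a * b) ->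
  `|Td| <= K * (b * a) -> `|dd| <= K * (a * a) ->
  `|dT + Td - dd| <= K * (2 * b * a + a * a).
Proof.
move=> h1 h2 h3; apply: le_trans (ler_normB _ _) _.
apply: le_trans (lerD (ler_normD _ _) h3) _.
rewrite (_ : K * (_ + _) = K * (a * b) + K * (b * a) + K * (a * a)); last by ring.
by rewrite lerD2r lerD.
Qed.

Variable C4 : R.
Hypothesis emb4 : embedding_const Omega 4 C4.
Hypothesis C4_ge0 : 0 <= C4.

Lemma H10_L4 v : H10 Omega v -> in_Lp Omega 4 v /\ N4 v <= C4 * gn v.
Proof. exact: H10_embed. Qed.

Section Skew.
Variable u : vfield R.
Hypothesis Hu : vH10 Omega u.
Hypothesis divu : {ae leb3, forall x, Omega x -> divergence Omega u x = 0}.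

Let lu j : in_Lp Omega 4 (u j) := (H10_L4 (Hu j)).1.

Notation B v w := (\int[leb3]_(x in Omega) transport u v w x).

Let intB v w : H10 Omega v -> H10 Omega w -> intO (transport u v w).
Proof.
by move=> Hv Hw; apply: (transport_bound lu _ (H10_L4 Hw).1).1; case: Hv.
Qed.

Let B_linl (a : R) v v' w : H10 Omega v -> H10 Omega v' -> H10 Omega w ->
  B (a *: v + v') w = a * B v w + B v' w.
Proof.
move=> Hv Hv' Hw; have i1 := intB Hv Hw; have i2 := intB Hv' Hw.
have i3 := intB (H10_lin oO a Hv Hv') Hw.
have i4 : intO (fun x => a * transport u v w x + transport u v' w x).
  by apply: intOD => //; exact: intOZ.
rewrite -(RintegralZl a mO i1) -RintegralD//; last exact: intOZ.
apply: (Rintegral_ae mO (intO_mfun i3) (intO_mfun i4)).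
have H := ae_forall3 (fun j => wpd_lin oO a j (ltr0n R 2) Hv.1 Hv'.1).
apply: filterS H => x H Ox; rewrite /transport mulrA -mulrDl mulr_sumr -big_split/=.
by congr (_ * _); apply: eq_bigr => j _; rewrite H//; ring.
Qed.

Let B_linr (a : R) v w w' : H10 Omega v -> H10 Omega w -> H10 Omega w' ->
  B v (a *: w + w') = a * B v w + B v w'.
Proof.
move=> Hv Hw Hw'; have i1 := intB Hv Hw; have i2 := intB Hv Hw'.
rewrite -(RintegralZl a mO i1) -RintegralD//; last exact: intOZ.
apply: eq_Rintegral => x _; rewrite /transport !fctE -[_ *: _]/(_ * _); ring.
Qed.

(** (u . grad phi) phi is half of u . grad (phi^2), and phi^2 is a test function
    for the weak derivatives of [u]. *)
Let B_test phi : test_fun Omega phi -> B phi phi = 0.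
Proof.
move=> tphi; have Hphi := H10_test oO tphi.
have [sphi _] := tphi.
have sq : test_fun Omega (phi \* phi) by exact: test_funMl.
have Dsq j x : 'D_(evec j) (phi \* phi) x = 2 * ('D_(evec j) phi x * phi x).
  have := is_derive_mul (smooth_is_derive x j sphi) (smooth_is_derive x j sphi).
  by move=> ?; rewrite derive_val; ring.
have lw j : loc_integrable Omega (u j) /\ loc_integrable Omega (wpd Omega j (u j)).
  by have [[]] := wpd_W1p oO j (ltr0n R 2) (Hu j).1.
have iD j := loc_integrable_mul_test oO (lw j).1 (test_fun_derive j sq).
have iw j := loc_integrable_mul_test oO (lw j).2 sq.
have i1 := intO_sum mO iD.
transitivity (\int[leb3]_(x in Omega) (2^-1 *
    \sum_j (u j x * 'D_(evec j) (phi \* phi) x))).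
  apply: (Rintegral_ae mO); [exact: intO_mfun (intB Hphi Hphi)
    |exact: intO_mfun (intOZ mO _ i1)|].
  have H := ae_forall3 (fun j => wpd_ae oO (weak_partial_test j mO tphi)).
  apply: filterS H => x H Ox; rewrite /transport mulr_suml mulr_sumr.
  by apply: eq_bigr => j _; rewrite H// Dsq; field.
rewrite RintegralZl// Rintegral_sum//.
under eq_bigr => j _.
  have [[_ _ W] _] := wpd_W1p oO j (ltr0n R 2) (Hu j).1.
  rewrite W//; over.
rewrite sumrN -Rintegral_sum//.
have i2 := intO_sum mO iw.
rewrite (Rintegral_ae mO (intO_mfun i2) (g := cst 0)).
- by rewrite Rintegral_cst// mul0r oppr0 mulr0.
- exact: measurable_cst.
- apply: filterS divu => x d Ox; have := d Ox.
  by rewrite /divergence -mulr_suml => ->; rewrite mul0r.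
Qed.

(** Take test functions phi_n tending to T. By [polarize], B(T, T) is bounded by
    terms that contain the gradient norm of T - phi_n. *)
Lemma transport_skew T : H10 Omega T -> B T T = 0.
Proof.
move=> HT; have [WT [phi [tphi _ gphi0]]] := HT.
set K := \sum_j N4 (u j).
have K0 : 0 <= K by apply: sumr_ge0 => j _; exact: Lp_norm_ge0.
have bB v w : H10 Omega v -> H10 Omega w -> `|B v w| <= K * C4 * (gn v * gn w).
  move=> Hv Hw; have [lw nw] := H10_L4 Hw.
  have tb := (transport_bound lu Hv.1 lw).2; rewrite -/K in tb.
  exact: le_mul_bound K0 (grad_norm_ge0 Omega 2 v) nw tb.
apply/eqP; rewrite -normr_le0.
apply: (@le_cvg0 _ (fun n => K * C4 * (2 * gn T * gn (T \- phi n) +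
  gn (T \- phi n) * gn (T \- phi n)))).
  move=> n; set d := T \- phi n; have dE : d = -1 *: phi n + T by rewrite /d sub_funE.
  have Hphi := H10_test oO (tphi n).
  have Hd : H10 Omega d by rewrite dE; exact: (H10_lin oO (-1) Hphi HT).
  have E : B T T = B d T + B T d - B d d.
    have := B_test (tphi n).
    have l w : H10 Omega w -> B d w = - B (phi n) w + B T w.
      by move=> Hw; rewrite dE B_linl// mulN1r.
    have r v : H10 Omega v -> B v d = - B v (phi n) + B v T.
      by move=> Hv; rewrite dE B_linr// mulN1r.
    move=> pp; exact: polarize (l T HT) (l d Hd) (r (phi n) Hphi) pp.
  rewrite E; exact: polarize_bound (bB d T Hd HT) (bB T d HT Hd) (bB d d Hd Hd).
have c : (fun n => K * C4 * (2 * gn T * gn (T \- phi n) +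
    gn (T \- phi n) * gn (T \- phi n))) @ \oo --> K * C4 * (2 * gn T * 0 + 0 * 0).
  apply: cvgMr; apply: cvgD; first exact: cvgMr.
  exact: cvgM.
by move: c; rewrite !mulr0 addr0 mulr0.
Qed.

End Skew.
End Convection.

(** * Functions with zero weak gradient *)

Section Constancy.
Context {R : realType}.
Implicit Types (f g h phi : sfield R) (x : E3 R) (F : 'I_3 -> R -> R).
Notation mu1 := (@lebesgue_measure R).

Lemma integral_pos d (T : measurableType d) (mu : {measure set T -> \bar R})
    (D A : set T) (f : T -> R) : measurable D -> measurable A -> A `<=` D ->
  (0 < mu A)%E -> mu.-integrable D (EFin \o f) -> (forall x : T, 0 <= f x) ->
  (forall x : T, A x -> 0 < f x) -> 0 < \int[mu]_(x in D) f x.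
Proof.
move=> mD mA AD A0 fi f0 fA; rewrite lt0r Rintegral_ge0// andbT.
apply/eqP => f00; have : (\int[mu]_(x in D) `|(EFin \o f) x| = 0)%E.
  rewrite (eq_integral (EFin \o f)) => [|x _]; last by rewrite gee0_abs// lee_fin.
  by rewrite -[LHS]fineK ?(integrable_fin_num mD)//; congr (_%:E).
move=> /(ae_eq_integral_abs mu mD (measurable_int mu fi)) ae0.
have : mu A = 0%E.
  apply/(negligibleP mu mA); apply: negligibleS ae0 => x Ax /(_ (AD _ Ax)) [fx0].
  by have := fA x Ax; rewrite fx0 ltxx.
by move=> E; rewrite E ltxx in A0.
Qed.

Lemma smooth1_of_derive (f df : R -> R) :
  (forall t, is_derive t (1 : R) f (df t)) -> smooth1 df -> smooth1 f.
Proof.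
move=> fdf sdf [|n] t; first by have := fdf t => ?; exact: ex_derive.
rewrite derive1Sn (_ : derive1 f = df)//; apply/funext => s.
by rewrite derive1E; have := fdf s => ?; rewrite derive_val.
Qed.

Lemma smooth1_lin (f g : R -> R) (c : R) : smooth1 f -> smooth1 g ->
  smooth1 (fun t => f t + c * g t).
Proof.
move=> sf sg; pose S (k : R -> R) := exists k1 k2 : R -> R,
  [/\ smooth1 k1, smooth1 k2 & k = fun t => k1 t + c * k2 t].
apply: (@smooth1_coind _ S); last by exists f, g.
move=> _ [{sf}f [{sg}g [sf sg ->]]].
have d t : is_derive t (1 : R) (fun t => f t + c * g t) (derive1 f t + c * derive1 g t).
  have df : is_derive t (1 : R) f (derive1 f t).
    by rewrite derive1E; apply: derivableP; exact: smooth1_derivable.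
  have dg : is_derive t (1 : R) g (derive1 g t).
    by rewrite derive1E; apply: derivableP; exact: smooth1_derivable.
  exact: (is_derive_add df (is_deriveZ c dg)).
split; first by move=> t; have := d t => ?; exact: ex_derive.
exists (derive1 f), (derive1 g); split; [exact: smooth1_derive..|].
by apply/funext => t; rewrite derive1E; have := d t => ?; rewrite derive_val.
Qed.

Lemma integrable_compact_support1 (f : R -> R) a b : continuous f ->
  (forall t, t \notin `]a, b[ -> f t = 0) -> mu1.-integrable setT (EFin \o f).
Proof.
move=> cf f0.
rewrite (_ : EFin \o f = (EFin \o f) \_ `[a, b]); last first.
  apply/funext => t; rewrite patchE; case: ifPn => // tab; rewrite /= f0//.
  apply: contra tab => tab; rewrite mem_setE; exact: subset_itv_oo_cc.
apply/(@integrable_mkcond _ _ _ mu1 `[a, b]%classic _ (measurable_itv _)).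
apply: continuous_compact_integrable; first exact: segment_compact.
exact: continuous_subspaceT.
Qed.

(** The primitive from -oo is 0 to the left of [a] because [f] is, and to the
    right of [b] because the total integral of [f] is 0. *)
Lemma smooth1_primitive (f : R -> R) a b : a <= b -> smooth1 f ->
  (forall t, t \notin `]a, b[ -> f t = 0) -> \int[mu1]_t f t = 0 ->
  exists psi, [/\ smooth1 psi, forall t, derive1 psi t = f t &
    forall t, t \notin `]a, b[ -> psi t = 0].
Proof.
move=> ab sf f0 If; have cf := smooth1_continuous sf.
have fi := integrable_compact_support1 cf f0.
pose psi (x : R) := \int[mu1]_(t in `]-oo, x]) f t.
have dpsi t : is_derive t (1 : R) psi (f t).
  have fit : mu1.-integrable [set` Interval -oo%O (BRight (t + 1))] (EFin \o f).
    by apply: (@integrableS _ _ _ mu1 setT).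
  have tt1 : t < t + 1 by rewrite ltrDl.
  have [d e] := @continuous_FTC1 R f -oo%O t (t + 1) tt1 fit (ltNyr _) (cf t).
  by apply: DeriveDef => //; rewrite -e derive1E.
exists psi; split.
- exact: smooth1_of_derive dpsi sf.
- by move=> t; rewrite derive1E; have := dpsi t => ?; rewrite derive_val.
- move=> t; rewrite in_itv/= negb_and -!leNgt => /orP[ta|bt].
    rewrite /psi (_ : \int[mu1]_(s in _) f s = \int[mu1]_(s in `]-oo, t]) cst 0 s).
      by rewrite Rintegral_cst// mul0r.
    apply: eq_Rintegral => s; rewrite inE/= in_itv/= => st; apply: f0.
    by rewrite in_itv/= negb_and -!leNgt (le_trans st ta).
  rewrite -If /psi Rintegral_mkcond; apply: eq_Rintegral => s _.
  rewrite patchE; case: ifPn => //; rewrite notin_setE/= in_itv/= => /negP.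
  rewrite -ltNge => ts.
  by rewrite f0// in_itv/= negb_and -!leNgt (le_trans bt (ltW ts)) orbT.
Qed.

Definition upd F i (f : R -> R) : 'I_3 -> R -> R :=
  fun j => if j == i then f else F j.

Lemma tensor_updE F i (f : R -> R) x : tensor (upd F i f) x =
  f (coor3 x i) * \prod_(j | j != i) F j (coor3 x j).
Proof.
rewrite /tensor (bigD1 i)//= /upd eqxx; congr (_ * _).
by apply: eq_bigr => j /negbTE ->.
Qed.

Lemma derive_tensor F i (f : R -> R) x : derivable f (coor3 x i) 1 ->
  'D_(evec i) (tensor (upd F i f)) x = tensor (upd F i (derive1 f)) x.
Proof.
move=> df; rewrite tensor_updE.
have d1 := is_derive_coor i df; rewrite eqxx mul1r in d1.
have d2 : is_derive x (evec i) (fun x => \prod_(j | j != i) F j (coor3 x j)) 0.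
  apply: is_derive_cst_line => h; apply: eq_bigr => j ji.
  by rewrite coor3_line eq_sym (negbTE ji) mulr0 add0r.
have := is_derive_mul d1 d2; rewrite mulr0 add0r mulrC => d.
rewrite (_ : tensor (upd F i f) = fun x => f (coor3 x i) *
  \prod_(j | j != i) F j (coor3 x j)); first by rewrite derive_val.
by apply/funext => y; exact: tensor_updE.
Qed.

Lemma chain3 (r : 'I_3 -> R) (A B C D : R) : A = r 0 * B -> B = r 1 * C ->
  C = r 2%:R * D -> A = (\prod_j r j) * D.
Proof.
move=> -> -> ->; rewrite !big_ord_recl big_ord0 mulr1 !mulrA.
by congr (r _ * r _ * r _ * D); exact: val_inj.
Qed.

Lemma cancel_ratio (r A B : R) : 0 < B -> - (A / B) * (r * B) + r * A = 0.
Proof. by move=> B0; field; rewrite gt_eqF. Qed.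

Section Local.
Variables (Omega : set (E3 R)) (p : {ffun 'I_3 -> rat} * {ffun 'I_3 -> rat}).
Hypothesis oO : open Omega.
Hypothesis pO : ratcbox p `<=` Omega.
Let mO : meas3 Omega := open_measurable3 oO.
Let a0 i : R := ratr (p.1 i).
Let b0 i : R := ratr (p.2 i).

(** The possible i-th factors of a product test function supported in the box
    [p]. *)
Definition admissible (i : 'I_3) (f : R -> R) :=
  smooth1 f /\ forall t, t \notin `]ratr (p.1 i) : R, ratr (p.2 i)[ -> f t = 0.

Lemma test_tensor F : (forall i, admissible i (F i)) -> test_fun Omega (tensor F).
Proof.
move=> aF; split; first by apply: smooth_tensor => i; exact: (aF i).1.
exists (ratcbox p); split => //; first exact: compact_ratcbox.
move=> x /existsNP[i xi]; rewrite /tensor (bigD1 i)//= (aF i).2 ?mul0r//.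
apply/negP => xi'; apply: xi => /=; exact: subset_itv_oo_cc.
Qed.

Lemma admissible_upd F i (f : R -> R) : (forall j, admissible j (F j)) -> admissible i f ->
  forall j, admissible j (upd F i f j).
Proof. by move=> aF af j; rewrite /upd; case: eqP => [->|]. Qed.

Lemma admissible_lin i (f g : R -> R) (c : R) : admissible i f -> admissible i g ->
  admissible i (fun t => f t + c * g t).
Proof.
move=> [sf f0] [sg g0]; split=> [|t ti]; first exact: smooth1_lin.
by rewrite f0// g0// mulr0 addr0.
Qed.

Let L h F := \int[leb3]_(x in Omega) (h x * tensor F x).

Hypothesis ab0 : forall i : 'I_3, ratr (p.1 i) < ratr (p.2 i) :> R.

Let eta (i : 'I_3) : R -> R := bump 1 (a0 i) (b0 i).

Let admissible_bump i (n a b : R) : 0 <= n -> a0 i <= a -> b <= b0 i ->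
  admissible i (bump n a b).
Proof.
move=> n0 aa bb; split=> [|t ti]; first exact: bump_smooth1.
apply: bump_out => //; apply: contra ti; rewrite !in_itv/= => /andP[ta tb].
by rewrite (le_lt_trans aa ta) (lt_le_trans tb bb).
Qed.

Let admissible_eta i : admissible i (eta i).
Proof. exact: admissible_bump. Qed.

Let bump_gt0 (a b t : R) : t \in `]a, b[ -> 0 < bump 1 a b t.
Proof.
rewrite in_itv/= => /andP[ta tb].
by rewrite /bump !mul1r /flat !subr_gt0 ta tb !expr0 !mul1r mulr_gt0// expR_gt0.
Qed.

Let admissible_integrable i (f : R -> R) : admissible i f ->
  mu1.-integrable setT (EFin \o f).
Proof.
move=> [sf f0]; apply: integrable_compact_support1 f0; exact: smooth1_continuous.
Qed.

Let I_eta i : 0 < \int[mu1]_t eta i t.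
Proof.
apply: (@integral_pos _ _ mu1 setT `]a0 i, b0 i[%classic).
- exact: measurableT.
- exact: measurable_itv.
- by [].
- apply: (@lt_le_trans _ _ (mu1 `]a0 i, b0 i[%classic)); last exact: lexx.
  by rewrite lebesgue_measure_itv/= lte_fin ab0 -EFinB lte_fin subr_gt0 ab0.
- exact: admissible_integrable (admissible_eta i).
- by move=> t; exact: bump_ge0.
- by move=> t; exact: bump_gt0.
Qed.

Section Functional.
Variable h : sfield R.
Hypothesis lh : loc_integrable Omega h.
Hypothesis hD : forall i phi, test_fun Omega phi ->
  \int[leb3]_(x in Omega) (h x * 'D_(evec i) phi x) = 0.

(** The primitive of [f] has compact support, so the product function is the i-th
    derivative of a test function. *)
Let L_prim F i (f : R -> R) : (forall j, admissible j (F j)) -> admissible i f ->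
  \int[mu1]_t f t = 0 -> L h (upd F i f) = 0.
Proof.
move=> aF [sf f0] If.
have [psi [spsi dpsi psi0]] := smooth1_primitive (ltW (ab0 i)) sf f0 If.
have apsi : admissible i psi by [].
rewrite -(hD i (test_tensor (admissible_upd aF apsi))).
apply: eq_Rintegral => x _; congr (_ * _).
rewrite derive_tensor; last exact: smooth1_derivable.
by rewrite (_ : derive1 psi = f)//; apply/funext.
Qed.

Let L_lin F i (f g : R -> R) (c : R) : (forall j, admissible j (F j)) ->
  admissible i f -> admissible i g ->
  L h (upd F i (fun t => f t + c * g t)) = L h (upd F i f) + c * L h (upd F i g).
Proof.
move=> aF af ag.
have i1 := loc_integrable_mul_test oO lh (test_tensor (admissible_upd aF af)).
have i2 := loc_integrable_mul_test oO lh (test_tensor (admissible_upd aF ag)).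
rewrite -(RintegralZl c mO i2) -RintegralD//; last exact: intOZ.
by apply: eq_Rintegral => x _; rewrite !tensor_updE; ring.
Qed.

(** Apply [L_prim] to [f - c eta], where [c] makes the integral vanish. *)
Let L_upd F i (f : R -> R) : (forall j, admissible j (F j)) -> admissible i f ->
  L h (upd F i f) =
  \int[mu1]_t f t / (\int[mu1]_t eta i t) * L h (upd F i (eta i)).
Proof.
move=> aF af; set If := \int[mu1]_t f t; set m := \int[mu1]_t eta i t.
have m0 : m != 0 by rewrite gt_eqF// I_eta.
have ie := admissible_integrable (admissible_eta i).
have := L_prim aF (admissible_lin (- (If / m)) af (admissible_eta i)).
rewrite L_lin// => H; apply/eqP; rewrite -subr_eq0 -mulNr H//.
rewrite RintegralD//; last 2 first.
- exact: admissible_integrable af.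
- exact: (@integrableZl _ _ _ mu1 _ _ _ _ ie).
by rewrite RintegralZl// -/If -/m; field.
Qed.

(** By [L_upd], used in the three variables in turn, only the integrals of the
    factors matter. The coefficient does not depend on [h]. *)
Lemma tensor_functional F : (forall j, admissible j (F j)) ->
  L h F = (\prod_j (\int[mu1]_t F j t / \int[mu1]_t eta j t)) * L h eta.
Proof.
move=> aF.
pose F1 := upd F 0 (eta 0); pose F2 := upd F1 1 (eta 1).
have aF1 : forall j, admissible j (F1 j) by apply: admissible_upd.
have aF2 : forall j, admissible j (F2 j) by apply: admissible_upd.
have E0 : F = upd F 0 (F 0) by apply/funext => j; rewrite /upd; case: eqP => [->|].
have E1 : F1 = upd F1 1 (F 1) by apply/funext => j; rewrite /upd; case: eqP => [->|].
have E2 : F2 = upd F2 2%:R (F 2%:R) by apply/funext => j; rewrite /upd; case: eqP => [->|].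
have E3 : upd F2 2%:R (eta 2%:R) = eta.
  apply/funext => j; rewrite /F2 /F1 /upd.
  case: eqP => [->//|n2]; case: eqP => [->//|n1]; case: eqP => [->//|n0].
  exfalso; case: j n0 n1 n2 => -[|[|[|//]]] hj n0 n1 n2;
    [apply: n0|apply: n1|apply: n2]; exact: val_inj.
have h0 := etrans (congr1 (L h) E0) (L_upd aF (aF 0)).
have h1 := etrans (congr1 (L h) E1) (L_upd aF1 (aF 1)).
have h2 := etrans (congr1 (L h) E2) (L_upd aF2 (aF 2%:R)).
rewrite E3 in h2.
exact: (@chain3 (fun j => \int[mu1]_t F j t / \int[mu1]_t eta j t) _ _ _ _ h0 h1 h2).
Qed.

End Functional.

Lemma loc_integrable_cst1 : loc_integrable Omega (cst 1).
Proof.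
move=> K cK _; apply: (@measurable_bounded_integrable _ _ _ leb3).
- exact: compact_measurable3.
- exact: compact_leb3_fin.
- exact: measurable_cst.
- exists 1; split; first exact: num_real.
  by move=> M M1 x _; rewrite /= normr1 ltW.
Qed.

(** By [tensor_functional] the integrals of [h] and of the constant 1 against
    products of bumps are proportional, so that [h - c] is orthogonal to all of
    them for a suitable [c]. *)
Lemma zero_gradient_local h : loc_integrable Omega h ->
  (forall i phi, test_fun Omega phi ->
    \int[leb3]_(x in Omega) (h x * 'D_(evec i) phi x) = 0) ->
  exists c : R, {ae leb3, forall x, ratbox p x -> h x = c}.
Proof.
move=> lh hD; have l1 := loc_integrable_cst1.
have D1 i phi : test_fun Omega phi ->
    \int[leb3]_(x in Omega) (cst 1 x * 'D_(evec i) phi x) = 0.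
  move=> tphi; rewrite -[RHS](Rintegral_derive_test i tphi).
  by apply: eq_Rintegral => x _; rewrite mul1r.
have teta := test_tensor admissible_eta.
have L1 : 0 < L (cst 1) eta.
  apply: (@integral_pos _ _ leb3 Omega (ratbox p)).
  - exact: mO.
  - exact: measurable_ratbox.
  - by move=> x /ratbox_sub /pO.
  - exact: leb3_box_itv.
  - exact: (loc_integrable_mul_test oO l1 teta).
  - by move=> x; rewrite mul1r; apply: prodr_ge0 => i _; exact: bump_ge0.
  - by move=> x px; rewrite mul1r; apply: prodr_gt0 => i _; apply: bump_gt0; exact: px.
pose c := L h eta / L (cst 1) eta; exists c.
have : {ae leb3, forall x, ratbox p x -> ((- c) *: cst 1 + h) x = 0}.
  apply: (bumps_eq0_ae (loc_integrableD (- c) l1 lh) pO) => a b n abp.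
  have aF j : admissible j (bump n.+1%:R (a j) (b j)).
    by have [] := abp j; exact: admissible_bump.
  have i1 := loc_integrable_mul_test oO l1 (test_tensor aF).
  have i2 := loc_integrable_mul_test oO lh (test_tensor aF).
  transitivity (- c * L (cst 1) (fun j => bump n.+1%:R (a j) (b j)) +
      L h (fun j => bump n.+1%:R (a j) (b j))).
    rewrite -(RintegralZl (- c) mO i1) -RintegralD//; last exact: intOZ.
    by apply: eq_Rintegral => x _; rewrite !fctE -[_ *: _]/(_ * _) /bumps; ring.
  have E1 := tensor_functional l1 D1 aF; have E2 := tensor_functional lh hD aF.
  by rewrite E1 E2; exact: cancel_ratio L1.
apply: filterS => x H /H; rewrite !fctE -[_ *: _]/(_ * _) mulr1 => /eqP.
by rewrite addrC subr_eq0 => /eqP.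
Qed.

End Local.

Lemma ratbox_nonempty_lt (p : {ffun 'I_3 -> rat} * {ffun 'I_3 -> rat}) x :
  ratbox p x -> forall i : 'I_3, ratr (p.1 i) < ratr (p.2 i) :> R.
Proof. by move=> px i; have := px i; rewrite /= in_itv/= => /andP[]; exact: lt_trans. Qed.

(** Nonempty open sets have positive measure. *)
Lemma open_ae_ex (U P : set (E3 R)) x : open U -> U x ->
  {ae leb3, forall y, U y -> P y} -> exists2 y, U y & P y.
Proof.
move=> oU Ux aeP; apply: contrapT => nex.
have [p [px pU]] := nbhs_ratbox (open_nbhs_nbhs (conj oU Ux)).
have : (0 < leb3 (@ratbox R p))%E by apply: leb3_box_itv; exact: ratbox_nonempty_lt px.
suff -> : leb3 (@ratbox R p) = 0%E by rewrite ltxx.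
apply/(negligibleP leb3 (measurable_ratbox p)).
apply: negligibleS aeP => y py /= UP; apply: nex.
have Uy : U y by apply/pU/ratbox_sub.
by exists y => //; exact: UP.
Qed.

(** [h] is constant on a small box around each point. Boxes that overlap have the
    same constant, because the overlap has positive measure. So the boxes with
    constant [c] and the boxes with another constant have disjoint open unions
    that cover [Omega], which is connected. *)
Lemma zero_gradient_cst (Omega : set (E3 R)) h : open Omega -> connected Omega ->
  Omega !=set0 -> loc_integrable Omega h ->
  (forall i phi, test_fun Omega phi ->
    \int[leb3]_(x in Omega) (h x * 'D_(evec i) phi x) = 0) ->
  exists c : R, {ae leb3, forall x, Omega x -> h x = c}.
Proof.
move=> oO conO [x0 Ox0] lh hD.
have loc x : Omega x -> exists p, [/\ ratbox p x, ratbox p `<=` Omega &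
    exists c : R, {ae leb3, forall y, ratbox p y -> h y = c}].
  move=> Ox; have [p [px pO]] := nbhs_ratbox (open_nbhs_nbhs (conj oO Ox)).
  exists p; split => //; first by move=> y /ratbox_sub /pO.
  exact: (zero_gradient_local oO pO (ratbox_nonempty_lt px) lh hD).
have [p0 [px0 p0O [c hc]]] := loc x0 Ox0.
exists c.
pose good p := {ae leb3, forall y, ratbox p y -> h y = c}.
pose A := \bigcup_(p in [set p | good p /\ ratbox p `<=` Omega]) @ratbox R p.
pose B := \bigcup_(p in [set p | ~ good p /\ ratbox p `<=` Omega /\
  exists c', {ae leb3, forall y, ratbox p y -> h y = c'}]) @ratbox R p.
have oA : open A by apply: bigcup_open => p _; exact: open_ratbox.
have oB : open B by apply: bigcup_open => p _; exact: open_ratbox.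
have AO : A `<=` Omega by move=> x [p [_ pO] px]; exact: pO.
have OAB x : Omega x -> A x \/ B x.
  move=> Ox; have [p [px pO [c' hc']]] := loc x Ox.
  have [gp|ngp] := pselect (good p); first by left; exists p.
  by right; exists p => //; split => //; split => //; exists c'.
have AB x : A x -> ~ B x.
  move=> [p [gp _] px] [q [ngq [_ [c' hc']]] qx].
  have oI : open (@ratbox R p `&` ratbox q) by apply: openI; exact: open_ratbox.
  have H : {ae @leb3 R, forall y, (@ratbox R p `&` ratbox q) y -> c = c'}.
    by apply: filterS2 gp hc' => y H1 H2 [/H1 <- /H2 <-].
  have [_ _ cc'] := open_ae_ex oI (conj px qx) H.
  by apply: ngq; rewrite /good cc'.
have AE : A = Omega.
  apply: conO.
  - by exists x0; exists p0.
  - by exists A => //; rewrite setIidr.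
  - exists (~` B); first exact: open_closedC.
    apply/seteqP; split=> [x Ax|x [Ox nBx]]; first by split; [exact: AO|exact: AB].
    by have [] := OAB x Ox.
apply: ae_locally => x; rewrite -AE => -[p [gp _] px].
by exists (ratbox p) => //; apply: open_nbhs_nbhs; split => //; exact: open_ratbox.
Qed.

End Constancy.

(** * Dual norms and norms of vector fields *)

Section DualNorm.
Context {R : realType} {X : lmodType R} (V : X -> Prop) (nrm : X -> R).
Hypothesis V0 : V 0.
Hypothesis VZ : forall (a : R) v, V v -> V (a *: v).
Hypothesis nrm_ge0 : forall v, 0 <= nrm v.
Hypothesis nrmZ : forall (a : R) v, V v -> nrm (a *: v) = `|a| * nrm v.

Lemma dual_norm_has_ub (F : X -> R) : in_dual V nrm F ->
  has_ubound [set `|F v| | v in [set v | V v /\ nrm v <= 1]].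
Proof.
move=> [_ [C FC]]; exists `|C| => _ [w [Vw nw] <-]; apply: le_trans (FC w Vw) _.
apply: (@le_trans _ _ (`|C| * nrm w)); first by rewrite ler_wpM2r// ler_norm.
by rewrite ler_piMr.
Qed.

(** Rescale [v] to norm 1; if [nrm v = 0], boundedness gives [F v = 0]. *)
Lemma dual_norm_bound (F : X -> R) v : in_dual V nrm F -> V v ->
  `|F v| <= dual_norm V nrm F * nrm v.
Proof.
move=> dF Vv; have [Flin [C FC]] := dF.
have F0 : F 0 = 0.
  by have := Flin 1 0 0 V0 V0; rewrite scale1r addr0 mul1r; lra.
have FZ (a : R) : F (a *: v) = a * F v.
  by have := Flin a v 0 Vv V0; rewrite !addr0 F0 addr0.
have [nv0|nv0] := eqVneq (nrm v) 0.
  by have := FC v Vv; rewrite nv0 !mulr0.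
have nv : 0 < nrm v by rewrite lt0r nv0 nrm_ge0.
rewrite -ler_pdivrMr//; apply: ub_le_sup.
  exact: dual_norm_has_ub.
exists ((nrm v)^-1 *: v).
  split; first exact: VZ.
  by rewrite nrmZ// ger0_norm ?invr_ge0// mulVf.
by rewrite FZ normrM ger0_norm ?invr_ge0// mulrC.
Qed.

Lemma dual_norm_ge0 (F : X -> R) : in_dual V nrm F -> 0 <= dual_norm V nrm F.
Proof.
move=> dF; apply: (@le_trans _ _ `|F 0|) => //; apply: ub_le_sup.
  exact: dual_norm_has_ub.
exists 0 => //; split => //.
by have := nrmZ 0 V0; rewrite scale0r normr0 mul0r => ->; exact: ler01.
Qed.

End DualNorm.

Section VectorNorms.
Context {R : realType}.
Variable Omega : set (E3 R).
Hypothesis oO : open Omega.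
Implicit Types (f g h v w phi T : sfield R) (u : vfield R).

Let mO : meas3 Omega := open_measurable3 oO.
Notation intO f := (leb3.-integrable Omega (EFin \o f)).
Notation gn := (grad_norm Omega 2).
Notation vgn := (vgrad_norm Omega 2).

Lemma L2_normZ (a : R) f : in_Lp Omega 2 f ->
  Lp_norm Omega 2 (a *: f) ^+ 2 = a ^+ 2 * Lp_norm Omega 2 f ^+ 2.
Proof.
move=> lf; have l0 : in_Lp Omega 2 (cst 0) by exact: test_fun_in_Lp (test_fun0 _).
have := in_LpZD a (ler1n R 2) lf l0.
rewrite (_ : cst 0 = 0)// addr0 => laf.
rewrite (L2_sqr mO laf).2 (L2_sqr mO lf).2 -RintegralZl//; last exact: (L2_sqr mO lf).1.
by apply: eq_Rintegral => x _; rewrite !fctE -[_ *: _]/(_ * _) exprMn.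
Qed.

Lemma H100 : H10 Omega 0.
Proof. exact: (H10_test oO (test_fun0 _)). Qed.

Lemma H10Z (a : R) v : H10 Omega v -> H10 Omega (a *: v).
Proof. by move=> Hv; rewrite -[_ *: _]addr0; exact: (H10_lin oO a Hv H100). Qed.

Lemma wpdZ (a : R) i v : H10 Omega v -> {ae leb3, forall x, Omega x ->
  wpd Omega i (a *: v) x = a * wpd Omega i v x}.
Proof.
move=> Hv; have H := wpd_lin oO a i (ltr0n R 2) Hv.1 H100.1.
rewrite addr0 in H; apply: filterS2 H (wpd_cst0 oO i) => x H1 H2 Ox.
by rewrite H1// [X in _ + X]H2// addr0.
Qed.

Lemma grad_normZ (a : R) v : H10 Omega v -> gn (a *: v) = `|a| * gn v.
Proof.
move=> Hv; have Hav := H10Z a Hv.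
apply/eqP; rewrite -(@eqrXn2 _ 2)// ?mulr_ge0 ?grad_norm_ge0//.
rewrite exprMn real_normK ?num_real// (grad_norm_sqr oO Hav.1) (grad_norm_sqr oO Hv.1).
rewrite mulr_sumr; apply/eqP; apply: eq_bigr => i _.
have [_ lv] := wpd_W1p oO i (ltr0n R 2) Hv.1.
have [_ lav] := wpd_W1p oO i (ltr0n R 2) Hav.1.
rewrite -L2_normZ//; congr (_ ^+ 2).
have laZ : in_Lp Omega 2 (a *: wpd Omega i v).
  by rewrite -[_ *: _]addr0; apply: in_LpZD => //; [exact: ler1n|exact: H100.1.1].
exact: (in_Lp_ae mO (ltr0n R 2) (in_Lp_mfun mO lav) laZ (wpdZ a i Hv)).2.
Qed.

Lemma vgrad_norm_sqr u : (forall i, W1p Omega 2 (u i)) ->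
  vgn u ^+ 2 = \sum_i gn (u i) ^+ 2.
Proof.
move=> Wu; rewrite /vgrad_norm (_ : (fun _ => _) = fun x =>
  Num.sqrt (\sum_i (fun x => enorm (fun j => wpd Omega j (u i) x)) x ^+ 2)).
  by rewrite Lp_norm_root_sum// => i; exact: (in_Lp_grad oO (ler1n R 2) (Wu i)).
apply/funext => x; congr Num.sqrt; apply: eq_bigr => i _.
by rewrite /= enorm_sqr.
Qed.

Lemma in_Lp_vgrad p u : 1 <= p -> vW1p Omega p u ->
  in_Lp Omega p (fun x => Num.sqrt (\sum_i \sum_j wpd Omega j (u i) x ^+ 2)).
Proof.
move=> p1 Wu; rewrite (_ : (fun _ => _) = fun x =>
  Num.sqrt (\sum_i (fun x => enorm (fun j => wpd Omega j (u i) x)) x ^+ 2)).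
  by apply: in_Lp_root_sum => // i; exact: in_Lp_grad.
apply/funext => x; congr Num.sqrt; apply: eq_bigr => i _.
by rewrite /= enorm_sqr.
Qed.

Lemma vH10_W12 u : vH10 Omega u -> vW1p Omega 2 u.
Proof. by move=> Hu i; have [] := Hu i. Qed.

Lemma vH100 : vH10 Omega 0.
Proof. move=> i; exact: H100. Qed.

Lemma vH10Z (a : R) u : vH10 Omega u -> vH10 Omega (a *: u).
Proof. by move=> Hu i; exact: (H10Z a (Hu i)). Qed.

Lemma vgrad_normZ (a : R) u : vH10 Omega u -> vgn (a *: u) = `|a| * vgn u.
Proof.
move=> Hu; apply/eqP; rewrite -(@eqrXn2 _ 2)// ?mulr_ge0 ?vgrad_norm_ge0//.
rewrite exprMn (vgrad_norm_sqr (vH10_W12 Hu)) (vgrad_norm_sqr (vH10_W12 (vH10Z a Hu))).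
rewrite mulr_sumr; apply/eqP; apply: eq_bigr => i _.
by rewrite -exprMn -(grad_normZ a (Hu i)).
Qed.

Lemma Hm1_bound F v : Hm1 Omega F -> H10 Omega v ->
  `|F v| <= Hm1_norm Omega F * gn v.
Proof.
apply: dual_norm_bound; [exact: H100|exact: H10Z|..].
  by move=> w; exact: grad_norm_ge0.
exact: grad_normZ.
Qed.

Lemma Hm1_norm_ge0 F : Hm1 Omega F -> 0 <= Hm1_norm Omega F.
Proof.
by apply: dual_norm_ge0; [exact: H100|move=> w; exact: grad_norm_ge0|exact: grad_normZ].
Qed.

Lemma vHm1_bound F u : vHm1 Omega F -> vH10 Omega u ->
  `|F u| <= vHm1_norm Omega F * vgn u.
Proof.
apply: dual_norm_bound; [exact: vH100|exact: vH10Z|..].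
  by move=> w; exact: vgrad_norm_ge0.
exact: vgrad_normZ.
Qed.

Lemma grad_norm_le_vgrad u i : vH10 Omega u -> gn (u i) <= vgn u.
Proof.
move=> Hu; rewrite -(@ler_pXn2r _ 2)// ?nnegrE ?grad_norm_ge0 ?vgrad_norm_ge0//.
rewrite (vgrad_norm_sqr (vH10_W12 Hu)) (bigD1 i)//= lerDl sumr_ge0// => j _; exact: sqr_ge0.
Qed.

Lemma L2_eq0_ae f : in_Lp Omega 2 f -> Lp_norm Omega 2 f = 0 ->
  {ae leb3, forall x, Omega x -> f x = 0}.
Proof.
move=> lf f0; have [i2 E] := L2_sqr mO lf; rewrite f0 expr0n in E.
have : (\int[leb3]_(x in Omega) `|(f x ^+ 2)%:E| = 0)%E.
  transitivity (\int[leb3]_(x in Omega) (f x ^+ 2)%:E)%E.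
    by apply: eq_integral => x _; rewrite gee0_abs// lee_fin sqr_ge0.
  rewrite -[LHS]fineK ?(@integrable_fin_num _ _ _ leb3 _ mO _ i2)//.
  by congr (_%:E); rewrite /Rintegral in E; rewrite -E.
move=> /(ae_eq_integral_abs leb3 mO (measurable_int leb3 i2)).
by apply: filterS => x H /H [] /eqP; rewrite sqrf_eq0 => /eqP.
Qed.

(** Expand |u|^4 as the double sum of u_i^2 u_j^2 and apply the Cauchy-Schwarz
    inequality to each term. *)
Lemma enorm_L4 u : (forall i, in_Lp Omega 4 (u i)) ->
  in_Lp Omega 4 (fun x => enorm (fun i => u i x)) /\
  Lp_norm Omega 4 (fun x => enorm (fun i => u i x)) ^+ 2 <=
    \sum_i Lp_norm Omega 4 (u i) ^+ 2.
Proof.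
move=> lu; have lS := in_Lp_root_sum oO (ler1n R 4) lu; split=> //.
rewrite -(@ler_pXn2r _ 2)// ?nnegrE ?sqr_ge0//; last first.
  by rewrite sumr_ge0// => i _; exact: sqr_ge0.
rewrite -exprM (Lp_normX mO (n := 3) lS).2.
have sq i : in_Lp Omega 2 (u i \* u i) /\
    Lp_norm Omega 2 (u i \* u i) <= Lp_norm Omega 4 (u i) ^+ 2.
  by rewrite expr2; exact: (L4_mul mO (lu i) (lu i)).
have mul i j := L2_mul mO (sq i).1 (sq j).1.
have E : (fun x => `|enorm (fun i => u i x)| ^+ 4) = fun x =>
    \sum_i \sum_j (u i \* u i) x * (u j \* u j) x.
  apply/funext => x; rewrite ger0_norm ?enorm_ge0// (exprM _ 2 2) enorm_sqr.
  rewrite expr2 big_distrlr; apply: eq_bigr => i _; apply: eq_bigr => j _ /=.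
  by rewrite !expr2.
rewrite [leLHS](_ : _ = \sum_i \sum_j
    \int[leb3]_(x in Omega) ((u i \* u i) x * (u j \* u j) x)); last first.
  rewrite E Rintegral_sum// => [|i].
    by apply: eq_bigr => i _; rewrite Rintegral_sum// => j; exact: (mul i j).1.
  by apply: (@intO_sum _ _ mO) => j; exact: (mul i j).1.
rewrite [leRHS]expr2 big_distrlr /=; apply: ler_sum => i _; apply: ler_sum => j _.
apply: le_trans (ler_norm _) _; apply: le_trans (mul i j).2 _.
by apply: ler_pM; rewrite ?Lp_norm_ge0 ?(sq _).2.
Qed.

(** The scalar embedding constant also serves for vector fields, without any
    dimensional factor. *)
Lemma vH10_L4 (C : R) u : 0 <= C -> embedding_const Omega 4 C -> vH10 Omega u ->
  in_Lp Omega 4 (fun x => enorm (fun i => u i x)) /\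
  Lp_norm Omega 4 (fun x => enorm (fun i => u i x)) <= C * vgn u.
Proof.
move=> C0 emb Hu; have H i := H10_L4 oO emb (Hu i).
have [l b] := enorm_L4 (fun i => (H i).1); split=> //.
rewrite -(@ler_pXn2r _ 2)// ?nnegrE ?Lp_norm_ge0 ?mulr_ge0 ?vgrad_norm_ge0//.
apply: le_trans b _; rewrite exprMn (vgrad_norm_sqr (vH10_W12 Hu)) mulr_sumr.
apply: ler_sum => i _; rewrite -exprMn.
rewrite ler_pXn2r// ?nnegrE ?Lp_norm_ge0 ?mulr_ge0 ?grad_norm_ge0//.
exact: (H i).2.
Qed.

(** Lagrange's identity: the defect is half the double sum of
    (a_i b_j - a_j b_i)^2. *)
Lemma cauchy_schwarz (I : finType) (a b : I -> R) :
  `|\sum_i a i * b i| <= Num.sqrt (\sum_i a i ^+ 2) * Num.sqrt (\sum_i b i ^+ 2).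
Proof.
have sa : 0 <= \sum_i a i ^+ 2 by rewrite sumr_ge0// => i _; exact: sqr_ge0.
rewrite -sqrtrM// -sqrtr_sqr ler_wsqrtr//.
have H : 0 <= \sum_i \sum_j (a i * b j - a j * b i) ^+ 2.
  by apply: sumr_ge0 => i _; apply: sumr_ge0 => j _; exact: sqr_ge0.
have E1 : (\sum_i a i ^+ 2) * (\sum_i b i ^+ 2) =
    \sum_i \sum_j a i ^+ 2 * b j ^+ 2 by exact: big_distrlr.
have E2 : (\sum_i a i ^+ 2) * (\sum_i b i ^+ 2) =
    \sum_i \sum_j a j ^+ 2 * b i ^+ 2.
  rewrite mulrC big_distrlr; apply: eq_bigr => i _.
  by apply: eq_bigr => j _; rewrite mulrC.
have E3 : (\sum_i a i * b i) ^+ 2 = \sum_i \sum_j (a i * b i) * (a j * b j).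
  by rewrite expr2 big_distrlr.
have E : \sum_i \sum_j (a i * b j - a j * b i) ^+ 2 =
    (\sum_i \sum_j a i ^+ 2 * b j ^+ 2) + (\sum_i \sum_j a j ^+ 2 * b i ^+ 2)
    - 2 * \sum_i \sum_j (a i * b i) * (a j * b j).
  rewrite mulr_sumr -big_split/= -sumrB; apply: eq_bigr => i _.
  rewrite mulr_sumr -big_split/= -sumrB; apply: eq_bigr => j _; ring.
move: H; rewrite E -E1 -E2 -E3; lra.
Qed.

End VectorNorms.

(** * Pointwise estimates and the role of small data *)

Section PointwiseAlgebra.
Context {R : realType}.
Implicit Types a b u w t : 'I_3 -> R.

(** Controls the drag |u|^(s-2) for 3 <= s <= 4. *)
Lemma powR_le_sqr (x r : R) : 0 <= x -> 1 <= r <= 2 -> x `^ r <= 1 + x ^+ 2.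
Proof.
move=> x0 /andP[r1 r2]; have [x1|x1] := leP x 1.
  have : x `^ r <= 1 `^ r.
    by apply: ge0_ler_powR; rewrite ?nnegrE//; lra.
  by rewrite powR1 => H; apply: le_trans H _; rewrite lerDl sqr_ge0.
have : x `^ r <= x `^ 2 by apply: ler_powR => //; exact: ltW.
by rewrite powR_mulrn// => H; apply: le_trans H _; rewrite lerDr.
Qed.

(** With A = |a|^r and B = |b|^r, the sum equals
    (A + B)/2 |a - b|^2 + (A - B)/2 (|a|^2 - |b|^2), and both terms are
    nonnegative since t^r is nondecreasing. *)
Lemma power_monotone a b (r : R) : 0 <= r ->
  0 <= \sum_i (enorm a `^ r * a i - enorm b `^ r * b i) * (a i - b i).
Proof.
move=> r0; set al := enorm a `^ r; set be := enorm b `^ r.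
have E : \sum_i (al * a i - be * b i) * (a i - b i) =
    (al + be) / 2 * (\sum_i (a i - b i) ^+ 2) +
    (al - be) / 2 * (enorm a ^+ 2 - enorm b ^+ 2).
  rewrite !enorm_sqr mulr_sumr -sumrB mulr_sumr -big_split/=.
  by apply: eq_bigr => i _; field.
have al0 : 0 <= al by exact: powR_ge0.
have be0 : 0 <= be by exact: powR_ge0.
rewrite E; apply: addr_ge0.
  apply: mulr_ge0; first by lra.
  by apply: sumr_ge0 => i _; exact: sqr_ge0.
have [ab|ba] := leP (enorm a) (enorm b).
  have : al <= be by apply: ge0_ler_powR; rewrite ?nnegrE ?enorm_ge0.
  have : enorm a ^+ 2 <= enorm b ^+ 2 by rewrite ler_pXn2r// nnegrE enorm_ge0.
  move=> h1 h2; rewrite mulr_le0//; lra.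
have : be <= al by apply: ge0_ler_powR; rewrite ?nnegrE ?enorm_ge0// ltW.
have : enorm b ^+ 2 <= enorm a ^+ 2 by rewrite ler_pXn2r ?nnegrE ?enorm_ge0// ltW.
move=> h1 h2; rewrite mulr_ge0//; lra.
Qed.

Lemma double_cauchy_schwarz (A B : 'I_3 -> 'I_3 -> R) :
  `|\sum_i \sum_j A i j * B i j| <=
  Num.sqrt (\sum_i \sum_j A i j ^+ 2) * Num.sqrt (\sum_i \sum_j B i j ^+ 2).
Proof. by rewrite !pair_bigA; exact: cauchy_schwarz. Qed.

(** The difference of the fluxes is k2 (D2 - D1) + (k2 - k1) D1. Tested with
    D2 - D1, the first part gives the square S and the second the product X of
    D1 with D2 - D1. *)
Lemma le_diffusion (m L k1 k2 th X S n1 n : R) :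
  m <= k2 -> `|k2 - k1| <= L * `|th| -> 0 <= S -> `|X| <= n1 * n ->
  0 <= n1 -> 0 <= n -> m * S - L * `|th| * n1 * n <= k2 * S + (k2 - k1) * X.
Proof.
move=> mk kL S0 Xn n10 n0.
have h1 : m * S <= k2 * S by rewrite ler_wpM2r.
have h2 : `|(k2 - k1) * X| <= L * `|th| * (n1 * n) by rewrite normrM ler_pM.
have h3 := ler_norm (- ((k2 - k1) * X)); rewrite normrN in h3.
rewrite -(mulrA (L * `|th|)); lra.
Qed.

(** The difference of two heat integrands tested with [th = T2 - T1]; the
    transport part splits as u2 . grad th + w . grad T1, where w = u2 - u1. *)
Lemma heat_pointwise (m L k1 k2 T1 T2 : R) (t1 t2 t u1 u2 w : 'I_3 -> R) (th : R) :
  (forall i, t i = t2 i - t1 i) -> (forall i, w i = u2 i - u1 i) -> th = T2 - T1 ->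
  m <= k2 -> `|k2 - k1| <= L * `|T2 - T1| ->
  m * enorm t ^+ 2 <=
  (k2 * (\sum_i t2 i * t i) + (\sum_i u2 i * t2 i) * th) -
  (k1 * (\sum_i t1 i * t i) + (\sum_i u1 i * t1 i) * th) +
  L * (`|th| * enorm t1 * enorm t) -
  (\sum_i u2 i * t i) * th - (\sum_i w i * t1 i) * th.
Proof.
move=> tE wE thE mk kL.
have X := cauchy_schwarz t1 t; rewrite -!/(enorm _) in X.
have kL' : `|k2 - k1| <= L * `|th| by rewrite thE.
have H := @le_diffusion m L k1 k2 th _ (enorm t ^+ 2) _ _ mk kL' (sqr_ge0 _) X
  (enorm_ge0 _) (enorm_ge0 _).
have E1 : \sum_i t2 i * t i = enorm t ^+ 2 + \sum_i t1 i * t i.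
  rewrite enorm_sqr -big_split/=; apply: eq_bigr => i _; rewrite tE; ring.
have E2 : \sum_i u2 i * t2 i =
    \sum_i u2 i * t i + \sum_i w i * t1 i + \sum_i u1 i * t1 i.
  rewrite -!big_split/=; apply: eq_bigr => i _; rewrite tE wE; ring.
rewrite E1 E2; lra.
Qed.

(** As in [heat_pointwise], with three further terms: the linear and the power
    drag are monotone and can be dropped, and the pressure disappears because
    the trace of [D] is 0. *)
Lemma momentum_pointwise (m L k1 k2 T1 T2 r p1 p2 : R) (D1 D2 D : 'I_3 -> 'I_3 -> R)
    (u1 u2 w : 'I_3 -> R) (th : R) (n1 := Num.sqrt (\sum_i \sum_j D1 i j ^+ 2))
    (n := Num.sqrt (\sum_i \sum_j D i j ^+ 2)) :
  (forall i j, D i j = D2 i j - D1 i j) -> (forall i, w i = u2 i - u1 i) ->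
  th = T2 - T1 -> 0 <= r ->
  m <= k2 -> `|k2 - k1| <= L * `|T2 - T1| -> \sum_i D i i = 0 ->
  m * n ^+ 2 <=
  (k2 * (\sum_i \sum_j D2 i j * D i j) + \sum_i (\sum_j u2 j * D2 i j) * w i
    + \sum_i u2 i * w i + enorm u2 `^ r * (\sum_i u2 i * w i) - p2 * \sum_i D i i) -
  (k1 * (\sum_i \sum_j D1 i j * D i j) + \sum_i (\sum_j u1 j * D1 i j) * w i
    + \sum_i u1 i * w i + enorm u1 `^ r * (\sum_i u1 i * w i) - p1 * \sum_i D i i) +
  L * (`|th| * n1 * n) -
  \sum_i (\sum_j u2 j * D i j) * w i - \sum_i (\sum_j w j * D1 i j) * w i.
Proof.
move=> DE wE thE r0 mk kL d0; rewrite d0 !mulr0 !subr0.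
have S0 : 0 <= \sum_i \sum_j D i j ^+ 2.
  by apply: sumr_ge0 => i _; apply: sumr_ge0 => j _; exact: sqr_ge0.
have nE : n ^+ 2 = \sum_i \sum_j D i j ^+ 2 by rewrite sqr_sqrtr.
have kL' : `|k2 - k1| <= L * `|th| by rewrite thE.
have H := @le_diffusion m L k1 k2 th _ (n ^+ 2) _ _ mk kL' (sqr_ge0 _)
  (double_cauchy_schwarz D1 D) (sqrtr_ge0 _) (sqrtr_ge0 _).
rewrite -/n1 -/n in H.
have E1 : \sum_i \sum_j D2 i j * D i j = n ^+ 2 + \sum_i \sum_j D1 i j * D i j.
  rewrite nE -big_split/=; apply: eq_bigr => i _; rewrite -big_split/=.
  by apply: eq_bigr => j _; rewrite DE; ring.
have E2 : \sum_i (\sum_j u2 j * D2 i j) * w i =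
    \sum_i (\sum_j u2 j * D i j) * w i + \sum_i (\sum_j w j * D1 i j) * w i +
    \sum_i (\sum_j u1 j * D1 i j) * w i.
  rewrite -!big_split/=; apply: eq_bigr => i _; rewrite -!mulrDl -!big_split/=.
  by congr (_ * _); apply: eq_bigr => j _; rewrite DE wE; ring.
have E3 : \sum_i u2 i * w i = \sum_i w i ^+ 2 + \sum_i u1 i * w i.
  by rewrite -big_split/=; apply: eq_bigr => i _; rewrite wE; ring.
have W0 : 0 <= \sum_i w i ^+ 2 by apply: sumr_ge0 => i _; exact: sqr_ge0.
have M := power_monotone u2 u1 r0.
have E4 : \sum_i (enorm u2 `^ r * u2 i - enorm u1 `^ r * u1 i) * (u2 i - u1 i) =
    enorm u2 `^ r * (\sum_i u2 i * w i) - enorm u1 `^ r * (\sum_i u1 i * w i).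
  by rewrite !mulr_sumr -sumrB; apply: eq_bigr => i _; rewrite wE; ring.
rewrite E4 in M; rewrite E1 E2.
move: M; set P2 := enorm u2 `^ r * _; set P1 := enorm u1 `^ r * _ => M.
rewrite [X in _ + X + P2]E3; lra.
Qed.

Lemma le_energy (m a b : R) : 0 < m -> 0 <= a -> 0 <= b ->
  m * a ^+ 2 <= b * a -> m * a <= b.
Proof.
move=> m0 a0 b0; have [->|an0] := eqVneq a 0; first by move=> _; rewrite mulr0.
have ap : 0 < a by rewrite lt0r an0.
by rewrite expr2 mulrA ler_pM2r.
Qed.

(** Here [w] and [t] are the gradient norms of the velocity and temperature
    differences, [a] and [b] those of the first solution. The first estimate
    bounds [t] by a multiple of [w]; inserted in the second one it gives
    al w^2 <= rho al w^2, where rho < 1 is the quantity assumed to be small. *)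
Lemma small_data_eq0 (al be La Lb C4 C6 CN NF NG N3T N3u w t a b : R) :
  0 < al -> 0 < be -> 0 <= La -> 0 <= C6 -> 0 <= CN -> 0 <= N3u ->
  0 <= w -> 0 <= t -> 0 <= b ->
  be * t ^+ 2 <= Lb * (C6 * t * N3T * t) + C4 ^+ 2 * w * b * t ->
  al * w ^+ 2 <= La * (C6 * t * N3u * w) + CN * w * a * w ->
  be * b <= NG -> al * a <= NF -> Lb * C6 * N3T < be ->
  CN / al ^+ 2 * NF + La * C6 * C4 ^+ 2 * NG * N3u /
    (al * be * (be - Lb * C6 * N3T)) < 1 ->
  w = 0 /\ t = 0.
Proof.
move=> al0 be0 La0 C60 CN0 N3u0 w0 t0 b0 ht hw hb ha hD.
set D := be - Lb * C6 * N3T => small; have D0 : 0 < D by rewrite subr_gt0.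
have Dt : D * t <= C4 ^+ 2 * w * b.
  apply: le_energy => //; first exact: mulr_ge0 (mulr_ge0 (sqr_ge0 _) w0) b0.
  by move: ht; rewrite /D; lra.
have bN : b <= NG / be by rewrite ler_pdivlMr// mulrC.
have aN : a <= NF / al by rewrite ler_pdivlMr// mulrC.
have tN : t <= C4 ^+ 2 * w * (NG / be) / D.
  rewrite ler_pdivlMr// mulrC; apply: le_trans Dt _.
  by rewrite ler_wpM2l// mulr_ge0 ?sqr_ge0.
have h1 : La * (C6 * t * N3u * w) <=
    La * (C6 * (C4 ^+ 2 * w * (NG / be) / D) * N3u * w).
  by rewrite ler_wpM2l// ler_wpM2r// ler_wpM2r// ler_wpM2l.
have h2 : CN * w * a * w <= CN * w * (NF / al) * w.
  by rewrite ler_wpM2r// ler_wpM2l// mulr_ge0.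
have w00 : w = 0.
  apply/eqP; apply: contraT => wn0; have wp : 0 < w by rewrite lt0r wn0.
  have := le_trans hw (lerD h1 h2).
  rewrite (_ : _ + _ = al * w ^+ 2 * (CN / al ^+ 2 * NF +
    La * C6 * C4 ^+ 2 * NG * N3u / (al * be * D))); last by field; rewrite ?gt_eqF.
  rewrite -[leLHS]mulr1 ler_pM2l ?mulr_gt0 ?exprn_gt0//.
  by rewrite leNgt small.
split=> //; apply/eqP; move: Dt; rewrite w00 mulr0 mul0r pmulr_rle0// => t00.
by rewrite eq_le t00.
Qed.

End PointwiseAlgebra.

(** * Integrability of the terms of the weak formulation *)

Section Integrands.
Context {R : realType}.
Variable Omega : set (E3 R).
Hypothesis oO : open Omega.
Implicit Types (f g h p S T : sfield R) (u v w : vfield R).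

Let mO : meas3 Omega := open_measurable3 oO.
Notation intO f := (leb3.-integrable Omega (EFin \o f)).
Notation gn := (grad_norm Omega 2).
Notation vgn := (vgrad_norm Omega 2).

Lemma le_Rintegral_ae f g : intO f -> intO g ->
  {ae leb3, forall x, Omega x -> f x <= g x} ->
  \int[leb3]_(x in Omega) f x <= \int[leb3]_(x in Omega) g x.
Proof.
move=> fi gi fg; have mf := intO_mfun fi; have mg := intO_mfun gi.
have mm : mfun3 Omega (fun x => Num.max (f x) (g x)) by exact: measurable_maxr.
have E : {ae leb3, forall x, Omega x -> Num.max (f x) (g x) = g x}.
  by apply: filterS fg => x H Ox; apply/max_idPr; exact: H.
rewrite -(Rintegral_ae mO mm mg E); apply: le_Rintegral => //.
  exact: (intO_ae mO mm gi E).
by move=> x _; rewrite le_max lexx.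
Qed.

Lemma intO_le f g : mfun3 Omega f -> intO g ->
  (forall x, Omega x -> `|f x| <= g x) ->
  intO f /\ `|\int[leb3]_(x in Omega) f x| <= \int[leb3]_(x in Omega) g x.
Proof.
move=> mf gi fg; have fi : intO f.
  apply: (@le_integrable _ _ _ leb3 _ mO _ (EFin \o g)) => //.
    exact/measurable_EFinP.
  by move=> x Ox; rewrite lee_fin; apply: le_trans (fg x Ox) (ler_norm _).
split=> //; apply: le_trans (le_normr_Rintegral mO fi) _.
apply: le_Rintegral => //; exact: (integrable_norm fi).
Qed.

Lemma intO_bounded_mul (M : R) f g : mfun3 Omega f -> (forall x, `|f x| <= M) ->
  intO g -> intO (fun x => f x * g x).
Proof.
move=> mf fM gi; have mg := intO_mfun gi.
have gi' : intO (fun x => M * `|g x|) by apply: intOZ => //; exact: (integrable_norm gi).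
apply: (intO_le _ gi' _).1; first exact: (measurable_funM mf mg).
by move=> x _; rewrite normrM ler_wpM2r.
Qed.

Lemma lipschitz_dist (L : R) (k : R -> R) : L.-lipschitz k ->
  forall r s, `|k r - k s| <= L * `|r - s|.
Proof. by move=> kL r s; exact: (kL (r, s)). Qed.

Lemma lipschitz_const_ge0 (L : R) (k : R -> R) : L.-lipschitz k -> 0 <= L.
Proof.
move=> /lipschitz_dist /(_ 1 0); rewrite subr0 normr1 mulr1.
exact: le_trans.
Qed.

Lemma lipschitz_mfun (L : R) (k : R -> R) T : L.-lipschitz k -> mfun3 Omega T ->
  mfun3 Omega (fun x => k (T x)).
Proof.
move=> kL mT; have L0 := lipschitz_const_ge0 kL; have kd := lipschitz_dist kL.
have mk : measurable_fun setT k.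
  apply: continuous_measurable_fun => x; apply/cvgrPdist_le => e e0.
  near=> y; apply: le_trans (kd _ _) _.
  apply: (@le_trans _ _ (L * (e / (L + 1)))).
    rewrite ler_wpM2l//; near: y; apply: cvgr_dist_le; first exact: cvg_id.
    by rewrite divr_gt0// ltr_wpDl.
  have L1 : 0 < L + 1 by rewrite ltr_wpDl.
  by rewrite mulrCA ger_pMr// ler_pdivrMr// mul1r lerDl.
exact: (measurableT_comp mk mT).
Unshelve. all: by end_near. Qed.

Variable C4 : R.
Hypothesis emb4 : embedding_const Omega 4 C4.

Let L4 w i : vH10 Omega w -> in_Lp Omega 4 (w i).
Proof. by move=> Hw; exact: (H10_L4 oO emb4 (Hw i)).1. Qed.

Let L2w S i : H10 Omega S -> in_Lp Omega 2 (wpd Omega i S).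
Proof. exact: in_L2_wpd. Qed.

Let L2of4 f g : in_Lp Omega 4 f -> in_Lp Omega 4 g -> in_Lp Omega 2 (f \* g).
Proof. by move=> lf lg; exact: (L4_mul mO lf lg).1. Qed.

Lemma intO_dot u v : vH10 Omega u -> vH10 Omega v ->
  intO (fun x => \sum_i u i x * v i x).
Proof.
move=> Hu Hv; apply: (intO_sum mO) => i.
exact: (L2_mul mO (Hu i).1.1 (Hv i).1.1).1.
Qed.

Lemma intO_convection u v w : vH10 Omega u -> vH10 Omega v -> vH10 Omega w ->
  intO (convection Omega u v w).
Proof.
move=> Hu Hv Hw; apply: (intO_sum mO (F := fun i => transport Omega u (v i) (w i))) => i.
by apply: (transport_bound oO _ (Hv i).1 (L4 i Hw)).1 => j; exact: L4.
Qed.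

(** By [powR_le_sqr] the integrand is at most |u . v| + |u|^2 |u . v|, and both
    |u|^2 and u . v are square integrable, as u and v are in L^4. *)
Lemma intO_drag u v (s : R) : 3 <= s <= 4 -> vH10 Omega u -> vH10 Omega v ->
  intO (fun x => enorm (fun i => u i x) `^ (s - 2) * (\sum_i u i x * v i x)).
Proof.
move=> /andP[s3 s4] Hu Hv.
have lD : in_Lp Omega 2 (fun x => \sum_i u i x * v i x).
  apply: (in_Lp_sum mO (F := fun i => u i \* v i) (ler1n R 2)).
  by move=> i; apply: L2of4; exact: L4.
have lU : in_Lp Omega 2 (fun x => \sum_i u i x * u i x).
  apply: (in_Lp_sum mO (F := fun i => u i \* u i) (ler1n R 2)).
  by move=> i; apply: L2of4; exact: L4.
have i1 := intO_dot Hu Hv; have [i2 _] := L2_mul mO lU lD.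
have gi : intO (fun x => `|\sum_i u i x * v i x| +
    `|(\sum_i u i x * u i x) * (\sum_i u i x * v i x)|).
  by apply: intOD => //; [exact: (integrable_norm i1)|exact: (integrable_norm i2)].
have mE : mfun3 Omega (fun x => enorm (fun i => u i x)).
  apply: (in_Lp_mfun mO (p := 4)).
  by apply: (@in_Lp_root_sum _ _ oO 4 3 u) => [|i]; [exact: ler1n|exact: L4].
apply: (intO_le _ gi _).1.
  have mP := measurableT_comp (measurable_powR (s - 2)) mE.
  exact: (measurable_funM mP (intO_mfun i1)).
move=> x _; rewrite !normrM (ger0_norm (powR_ge0 _ _)).
rewrite -[X in _ <= X + _]mul1r -mulrDl ler_wpM2r//.
apply: le_trans (powR_le_sqr (enorm_ge0 _) _) _; first by apply/andP; split; lra.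
rewrite lerD2l enorm_sqr; apply: le_trans (ler_norm _).
by rewrite le_eqVlt; apply/orP; left; apply/eqP; apply: eq_bigr => i _; rewrite expr2.
Qed.

(** The integrand of the momentum equation, [v] being the test field. *)
Definition momentum (nu : R -> R) (s : R) u p T v : sfield R := fun x =>
  nu (T x) * (\sum_i \sum_j wpd Omega j (u i) x * wpd Omega j (v i) x)
   + convection Omega u u v x
   + \sum_i u i x * v i x
   + enorm (fun i => u i x) `^ (s - 2) * (\sum_i u i x * v i x)
   - p x * divergence Omega v x.

(** The integrand of the heat equation, [S] being the test function. *)
Definition heat (kappa : R -> R) u T S : sfield R := fun x =>
  kappa (T x) * (\sum_i wpd Omega i T x * wpd Omega i S x)
   + (\sum_i u i x * wpd Omega i T x) * S x.

Lemma in_L2_divergence v : vH10 Omega v -> in_Lp Omega 2 (divergence Omega v).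
Proof.
move=> Hv; apply: (in_Lp_sum mO (F := fun i => wpd Omega i (v i)) (ler1n R 2)).
by move=> i; exact: L2w.
Qed.

Lemma intO_momentum (L m M s : R) (nu : R -> R) u p T v :
  L.-lipschitz nu -> 0 < m -> (forall r, m <= nu r <= M) -> 3 <= s <= 4 ->
  vH10 Omega u -> in_Lp Omega 2 p -> mfun3 Omega T -> vH10 Omega v ->
  intO (momentum nu s u p T v).
Proof.
move=> nuL m0 nuM s34 Hu lp mT Hv.
have i1 : intO (fun x => \sum_i \sum_j wpd Omega j (u i) x * wpd Omega j (v i) x).
  apply: (intO_sum mO) => i; apply: (intO_sum mO) => j.
  exact: (L2_mul mO (L2w j (Hu i)) (L2w j (Hv i))).1.
have i2 : intO (fun x => nu (T x) *
    (\sum_i \sum_j wpd Omega j (u i) x * wpd Omega j (v i) x)).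
  apply: (@intO_bounded_mul M) i1; first exact: lipschitz_mfun nuL mT.
  by move=> x; have /andP[a b] := nuM (T x); rewrite ger0_norm// (le_trans (ltW m0)).
have i3 := (L2_mul mO lp (in_L2_divergence Hv)).1.
have i4 : intO (fun x => -1 * (p x * divergence Omega v x)) by exact: intOZ.
have := intOD mO (intOD mO (intOD mO (intOD mO i2 (intO_convection Hu Hu Hv))
  (intO_dot Hu Hv)) (intO_drag s34 Hu Hv)) i4.
by rewrite (_ : (fun x => _) = momentum nu s u p T v)//; apply/funext => x;
  rewrite /momentum mulN1r.
Qed.

Lemma intO_heat (L m M : R) (kappa : R -> R) u T S :
  L.-lipschitz kappa -> 0 < m -> (forall r, m <= kappa r <= M) ->
  vH10 Omega u -> H10 Omega T -> H10 Omega S -> intO (heat kappa u T S).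
Proof.
move=> kL m0 kM Hu HT HS.
have i1 : intO (fun x => \sum_i wpd Omega i T x * wpd Omega i S x).
  by apply: (intO_sum mO) => i; exact: (L2_mul mO (L2w i HT) (L2w i HS)).1.
apply: (intOD mO).
  apply: (@intO_bounded_mul M) i1; first exact: lipschitz_mfun kL (in_Lp_mfun mO HT.1.1).
  by move=> x; have /andP[a b] := kM (T x); rewrite ger0_norm// (le_trans (ltW m0)).
by apply: (transport_bound oO _ HT.1 (H10_L4 oO emb4 HS).1).1 => j; exact: L4.
Qed.

End Integrands.

(** * Energy estimates and uniqueness *)

Section Uniqueness.
Context {R : realType}.
Variables (Omega : set (E3 R)) (s : R) (nu kappa : R -> R).
Variables (L_nu L_kappa nu_m nu_p kappa_m kappa_p : R).
Variables (F : vfield R -> R) (G : sfield R -> R) (C_N C_4 C_6 : R).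
Hypothesis oO : open Omega.
Hypothesis fO : (leb3 Omega < +oo)%E.
Hypothesis hs : 3 <= s <= 4.
Hypotheses (hnu_lip : L_nu.-lipschitz nu) (hkappa_lip : L_kappa.-lipschitz kappa).
Hypotheses (hnu_m : 0 < nu_m) (hkappa_m : 0 < kappa_m).
Hypothesis hnu : forall r, nu_m <= nu r <= nu_p.
Hypothesis hkappa : forall r, kappa_m <= kappa r <= kappa_p.
Hypotheses (hF : vHm1 Omega F) (hG : Hm1 Omega G).
Hypothesis hconv : convection_const Omega C_N.
Hypotheses (emb4 : embedding_const Omega 4 C_4) (C4_ge0 : 0 <= C_4).
Hypotheses (emb6 : embedding_const Omega 6 C_6) (C6_ge0 : 0 <= C_6).

Implicit Types (f g h p S T : sfield R) (u v w : vfield R).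

Let mO : meas3 Omega := open_measurable3 oO.
Notation intO f := (leb3.-integrable Omega (EFin \o f)).
Notation gn := (grad_norm Omega 2).
Notation vgn := (vgrad_norm Omega 2).
Notation sol := (weak_solution Omega s nu kappa F G).
Notation "'Int' f" := (\int[leb3]_(x in Omega) f x) (at level 10, f at level 9).

Lemma intOB f g : intO f -> intO g -> intO (fun x => f x - g x).
Proof.
move=> fi gi; have := intOD mO fi (intOZ mO (-1) gi).
by rewrite (_ : (fun x => _) = fun x => f x - g x)//; apply/funext => x; rewrite mulN1r.
Qed.

Lemma sol_momentum u p T v : sol u p T -> vH10 Omega v ->
  Int (momentum Omega nu s u p T v) = F v.
Proof.
move=> [_ lp _ eqs] Hv; have [] := eqs v p 0 Hv lp (H100 oO); by [].
Qed.

Lemma sol_heat u p T S : sol u p T -> H10 Omega S ->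
  Int (heat Omega kappa u T S) = G S.
Proof.
move=> [_ lp _ eqs] HS; have [] := eqs 0 p S (vH100 oO) lp HS; by [].
Qed.

(** The divergence has zero mean by [Rintegral_wpd], so that it may be taken as
    the pressure test function in the second equation. *)
Lemma sol_divergence u p T : sol u p T ->
  {ae leb3, forall x, Omega x -> divergence Omega u x = 0}.
Proof.
move=> [Hu _ _ eqs]; have ld := in_L2_divergence oO Hu.
have ld0 : L20 Omega (divergence Omega u).
  split=> //; rewrite Rintegral_sum// => [|i].
    by rewrite big1// => i _; exact: Rintegral_wpd.
  exact: (L2_intO oO fO (in_L2_wpd oO i (Hu i))).1.
have [_ E _] := eqs 0 _ 0 (vH100 oO) ld0 (H100 oO).
apply: L2_eq0_ae => //; apply/eqP; rewrite -sqrf_eq0 (L2_sqr mO ld).2 -[X in _ == X]E.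
by apply/eqP; apply: eq_Rintegral => x _; rewrite expr2.
Qed.

Lemma convection_skew u w : vH10 Omega u ->
  {ae leb3, forall x, Omega x -> divergence Omega u x = 0} -> vH10 Omega w ->
  Int (convection Omega u w w) = 0.
Proof.
move=> Hu du Hw.
transitivity (\sum_i Int (transport Omega u (w i) (w i))).
  apply: (Rintegral_sum mO (F := fun i => transport Omega u (w i) (w i))) => i.
  by apply: (transport_bound oO _ (Hw i).1 (H10_L4 oO emb4 (Hw i)).1).1 => j;
    exact: (H10_L4 oO emb4 (Hu j)).1.
by rewrite big1// => i _; exact: (transport_skew oO emb4 Hu du (Hw i)).
Qed.

Lemma intO_transport u S T : vH10 Omega u -> H10 Omega S -> H10 Omega T ->
  intO (transport Omega u S T).
Proof.
move=> Hu HS HT; apply: (transport_bound oO _ HS.1 (H10_L4 oO emb4 HT).1).1 => j.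
exact: (H10_L4 oO emb4 (Hu j)).1.
Qed.

Lemma gn_sqr T : H10 Omega T ->
  intO (fun x => enorm (fun i => wpd Omega i T x) ^+ 2) /\
  gn T ^+ 2 = \int[leb3]_(x in Omega) enorm (fun i => wpd Omega i T x) ^+ 2.
Proof. by move=> HT; exact: (L2_sqr mO (in_Lp_grad oO (ler1n R 2) HT.1)). Qed.

Definition vgrad u : sfield R :=
  fun x => Num.sqrt (\sum_i \sum_j wpd Omega j (u i) x ^+ 2).

Lemma in_L2_vgrad u : vH10 Omega u -> in_Lp Omega 2 (vgrad u).
Proof. by move=> Hu; exact: (in_Lp_vgrad oO (ler1n R 2) (vH10_W12 Hu)). Qed.

Lemma vgn_sqr u : vH10 Omega u ->
  intO (fun x => vgrad u x ^+ 2) /\ vgn u ^+ 2 = \int[leb3]_(x in Omega) vgrad u x ^+ 2.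
Proof. by move=> Hu; exact: (L2_sqr mO (in_L2_vgrad Hu)). Qed.

(** The heat equation is tested with [T] itself, which cancels the transport
    term. *)
Lemma sol_grad_temperature u p T : sol u p T -> kappa_m * gn T <= Hm1_norm Omega G.
Proof.
move=> sT; have du := sol_divergence sT; have [Hu _ HT _] := sT.
apply: le_energy; rewrite ?grad_norm_ge0 ?(Hm1_norm_ge0 oO hG)//.
have [iT ->] := gn_sqr HT.
apply: le_trans (le_trans (ler_norm _) (Hm1_bound oO hG HT)).
have ih := intO_heat oO emb4 hkappa_lip hkappa_m hkappa Hu HT HT.
have it := intO_transport Hu HT HT.
rewrite -(sol_heat sT HT) -[leRHS]subr0 -(transport_skew oO emb4 Hu du HT).
rewrite -RintegralB// -RintegralZl//; apply: le_Rintegral => //.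
- exact: intOZ.
- exact: intOB.
move=> x _; rewrite /heat /transport addrK enorm_sqr.
have /andP[km _] := hkappa (T x).
rewrite (eq_bigr (fun i => wpd Omega i T x ^+ 2)); last by move=> i _; rewrite expr2.
by apply: ler_wpM2r => //; apply: sumr_ge0 => i _; exact: sqr_ge0.
Qed.

Lemma vHm1_norm_ge0 : 0 <= vHm1_norm Omega F.
Proof.
by move: hF; apply: dual_norm_ge0;
  [exact: vH100|move=> w; exact: vgrad_norm_ge0|exact: vgrad_normZ].
Qed.

(** The momentum equation is tested with [u] itself: convection and pressure
    cancel, and the zero order terms have the good sign. *)
Lemma sol_grad_velocity u p T : sol u p T -> nu_m * vgn u <= vHm1_norm Omega F.
Proof.
move=> sT; have du := sol_divergence sT; have [Hu lp HT _] := sT.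
apply: le_energy; rewrite ?vgrad_norm_ge0 ?vHm1_norm_ge0//.
have [iu ->] := vgn_sqr Hu.
apply: le_trans (le_trans (ler_norm _) (vHm1_bound oO hF Hu)).
have im := intO_momentum oO emb4 hnu_lip hnu_m hnu hs Hu lp.1 (in_Lp_mfun mO HT.1.1) Hu.
have ic := intO_convection oO emb4 Hu Hu Hu.
rewrite -(sol_momentum sT Hu) -[leRHS]subr0 -(convection_skew Hu du Hu).
rewrite -RintegralB// -RintegralZl//; apply: le_Rintegral_ae => //.
- exact: intOZ.
- exact: intOB.
apply: filterS du => x d Ox; rewrite /momentum (d Ox) mulr0 subr0.
have /andP[nm _] := hnu (T x).
have S0 : 0 <= \sum_i \sum_j wpd Omega j (u i) x ^+ 2.
  by apply: sumr_ge0 => i _; apply: sumr_ge0 => j _; exact: sqr_ge0.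
have U0 : 0 <= \sum_i u i x * u i x.
  by apply: sumr_ge0 => i _; rewrite -expr2 sqr_ge0.
rewrite /vgrad sqr_sqrtr//.
rewrite [X in nu (T x) * X](_ : _ = \sum_i \sum_j wpd Omega j (u i) x ^+ 2); last first.
  by apply: eq_bigr => i _; apply: eq_bigr => j _; rewrite expr2.
have h1 := ler_wpM2r S0 nm.
have h2 := mulr_ge0 (powR_ge0 (enorm (fun i => u i x)) (s - 2)) U0.
move: h1 h2 U0; set A := \sum_i \sum_j _; set B := _ `^ _ * _; set D := \sum_i _.
set E := convection _ _ _ _ _; lra.
Qed.


Lemma hoelder_L6_L3_L2 S g h : H10 Omega S -> in_Lp Omega 3 g -> in_Lp Omega 2 h ->
  intO (fun x => `|S x| * g x * h x) /\
  Int (fun x => `|S x| * g x * h x) <=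
    C_6 * gn S * Lp_norm Omega 3 g * Lp_norm Omega 2 h.
Proof.
move=> HS lg lh; have [l6 b6] := H10_embed oO (ltr0n R 6) emb6 HS.
have [la ba] := in_Lp_abs mO (ltr0n R 6) l6.
have [l b] := L63_mul mO la lg; have [i bi] := L2_mul mO l lh; split=> //.
apply: le_trans (le_trans (ler_norm _) bi) _.
apply: ler_wpM2r; first exact: Lp_norm_ge0.
apply: le_trans b _; apply: ler_wpM2r; first exact: Lp_norm_ge0.
exact: le_trans ba b6.
Qed.

Lemma hoelder_transport w S T : vH10 Omega w -> H10 Omega S -> H10 Omega T ->
  `|Int (transport Omega w S T)| <= C_4 ^+ 2 * vgn w * gn S * gn T.
Proof.
move=> Hw HS HT; have [lw bw] := vH10_L4 oO C4_ge0 emb4 Hw.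
have [lT bT] := H10_L4 oO emb4 HT.
have lS := in_Lp_grad oO (ler1n R 2) HS.1.
have [la ba] := in_Lp_abs mO (ltr0n R 4) lT.
have [l b] := L4_mul mO lw la; have [i bi] := L2_mul mO l lS.
have [|_ bt] := intO_le oO (intO_mfun (intO_transport Hw HS HT)) i.
  move=> x _; rewrite /transport normrM /= mulrAC; apply: ler_wpM2r => //.
  exact: cauchy_schwarz.
apply: le_trans bt (le_trans (le_trans (ler_norm _) bi) _).
rewrite mulrAC; apply: ler_wpM2r; first exact: grad_norm_ge0.
apply: le_trans b _.
rewrite (_ : _ * _ * _ = (C_4 * vgn w) * (C_4 * gn T)); last by ring.
apply: ler_pM; [exact: Lp_norm_ge0|exact: Lp_norm_ge0|exact: bw|].
exact: le_trans ba bT.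
Qed.

Section Difference.
Variables (u1 u2 : vfield R) (p1 T1 p2 T2 : sfield R).
Hypotheses (s1 : sol u1 p1 T1) (s2 : sol u2 p2 T2).
Hypotheses (hu1 : vW1p Omega 3 u1) (hT1 : W1p Omega 3 T1).

Let W : vfield R := fun i => -1 *: u1 i + u2 i.
Let th : sfield R := -1 *: T1 + T2.

Let Hu1 : vH10 Omega u1. Proof. by have [] := s1. Qed.
Let Hu2 : vH10 Omega u2. Proof. by have [] := s2. Qed.
Let HT1 : H10 Omega T1. Proof. by have [] := s1. Qed.
Let HT2 : H10 Omega T2. Proof. by have [] := s2. Qed.
Let lp1 : in_Lp Omega 2 p1. Proof. by have [_ []] := s1. Qed.
Let lp2 : in_Lp Omega 2 p2. Proof. by have [_ []] := s2. Qed.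

Let HW : vH10 Omega W.
Proof. by move=> i; exact: (H10_lin oO (-1) (Hu1 i) (Hu2 i)). Qed.

Let Hth : H10 Omega th.
Proof. exact: (H10_lin oO (-1) HT1 HT2). Qed.

Let WE i x : W i x = u2 i x - u1 i x.
Proof. by rewrite /W !fctE scaleN1r addrC. Qed.

Let thE x : th x = T2 x - T1 x.
Proof. by rewrite /th !fctE scaleN1r addrC. Qed.

Let wpd_th : {ae leb3, forall x, Omega x -> forall i,
  wpd Omega i th x = wpd Omega i T2 x - wpd Omega i T1 x}.
Proof.
have H := ae_forall3
  (fun j => wpd_lin oO (-1) j (ltr0n R 2) HT1.1 HT2.1).
by apply: filterS H => x H Ox i; rewrite H// mulN1r addrC.
Qed.

Let wpd_W : {ae leb3, forall x, Omega x -> forall i j,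
  wpd Omega j (W i) x = wpd Omega j (u2 i) x - wpd Omega j (u1 i) x}.
Proof.
have H := ae_forall3 (fun i =>
  ae_forall3
  (fun j => wpd_lin oO (-1) j (ltr0n R 2) (Hu1 i).1 (Hu2 i).1)).
by apply: filterS H => x H Ox i j; rewrite H// mulN1r addrC.
Qed.

Let div_W : {ae leb3, forall x, Omega x -> divergence Omega W x = 0}.
Proof.
have := @filterS3 _ _ ae_leb3_filter _ _ _ _ _ wpd_W (sol_divergence s1) (sol_divergence s2).
apply => x wE d1 d2 Ox; rewrite /divergence; under eq_bigr do rewrite wE//.
by rewrite sumrB -!/(divergence _ _ _) d1// d2// subrr.
Qed.

Let mT1 : mfun3 Omega T1. Proof. exact: (in_Lp_mfun mO HT1.1.1). Qed.
Let mT2 : mfun3 Omega T2. Proof. exact: (in_Lp_mfun mO HT2.1.1). Qed.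

(** [heat_pointwise] is integrated. The two heat integrals have the same value
    [G th], and u2 . grad th is skew. *)
Lemma temperature_difference :
  kappa_m * gn th ^+ 2 <= L_kappa * (C_6 * gn th * grad_norm Omega 3 T1 * gn th)
    + C_4 ^+ 2 * vgn W * gn T1 * gn th.
Proof.
have [ic bc] := hoelder_L6_L3_L2 Hth (in_Lp_grad oO (ler1n R 3) hT1)
  (in_Lp_grad oO (ler1n R 2) Hth.1).
have [it ->] := gn_sqr Hth.
have ih1 := intO_heat oO emb4 hkappa_lip hkappa_m hkappa Hu1 HT1 Hth.
have ih2 := intO_heat oO emb4 hkappa_lip hkappa_m hkappa Hu2 HT2 Hth.
have i3 := intO_transport Hu2 Hth Hth; have i4 := intO_transport HW HT1 Hth.
have skew := transport_skew oO emb4 Hu2 (sol_divergence s2) Hth.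
have L0 := lipschitz_const_ge0 hkappa_lip.
(* The right-hand side of [heat_pointwise]. *)
pose rhs := fun x => heat Omega kappa u2 T2 th x - heat Omega kappa u1 T1 th x +
  L_kappa * (`|th x| * enorm (fun i => wpd Omega i T1 x) * enorm (fun i => wpd Omega i th x))
  - transport Omega u2 th th x - transport Omega W T1 th x.
have i5 := intOB ih2 ih1; have i6 := intOD mO i5 (intOZ mO L_kappa ic).
have i7 := intOB i6 i3; have i8 : intO rhs := intOB i7 i4.
have E : Int rhs = L_kappa * Int (fun x => `|th x| * enorm (fun i => wpd Omega i T1 x)
                 * enorm (fun i => wpd Omega i th x)) - Int (transport Omega W T1 th).
  rewrite /rhs RintegralB// RintegralB// skew subr0 RintegralD//; last exact: intOZ.
  by rewrite RintegralB// RintegralZl// (sol_heat s2 Hth) (sol_heat s1 Hth) subrr add0r.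
rewrite -RintegralZl//.
apply: (@le_trans _ _ (Int rhs)).
  apply: le_Rintegral_ae => //; first exact: intOZ.
  apply: filterS wpd_th => x wE Ox; rewrite /rhs /heat /transport.
  have /andP[km _] := hkappa (T2 x).
  exact: (heat_pointwise (fun i => wE Ox i) (fun i => WE i x) (thE x) km
    (lipschitz_dist hkappa_lip _ _)).
rewrite E; apply: lerD; first exact: ler_wpM2l.
by apply: le_trans (hoelder_transport HW HT1 Hth); rewrite -normrN ler_norm.
Qed.

(** [momentum_pointwise] is integrated. The two momentum integrals have the same
    value [F W], and the convection by [u2] is skew. *)
Lemma velocity_difference :
  nu_m * vgn W ^+ 2 <= L_nu * (C_6 * gn th * vgrad_norm Omega 3 u1 * vgn W)
    + C_N * vgn W * vgn u1 * vgn W.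
Proof.
have [ic bc] := hoelder_L6_L3_L2 Hth (in_Lp_vgrad oO (ler1n R 3) hu1) (in_L2_vgrad HW).
rewrite -!/(vgrad _) in ic bc.
have [it ->] := vgn_sqr HW.
have im1 := intO_momentum oO emb4 hnu_lip hnu_m hnu hs Hu1 lp1 mT1 HW.
have im2 := intO_momentum oO emb4 hnu_lip hnu_m hnu hs Hu2 lp2 mT2 HW.
have i3 := intO_convection oO emb4 Hu2 HW HW.
have i4 := intO_convection oO emb4 HW Hu1 HW.
have skew := convection_skew Hu2 (sol_divergence s2) HW.
have L0 := lipschitz_const_ge0 hnu_lip.
(* The right-hand side of [momentum_pointwise]. *)
pose rhs := fun x => momentum Omega nu s u2 p2 T2 W x - momentum Omega nu s u1 p1 T1 W x +
  L_nu * (`|th x| * vgrad u1 x * vgrad W x)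
  - convection Omega u2 W W x - convection Omega W u1 W x.
have i5 := intOB im2 im1; have i6 := intOD mO i5 (intOZ mO L_nu ic).
have i7 := intOB i6 i3; have i8 : intO rhs := intOB i7 i4.
have E : Int rhs = L_nu * Int (fun x => `|th x| * vgrad u1 x * vgrad W x)
    - Int (convection Omega W u1 W).
  rewrite /rhs RintegralB// RintegralB// skew subr0 RintegralD//; last exact: intOZ.
  by rewrite RintegralB// RintegralZl// (sol_momentum s2 HW) (sol_momentum s1 HW) subrr add0r.
rewrite -RintegralZl//.
apply: (@le_trans _ _ (Int rhs)).
  apply: le_Rintegral_ae => //; first exact: intOZ.
  have := @filterS2 _ _ ae_leb3_filter _ _ _ _ wpd_W div_W.
  apply => x wE d0 Ox; rewrite /rhs /momentum.
  have /andP[nm _] := hnu (T2 x).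
  have r0 : 0 <= s - 2 by have /andP[s3 _] := hs; rewrite subr_ge0 (le_trans _ s3)// ler_nat.
  exact: (momentum_pointwise _ _ (fun i j => wE Ox i j) (fun i => WE i x) (thE x) r0 nm
    (lipschitz_dist hnu_lip _ _) (d0 Ox)).
rewrite E; apply: lerD; first exact: ler_wpM2l.
by apply: le_trans (hconv HW Hu1 HW); rewrite -normrN ler_norm.
Qed.

Hypothesis C_N_ge0 : 0 <= C_N.
Hypothesis small_T1 : L_kappa * C_6 * grad_norm Omega 3 T1 < kappa_m.
Hypothesis small_data : C_N / nu_m ^+ 2 * vHm1_norm Omega F
  + L_nu * C_6 * C_4 ^+ 2 * Hm1_norm Omega G * vgrad_norm Omega 3 u1
    / (nu_m * kappa_m * (kappa_m - L_kappa * C_6 * grad_norm Omega 3 T1)) < 1.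

Lemma difference_gradients_eq0 : vgn W = 0 /\ gn th = 0.
Proof.
exact: (small_data_eq0 hnu_m hkappa_m (lipschitz_const_ge0 hnu_lip) C6_ge0 C_N_ge0
  (vgrad_norm_ge0 _ _ _) (vgrad_norm_ge0 _ _ _) (grad_norm_ge0 _ _ _)
  (grad_norm_ge0 _ _ _) temperature_difference velocity_difference
  (sol_grad_temperature s1) (sol_grad_velocity s1) small_T1 small_data).
Qed.

Lemma H10_eq0_ae S : H10 Omega S -> gn S = 0 ->
  {ae leb3, forall x, Omega x -> S x = 0 /\ forall i, wpd Omega i S x = 0}.
Proof.
move=> HS g0; have [l b] := H10_L4 oO emb4 HS.
have n40 : Lp_norm Omega 4 S = 0.
  by apply/eqP; rewrite eq_le Lp_norm_ge0 andbT -(mulr0 C_4) -g0.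
have l2 := L4_mul mO l l; rewrite n40 mulr0 in l2.
have S0 := L2_eq0_ae oO l2.1 (le_anti (introT andP (conj l2.2 (Lp_norm_ge0 _ _ _)))).
have d0 i : {ae leb3, forall x, Omega x -> wpd Omega i S x = 0}.
  apply: (L2_eq0_ae oO (in_L2_wpd oO i HS)); apply/eqP.
  rewrite eq_le Lp_norm_ge0 andbT -g0; exact: (wpd_norm_le oO i HS.1).
have := @filterS2 _ _ ae_leb3_filter _ _ _ _ S0
  (ae_forall3 d0).
apply => x s0 w0 Ox; split=> [|i]; last exact: w0.
by apply/eqP; have /eqP := s0 Ox; rewrite /= mulf_eq0 orbb.
Qed.

Lemma velocity_temperature_unique : {ae leb3, forall x, Omega x ->
  [/\ forall i, u2 i x = u1 i x, T2 x = T1 x &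
      forall i j, wpd Omega j (u2 i) x = wpd Omega j (u1 i) x]}.
Proof.
have [w0 t0] := difference_gradients_eq0.
have W0 i : gn (W i) = 0.
  apply/eqP; rewrite eq_le grad_norm_ge0 andbT -w0; exact: (grad_norm_le_vgrad oO i HW).
have := @filterS3 _ _ ae_leb3_filter _ _ _ _ _
  (ae_forall3 (fun i => H10_eq0_ae (HW i) (W0 i)))
  (H10_eq0_ae Hth t0) wpd_W.
apply => x hW ht wE Ox; have [tx _] := ht Ox; split=> [i||i j].
- by have [Wx _] := hW i Ox; apply/eqP; rewrite -subr_eq0 -WE Wx.
- by apply/eqP; rewrite -subr_eq0 -thE tx.
- by have [_ d] := hW i Ox; apply/eqP; rewrite -subr_eq0 -wE// d.
Qed.

(** The momentum equations are tested with the field whose i-th component is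
    [phi], the other ones being 0. All terms but the pressures agree. *)
Lemma pressure_gradient i phi : test_fun Omega phi ->
  Int (fun x => (p1 x - p2 x) * 'D_(evec i) phi x) = 0.
Proof.
move=> tphi; pose v : vfield R := fun k => if k == i then phi else cst 0.
have tv k : test_fun Omega (v k) by rewrite /v; case: ifP => // _; exact: test_fun0.
have Hv : vH10 Omega v by move=> k; exact: (H10_test oO (tv k)).
have im1 := intO_momentum oO emb4 hnu_lip hnu_m hnu hs Hu1 lp1 mT1 Hv.
have im2 := intO_momentum oO emb4 hnu_lip hnu_m hnu hs Hu2 lp2 mT2 Hv.
have divv : {ae leb3, forall x, Omega x -> divergence Omega v x = 'D_(evec i) phi x}.
  have := ae_forall3
    (fun k => wpd_ae oO (weak_partial_test k mO (tv k))).
  apply: filterS => x vE Ox; rewrite /divergence; under eq_bigr do rewrite vE//.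
  rewrite (bigD1 i)//= big1 ?addr0 => [|k ki]; first by rewrite /v eqxx.
  by rewrite /v (negPf ki) derive_cst.
have md : mfun3 Omega ('D_(evec i) phi).
  exact: (in_Lp_mfun mO (test_fun_in_Lp oO (ltr0n R 2) (test_fun_derive i tphi))).
have mD : mfun3 Omega (fun x => (p1 x - p2 x) * 'D_(evec i) phi x).
  apply: measurable_funM md.
  by apply: measurable_funB; [exact: (in_Lp_mfun mO lp1)|exact: (in_Lp_mfun mO lp2)].
have i3 := intOB im2 im1.
rewrite (@Rintegral_ae _ _ mO _ (fun x => momentum Omega nu s u2 p2 T2 v x -
  momentum Omega nu s u1 p1 T1 v x) mD (intO_mfun i3)).
  by rewrite RintegralB// (sol_momentum s2 Hv) (sol_momentum s1 Hv) subrr.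
have := @filterS2 _ _ ae_leb3_filter _ _ _ _ velocity_temperature_unique divv.
apply => x uT dv Ox; have [uE tE dE] := uT Ox.
rewrite -dv// /momentum tE (_ : u2^~ x = u1^~ x); last exact/funext.
have -> : convection Omega u2 u2 v x = convection Omega u1 u1 v x.
  by apply: eq_bigr => k _; congr (_ * _); apply: eq_bigr => j _; rewrite uE dE.
have -> : \sum_k u2 k x * v k x = \sum_k u1 k x * v k x.
  by apply: eq_bigr => k _; rewrite uE.
have -> : \sum_k \sum_j wpd Omega j (u2 k) x * wpd Omega j (v k) x =
    \sum_k \sum_j wpd Omega j (u1 k) x * wpd Omega j (v k) x.
  by apply: eq_bigr => k _; apply: eq_bigr => j _; rewrite dE.
have cancel (X d a b : R) : (a - b) * d = X - b * d - (X - a * d) by ring.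
exact: cancel.
Qed.

Hypotheses (conO : connected Omega) (neO : Omega !=set0).

(** By [zero_gradient_cst] the pressures differ by a constant, which is 0 because
    both have zero mean and [Omega] has positive measure. *)
Lemma pressure_unique : {ae leb3, forall x, Omega x -> p2 x = p1 x}.
Proof.
have ip1 := (L2_intO oO fO lp1).1; have ip2 := (L2_intO oO fO lp2).1;
have ip := intOB ip1 ip2.
have lpl : loc_integrable Omega (fun x => p1 x - p2 x).
  move=> K cK KO; apply: (@integrableS _ _ _ leb3 Omega K) => //.
  exact: compact_measurable3.
have [c pc] := zero_gradient_cst oO conO neO lpl pressure_gradient.
have ic : intO (cst c).
  have mc : mfun3 Omega (cst c) by exact: measurable_cst.
  by apply: (intO_ae mO mc ip); apply: filterS pc => x H /H.
have c0 : c * fine (leb3 Omega) = 0.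
  rewrite -(Rintegral_cst leb3 mO c) -(Rintegral_ae mO (intO_mfun ip) (intO_mfun ic) pc).
  have [_ [_ z1] _ _] := s1; have [_ [_ z2] _ _] := s2.
  by rewrite RintegralB// z1 z2 subrr.
suff m0 : fine (leb3 Omega) != 0.
  move/eqP: c0; rewrite mulf_eq0 (negPf m0) orbF => /eqP c0.
  by apply: filterS pc => x H /H; rewrite c0 => /eqP; rewrite subr_eq0 => /eqP.
apply/negP => /eqP m0; have [x Ox] := neO.
suff : {ae leb3, forall y, Omega y -> False} by move=> /(open_ae_ex oO Ox)[].
have L0 : leb3 Omega = 0%E by rewrite -[LHS]fineK ?m0// ge0_fin_numE.
by exists Omega; split=> // y /= H; apply: contrapT => nOy; apply: H => /nOy.
Qed.

Lemma weak_solution_unique : {ae leb3, forall x, Omega x ->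
  [/\ forall i, u2 i x = u1 i x, p2 x = p1 x & T2 x = T1 x]}.
Proof.
have := @filterS2 _ _ ae_leb3_filter _ _ _ _ velocity_temperature_unique pressure_unique.
by apply => x uT pE Ox; have [uE tE _] := uT Ox; split=> //; exact: pE.
Qed.

End Difference.

End Uniqueness.

Theorem theorem3p3 (R : realType) (Omega : set (E3 R)) (s : R)
  (nu kappa : R -> R) (L_nu L_kappa nu_m nu_p kappa_m kappa_p : R)
  (f : vfield R -> R) (g : sfield R -> R)
  (C_N C_4 C_6 : R) (u1 : vfield R) (p1 T1 : sfield R)
  (hOmega : lipschitz_domain Omega)
  (hs : 3 <= s <= 4)
  (hnu_lip : L_nu.-lipschitz nu) (hkappa_lip : L_kappa.-lipschitz kappa)
  (hnu_m : 0 < nu_m) (hnu_p : 0 < nu_p)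
  (hkappa_m : 0 < kappa_m) (hkappa_p : 0 < kappa_p)
  (hnu : forall r, nu_m <= nu r <= nu_p)
  (hkappa : forall r, kappa_m <= kappa r <= kappa_p)
  (hf : vHm1 Omega f) (hg : Hm1 Omega g)
  (hC_N : 0 < C_N) (hconv : convection_const Omega C_N)
  (hC_4 : best_embedding_const Omega 4 C_4)
  (hC_6 : best_embedding_const Omega 6 C_6)
  (hsol1 : weak_solution Omega s nu kappa f g u1 p1 T1)
  (hu1 : vW1p Omega 3 u1) (hT1 : W1p Omega 3 T1)
  (hsmall : C_N / nu_m ^+ 2 * vHm1_norm Omega f
      + L_nu * C_6 * C_4 ^+ 2 * Hm1_norm Omega g * vgrad_norm Omega 3 u1
        / (nu_m * kappa_m * (kappa_m - L_kappa * C_6 * grad_norm Omega 3 T1)) < 1)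
  (hT1_small : L_kappa * C_6 * grad_norm Omega 3 T1 < kappa_m) :
  forall (u2 : vfield R) (p2 T2 : sfield R),
    weak_solution Omega s nu kappa f g u2 p2 T2 ->
    {ae leb3, forall x, Omega x ->
      [/\ forall i, u2 i x = u1 i x, p2 x = p1 x & T2 x = T1 x]}.
Proof.
move=> u2 p2 T2 hsol2.
have [neO oO conO bO _] := hOmega.
exact: (weak_solution_unique oO (bounded_leb3_fin (open_measurable3 oO) bO) hs
  hnu_lip hkappa_lip hnu_m hkappa_m hnu hkappa hf hg hconv hC_4.1
  (best_embedding_ge0 hC_4) hC_6.1 (best_embedding_ge0 hC_6)
  hsol1 hsol2 hu1 hT1 (ltW hC_N) hT1_small hsmall conO neO).
Qed.
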